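(* In the additive growth curve model $Y=\sum_{i=1}^kX_i\Theta_iZ_i'+\mathcal E$ with orthogonal design matrices (as specified in the context), suppose that (i) for each $l=1,\dots,k$, $\lim_{n\to\infty}n^{-1}X_l'X_l=R_l$, where $R_l$ is positive definite; and (ii) $\mathrm E(\mathcal E_1)=\mathbf 0$, $\mathrm E(\mathcal E_1\mathcal E_1')=\Sigma>\mathbf 0$, $\mathrm E(\mathcal E_1\otimes\mathcal E_1\mathcal E_1')=\mathbf 0_{p^2\times p}$ and $\mathrm E\Vert\mathcal E_1\Vert^4<\infty$, where $\mathcal E_1'$ is the first row vector of the error matrix $\mathcal E$. Then the following hold: (a) $\sqrt n\,(\widehat\Sigma(Y)-\Sigma)$ converges in distribution to $\mathcal N\bigl(\mathbf 0,\operatorname{Cov}(\mathcal E_1'\otimes\mathcal E_1')\bigr)$ as $n\to\infty$. (b) For each $i$, $\sqrt n\,(\widehat\Sigma(Y)-\Sigma)$ and $\sqrt n\,(\widehat\Theta_i(Y)-\Theta_i)$ are asymptotically independent. (c) For any distinct $i,j$, $\sqrt n\,(\widehat\Theta_i(Y)-\Theta_i)$ and $\sqrt n\,(\widehat\Theta_j(Y)-\Theta_j)$ are independent.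
   Context: Model. For each sample size $n$, $Y$ (depending on $n$) is an $n\times p$ random matrix of observations with $Y=\sum_{i=1}^kX_i\Theta_iZ_i'+\mathcal E$. For $1\le i\le k$, $X_i$ (depending on $n$) is a known $n\times m_i$ design matrix ($n>m_i$) of full rank $m_i$, $Z_i$ is a known $p\times q_i$ profile matrix ($p>q_i$) of full rank $q_i$, and $\Theta_i$ is an unknown $m_i\times q_i$ matrix of regression coefficients; $k,p,m_i,q_i,Z_i,\Theta_i$ do not depend on $n$. The $n\times p$ error matrix $\mathcal E$ (depending on $n$) has a general continuous type distribution; its rows are independent and identically distributed with mean zero and common unknown $p\times p$ covariance matrix $\Sigma$. The design matrices satisfy $\operatorname{rank}(X_i)+p\le n$ for all $i$ and $X_i'X_j=\mathbf 0$ for all distinct $i,j$. As $n$ grows, new rows are added to the matrices $X_i$ (and to $Y,\mathcal E$), earlier rows remaining intact. Notation. $A'$ is the transpose, $P_A=A(A'A)^-A'$ the orthogonal projection onto the column space of $A$, $\otimes$ the Kronecker product. $\operatorname{vec}$ stacks the rows of a matrix one underneath another into a column vector; convergence in distribution of the matrix in (a) to a normal law means that its $\operatorname{vec}$ converges to the normal law on $\mathbb R^{p^2}$ with mean zero and the stated covariance matrix (the $p^2\times p^2$ covariance matrix of the random vector $\mathcal E_1'\otimes\mathcal E_1'$). Estimators. $\widehat\Sigma(Y)=Y'WY$, $W=\frac1r\bigl(I-\sum_{i=1}^kP_{X_i}\bigr)$, $r=n-\sum_{i=1}^k\operatorname{rank}(X_i)$. The paper takes $\widehat\Sigma(Y)$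 to be positive definite with probability one, so its inverse $\widehat\Sigma^{-1}(Y)$ exists with probability one. Further, $H_i(Y)=\widehat\Sigma^{-1}(Y)Z_i\bigl(Z_i'\widehat\Sigma^{-1}(Y)Z_i\bigr)^{-1}Z_i'$ and $\widehat\Theta_i(Y)=(X_i'X_i)^{-1}X_i'\,Y\,H_i(Y)\,Z_i(Z_i'Z_i)^{-1}$.
   Formalization: In (c), ''independent'' is stated as asymptotically independent (the joint limit law is a product): exact independence is false, e.g. for normal errors with p=2 and Z_1=Z_2=(1,0)', since both estimators share the random factor from the inverse of the estimated covariance. *)

(* Defs.v *)
From HB Require Import structures.
From mathcomp Require Import all_boot all_order all_algebra.
From mathcomp Require Import all_classical all_reals all_analysis.
From mathcomp Require Export mxtens.

Set Implicit Arguments.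
Unset Strict Implicit.
Unset Printing Implicit Defensive.

Import Order.TTheory GRing.Theory Num.Theory.
Import numFieldNormedType.Exports.

Local Open Scope classical_set_scope.
Local Open Scope ring_scope.

(* Matrices with the Borel sigma-algebra of their (entrywise) topology. *)
Definition borel_mx (R : realType) (m n : nat) :=
  g_sigma_algebraType (@open 'M[R]_(m, n)).

Section linear_algebra.
Context {R : realType}.

Definition posdefmx n (A : 'M[R]_n) : Prop :=
  A^T = A /\ forall x : 'cV[R]_n, x != 0 -> 0 < (x^T *m A *m x) 0 0.

(* mxvec lists the entries row by row, as vec does, but as a row vector. *)
Definition vec m n (A : 'M[R]_(m, n)) : 'cV[R]_(m * n) := (mxvec A)^T.

(* pinvmx B is a generalized inverse of B: B *m pinvmx B *m B = B. *)
Definition projmx n m (A : 'M[R]_(n, m)) : 'M[R]_n :=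
  A *m pinvmx (A^T *m A) *m A^T.

(* Euclidean norm; `|x| on row vectors is the maximum norm. *)
Definition enorm p (x : 'rV[R]_p) : R := Num.sqrt (\sum_j x 0 j ^+ 2).

End linear_algebra.

Section probability.
Context {R : realType} {d : measure_display} {T : measurableType d}.
Variable P : probability T R.

(* fine sends infinite values to 0, so these two are meaningful only when the
   expectations involved are finite. *)
Definition expectation_mx m n (X : T -> 'M[R]_(m, n)) : 'M[R]_(m, n) :=
  \matrix_(i, j) fine ('E_P[fun w => X w i j])%E.

Definition covariance_mx N (X : T -> 'rV[R]_N) : 'M[R]_N :=
  \matrix_(i, j) fine (covariance P (fun w => X w 0 i) (fun w => X w 0 j)).

Definition mutually_independent {d'} {S : measurableType d'}
    (X : nat -> T -> S) : Prop :=
  forall (s : seq nat) (A : nat -> set S), uniq s ->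
    (forall t, measurable (A t)) ->
    P (\bigcap_(t in [set` s]) (X t @^-1` A t)) =
    (\prod_(t <- s) fine (P (X t @^-1` A t)))%:E.

Definition identically_distributed {d'} {S : measurableType d'}
    (X : nat -> T -> S) : Prop :=
  forall (t : nat) (A : set S), measurable A ->
    P (X t @^-1` A) = P (X 0%N @^-1` A).

(* lambda is Lebesgue measure on m x n matrices: the Borel measure (unique)
   giving each box its volume. *)
Definition is_lebesgue_mx m n
    (lambda : {measure set (borel_mx R m n) -> \bar R}) : Prop :=
  forall a b : 'M[R]_(m, n), (forall i j, a i j <= b i j) ->
    lambda [set x : 'M[R]_(m, n) | forall i j, a i j <= x i j <= b i j] =
    (\prod_i \prod_j (b i j - a i j))%:E.

(* X has a probability density with respect to Lebesgue measure. *)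
Definition continuous_type m n (X : T -> 'M[R]_(m, n)) : Prop :=
  exists lambda : {measure set (borel_mx R m n) -> \bar R},
  exists f : borel_mx R m n -> R,
    [/\ is_lebesgue_mx lambda, measurable_fun setT f,
        forall x, 0 <= f x &
        forall A : set (borel_mx R m n), measurable A ->
          P (X @^-1` A) = (\int[lambda]_(x in A) (f x)%:E)%E].

(* Convergence in distribution of X n (under P) to Y, a random element
   possibly living on another probability space. *)
Definition cvg_in_distribution (U : topologicalType) (X : nat -> T -> U)
    {d'} {T' : measurableType d'} (Q : probability T' R) (Y : T' -> U) : Prop :=
  forall f : U -> R, continuous f ->
    (exists M : R, forall x, `|f x| <= M) ->
    ('E_P[f \o X n])%E @[n --> \oo] --> ('E_Q[f \o Y])%E.

(* The joint law converges weakly to a product of two probability measures. *)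
Definition asymptotically_independent m n m' n'
    (A : nat -> T -> 'M[R]_(m, n)) (B : nat -> T -> 'M[R]_(m', n')) : Prop :=
  exists (mu : probability (borel_mx R m n) R)
         (nu : probability (borel_mx R m' n') R),
    cvg_in_distribution
      (fun t w => (A t w, B t w) : 'M[R]_(m, n) * 'M[R]_(m', n'))
      (mu \x nu)%E
      (fun x : borel_mx R m n * borel_mx R m' n' =>
        (x.1, x.2) : 'M[R]_(m, n) * 'M[R]_(m', n')).

End probability.

(* Univariate normal law with mean m and variance v, degenerate for v = 0
   (normal_prob m 0 is not the Dirac mass at m). *)
Definition normal_law {R : realType} (m v : R) (B : set R) : \bar R :=
  if v == 0 then \d_m B else normal_prob m (Num.sqrt v) B.

(* N(m, V) on R^N, with V possibly singular: every linear combination a'x of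
   the coordinates has the univariate law N(a'm, a'Va). *)
Definition is_multivariate_normal {R : realType} N (m : 'cV[R]_N) (V : 'M[R]_N)
    (mu : probability (borel_mx R N 1) R) : Prop :=
  forall (a : 'cV[R]_N) (B : set R), measurable B ->
    mu [set x : 'cV[R]_N | B ((a^T *m x) 0 0)] =
    normal_law ((a^T *m m) 0 0) ((a^T *m V *m a) 0 0) B.

Definition cvg_to_normal {R : realType} {d} {T : measurableType d}
    (P : probability T R) m n (A : nat -> T -> 'M[R]_(m, n))
    (V : 'M[R]_(m * n)) : Prop :=
  exists2 mu : probability (borel_mx R (m * n) 1) R,
    is_multivariate_normal 0 V mu &
    cvg_in_distribution P (fun t w => vec (A t w)) mu
      (fun x : borel_mx R (m * n) 1 => x : 'cV[R]_(m * n)).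

Section estimators.
Context {R : realType} {k p n : nat} {m q : 'I_k -> nat}.
Variables (X : forall i, 'M[R]_(n, m i)) (Z : forall i, 'M[R]_(p, q i)).

(* A difference in R, not the truncated difference of naturals. *)
Definition resid_df : R := n%:R - \sum_i (\rank (X i))%:R.

Definition resid_mx : 'M[R]_n := resid_df^-1 *: (1%:M - \sum_i projmx (X i)).

Definition Sigma_hat (Y : 'M[R]_(n, p)) : 'M[R]_p := Y^T *m resid_mx *m Y.

Definition H_mx (Y : 'M[R]_(n, p)) (i : 'I_k) : 'M[R]_p :=
  let S := invmx (Sigma_hat Y) in
  S *m Z i *m invmx ((Z i)^T *m S *m Z i) *m (Z i)^T.

Definition Theta_hat (Y : 'M[R]_(n, p)) (i : 'I_k) : 'M[R]_(m i, q i) :=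
  invmx ((X i)^T *m X i) *m (X i)^T *m Y *m H_mx Y i *m Z i
    *m invmx ((Z i)^T *m Z i).

End estimators.

Section model.
Context {R : realType} {d : measure_display} {T : measurableType d}.
Variable P : probability T R.
Context {k p : nat} {m q : 'I_k -> nat}.

(* Since rows are only ever appended as n grows, the design matrices and the
   error matrices are the first n rows of infinite sequences x i and e. *)
Definition design (x : forall i, nat -> 'rV[R]_(m i)) (n : nat) (i : 'I_k) :
  'M[R]_(n, m i) := \matrix_(t < n) x i t.

Definition errors (e : nat -> T -> 'rV[R]_p) (n : nat) (w : T) :
  'M[R]_(n, p) := \matrix_(t < n) e t w.

Definition observations (x : forall i, nat -> 'rV[R]_(m i))
    (Z : forall i, 'M[R]_(p, q i)) (Theta : forall i, 'M[R]_(m i, q i))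
    (e : nat -> T -> 'rV[R]_p) (n : nat) (w : T) : 'M[R]_(n, p) :=
  \sum_i design x n i *m Theta i *m (Z i)^T + errors e n w.

(* The conditions on the design cannot hold for small n, so the admissible
   sample sizes are the n >= n0. *)
Record growth_curve_model (n0 : nat) (x : forall i, nat -> 'rV[R]_(m i))
    (Z : forall i, 'M[R]_(p, q i)) (Theta : forall i, 'M[R]_(m i, q i))
    (e : nat -> T -> 'rV[R]_p) : Prop := GrowthCurveModel {
  gcm_ltn_design : forall n i, (n0 <= n)%N -> (m i < n)%N;
  gcm_rank_design : forall n i, (n0 <= n)%N -> \rank (design x n i) = m i;
  gcm_size_design : forall n i, (n0 <= n)%N ->
    (\rank (design x n i) + p <= n)%N;
  gcm_orthogonal : forall n i j, (n0 <= n)%N -> i != j ->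
    (design x n i)^T *m design x n j = 0;
  gcm_ltn_profile : forall i, (q i < p)%N;
  gcm_rank_profile : forall i, \rank (Z i) = q i;
  gcm_measurable_errors : forall t,
    measurable_fun setT (e t : T -> borel_mx R 1 p);
  gcm_independent_errors :
    mutually_independent P (e : nat -> T -> borel_mx R 1 p);
  gcm_identical_errors :
    identically_distributed P (e : nat -> T -> borel_mx R 1 p);
  gcm_continuous_errors : forall n, (n0 <= n)%N ->
    continuous_type P (errors e n);
  gcm_posdef_Sigma_hat : forall n, (n0 <= n)%N ->
    {ae P, forall w,
      posdefmx (Sigma_hat (design x n) (observations x Z Theta e n w))} }.

End model.

(* Main.v *)
Require Import Defs.
From HB Require Import structures.
From mathcomp Require Import all_boot all_order all_algebra.
From mathcomp Require Import all_classical all_reals all_analysis.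
From mathcomp Require Import measurable_realfun.
From mathcomp Require Import ring lra.

Set Implicit Arguments.
Unset Strict Implicit.
Unset Printing Implicit Defensive.

Import Order.TTheory GRing.Theory Num.Theory.
Import numFieldNormedType.Exports.

Local Open Scope classical_set_scope.
Local Open Scope ring_scope.


(** The errors enter both estimators only through the normalized statistics
    M_i = n^(-1/2) X_i' E and N = n^(-1/2) (E' E - n Sigma), and one central
    limit theorem for these statistics gives all three claims.

    Since the design matrices are mutually orthogonal, the residual projector
    kills every X_j Theta_j Z_j', so Sigma_hat is a deterministic function of
    (M, N) (Sigma_hatE), and so is Theta_hat_i (Theta_hatE). Scaled by sqrt n,
    the two estimation errors are functions F_n (M, N) which converge, uniformly
    on compact sets, to N and to R_i^-1 M_i K_i, where
    K_i = Sigma^-1 Z_i (Z_i' Sigma^-1 Z_i)^-1 (Sigma_error_cvg and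
    Theta_error_of_cvg). A continuous mapping theorem for varying maps
    (continuous_convergence_law) then does the work of Slutsky's lemma and of
    the delta method: no random remainder term has to be controlled.

    A linear functional of (M, N) is n^(-1/2) times a sum of independent scores,
    each a linear plus a centered quadratic form in one row of errors
    (functional_score). Lindeberg's theorem gives it a centered Gaussian limit
    whose variance is the sum of a part from N and of parts from the M_i
    (functional_characteristic): the third moments vanish, so M and N do not
    interact, and X_i' X_j = 0, so M_i and M_j do not interact either. The
    characteristic function of the limit of a pair of errors is therefore
    a product. This is the asymptotic independence in (b) and (c); the part
    from N alone is the quadratic form of Cov(e' (x) e') (tensor_covariance_form),
    which is (a).

    The passage from characteristic functions to weak convergence is Levy's
    theorem under bounded second moments (levy_continuity): a bounded continuous
    function is close on a large cube to a trigonometric polynomial with the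
    same bound (trigonometric_approximation). The limit laws are images of
    independent standard normal variables (standard_normal_vector,
    psdmx_factor), and their linear images are identified with normal laws by
    uniqueness of characteristic functions on the line (eq_real_law). Throughout,
    a complex characteristic function E exp(i Y) is replaced by the real numbers
    E cos(Y + theta) for all phases theta, which carry its real and imaginary
    parts. *)

(** * Measurability and limits of matrices, entry by entry *)

Section borel_matrices.
Context {R : realType} {d : measure_display} {T : measurableType d}.

Definition measurable_entries m n (A : T -> 'M[R]_(m, n)) : Prop :=
  forall i j, measurable_fun setT (fun w => A w i j).

(** An open set of matrices is a countable union of cubes with rational centres,
    and the preimage of a cube is a finite intersection of preimages of
    intervals. *)
Lemma measurable_open_preimage m n (O : set 'M[R]_(m, n))
    (A : T -> 'M[R]_(m, n)) :
  measurable_entries A -> open O -> measurable (A @^-1` O).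
Proof.
move=> mA oO.
pose B (q : 'M[rat]_(m, n) * nat) : set 'M[R]_(m, n) :=
  [set M | forall i j, `|M i j - ratr (q.1 i j)| < q.2.+1%:R^-1].
pose I := [set q | B q `<=` O].
have -> : A @^-1` O = \bigcup_(q : 'M[rat]_(m, n) * nat)
    (if `[< B q `<=` O >] then A @^-1` B q else set0).
  apply/seteqP; split=> [w /= Ow|w [q _]]; last first.
    by case: asboolP => // BO /BO.
  have /nbhs_ballP [e /= e0 eO] : nbhs (A w) O by apply: open_nbhs_nbhs; split.
  have cgt0 N : 0 < N.+1%:R^-1 :> R by rewrite invr_gt0 ltr0n.
  have [N eN] : exists N : nat, N.+1%:R^-1 < e / 2 :> R.
    have := near_infty_natSinv_lt (PosNum (divr_gt0 e0 (ltr0n R 2))).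
    by move=> [N _ /(_ N (leqnn N))] /= ?; exists N.
  have Nq i j : exists q : rat, `|A w i j - ratr q| < N.+1%:R^-1.
    have N0 : A w i j - N.+1%:R^-1 < A w i j + N.+1%:R^-1 :> R.
      by have := cgt0 N; move: (N.+1%:R^-1) => c c0; lra.
    have [q] := rat_in_itvoo N0; rewrite in_itv/= => /andP[q1 q2].
    exists q; rewrite ltr_norml.
    by move: q1 q2; move: (N.+1%:R^-1) => c q1 q2; apply/andP; split; lra.
  have [q qP] := boolp.choice (fun ij : 'I_m * 'I_n => Nq ij.1 ij.2).
  exists (\matrix_(i, j) q (i, j), N) => //.
  case: asboolP; last first.
    case=> M BM; apply: eO; split => // i j; rewrite /ball/=.
    have := BM i j; have := qP (i, j); rewrite mxE /= => h1 h2.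
    rewrite (_ : A w i j - M i j =
      (A w i j - ratr (q (i, j))) - (M i j - ratr (q (i, j)))); last by ring.
    rewrite (le_lt_trans (ler_normB _ _))//.
    by move: eN h1 h2; move: (N.+1%:R^-1) => c *; lra.
  by move=> _ i j; rewrite /= mxE; exact: (qP (i, j)).
apply: countable_bigcupT_measurable => [|q]; first exact: countableP.
case: asboolP => // _.
have -> : A @^-1` B q = \bigcap_(ij in [set: 'I_m * 'I_n])
    ((fun w => `|A w ij.1 ij.2 - ratr (q.1 ij.1 ij.2)|) @^-1`
      `]-oo, q.2.+1%:R^-1[).
  apply/seteqP; split=> [w /= Bw [i j] _ /=|w /= Bw i j].
    by rewrite in_itv/=; exact: Bw.
  by have := Bw (i, j) Logic.I; rewrite /= in_itv.
apply: fin_bigcap_measurable; first exact: finite_finset.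
move=> [i j] _ /=; rewrite -[X in measurable X]setTI.
have mu : measurable_fun setT (fun w => `|A w i j - ratr (q.1 i j)|).
  by apply: measurableT_comp => //; exact: measurable_funB.
by apply: mu => //; exact: measurable_itv.
Qed.

Lemma measurable_entriesP m n (A : T -> borel_mx R m n) :
  measurable_fun setT A <-> measurable_entries (A : T -> 'M[R]_(m, n)).
Proof.
split=> [mA i j|mA].
  apply: (measurability _ (RGenOInfty.measurableE R)).
  move=> _ [_ [a ->] <-]; rewrite setTI.
  have -> : (fun w => A w i j) @^-1` `]a, +oo[ =
      A @^-1` [set M : 'M[R]_(m, n) | a < M i j].
    by apply/seteqP; split=> w /=; rewrite in_itv/= andbT.
  rewrite -[X in measurable X]setTI; apply: mA => //; apply: sub_sigma_algebra.
  have := @coord_continuous R m n i j; move=> /continuousP /(_ _ (@open_gt R a)).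
  by rewrite /preimage.
apply: (@measurability _ _ _ _ setT A (@open _)) => //; move=> _ [U oU <-]; rewrite setTI.
exact: measurable_open_preimage.
Qed.

Lemma measurable_continuous_entries m n (A : T -> 'M[R]_(m, n))
    (f : 'M[R]_(m, n) -> R) :
  measurable_entries A -> continuous f -> measurable_fun setT (f \o A).
Proof.
move=> mA /continuousP cf; apply: (measurability _ (RGenOInfty.measurableE R)).
move=> _ [_ [a ->] <-]; rewrite setTI.
rewrite (_ : _ @^-1` _ = A @^-1` (f @^-1` [set x | a < x])).
  by apply: measurable_open_preimage => //; exact/cf/open_gt.
by apply/seteqP; split=> w /=; rewrite in_itv/= andbT.
Qed.

Lemma measurable_entriesD m n (A B : T -> 'M[R]_(m, n)) :
  measurable_entries A -> measurable_entries B ->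
  measurable_entries (fun w => A w + B w).
Proof.
by move=> mA mB i j; under eq_fun do rewrite mxE; exact: measurable_funD.
Qed.

Lemma measurable_entriesB m n (A B : T -> 'M[R]_(m, n)) :
  measurable_entries A -> measurable_entries B ->
  measurable_entries (fun w => A w - B w).
Proof.
by move=> mA mB i j; under eq_fun do rewrite !mxE; exact: measurable_funB.
Qed.

Lemma measurable_entriesZ m n (c : T -> R) (A : T -> 'M[R]_(m, n)) :
  measurable_fun setT c -> measurable_entries A ->
  measurable_entries (fun w => c w *: A w).
Proof.
by move=> mc mA i j; under eq_fun do rewrite mxE; exact: measurable_funM.
Qed.

Lemma measurable_entriesM m n p (A : T -> 'M[R]_(m, n)) (B : T -> 'M[R]_(n, p)) :
  measurable_entries A -> measurable_entries B ->
  measurable_entries (fun w => A w *m B w).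
Proof.
move=> mA mB i j; under eq_fun do rewrite mxE.
by apply: measurable_sum => l; exact: measurable_funM.
Qed.

Lemma measurable_entries_cst m n (A : 'M[R]_(m, n)) :
  measurable_entries (fun=> A).
Proof. by move=> i j; exact: measurable_cst. Qed.

Lemma measurable_entries_tr m n (A : T -> 'M[R]_(m, n)) :
  measurable_entries A -> measurable_entries (fun w => (A w)^T).
Proof. by move=> mA i j; under eq_fun do rewrite mxE; exact: mA. Qed.

Lemma measurable_det n (A : T -> 'M[R]_n) :
  measurable_entries A -> measurable_fun setT (fun w => \det (A w)).
Proof.
move=> mA; apply: measurable_sum => s.
by apply: measurable_funM => //; apply: measurable_prod => i _; exact: mA.
Qed.

Lemma measurable_inv (f : T -> R) :
  measurable_fun setT f -> measurable_fun setT (fun w => (f w)^-1).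
Proof.
(* x^-1 = x exp (- ln x^2) holds at x = 0 too, where the inverse is 0. *)
move=> mf; rewrite (_ : (fun w => _) =
    fun w => f w * expR (- ln (f w ^+ 2))); last first.
  apply/funext => w; have [->|f0] := eqVneq (f w) 0.
    by rewrite invr0 mul0r.
  have f2 : 0 < f w ^+ 2 by rewrite exprn_even_gt0.
  by rewrite expRN lnK// expr2 invfM mulrA divff// mul1r.
apply: measurable_funM => //; apply: measurableT_comp => //.
apply: measurableT_comp => //; apply: measurableT_comp => //.
exact: measurable_funX.
Qed.

(** Cramer's rule; invmx is the identity on singular matrices. *)
Lemma measurable_entries_invmx n (A : T -> 'M[R]_n) :
  measurable_entries A -> measurable_entries (fun w => invmx (A w)).
Proof.
move=> mA i j; have mD := measurable_det mA.
rewrite (_ : (fun w => _) = (fun w => if \det (A w) == 0 then A w i j else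
   (\det (A w))^-1 * cofactor (A w) j i)); last first.
  apply/funext => w; rewrite /invmx unitmxE unitfE.
  by case: eqP => //=; rewrite !mxE.
apply: measurable_fun_ifT => //; first exact: measurable_fun_eqr.
apply: measurable_funM; first exact: measurable_inv.
rewrite /cofactor; apply: measurable_funM => //.
by apply: measurable_det => a b; under eq_fun do rewrite !mxE; exact: mA.
Qed.

End borel_matrices.

Section entrywise_limits.
Context {R : realType} {I : Type} {F : set_system I} {FF : Filter F}.

Lemma cvg_entries m n (A : I -> 'M[R]_(m, n)) (a : 'M[R]_(m, n)) :
  (forall i j, A x i j @[x --> F] --> a i j) -> A @ F --> a.
Proof.
move=> Aa; apply/cvg_ballP => e e0.
have : \forall x \near F, forall ij : 'I_m * 'I_n, ball (a ij.1 ij.2) e (A x ij.1 ij.2).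
  by apply: filter_forall => -[i j]; move/cvg_ballP : (Aa i j) => /(_ _ e0).
by apply: filterS => x Ax; split => // i j; exact: (Ax (i, j)).
Qed.

Lemma cvg_entry m n (A : I -> 'M[R]_(m, n)) (a : 'M[R]_(m, n)) i j :
  A @ F --> a -> A x i j @[x --> F] --> a i j.
Proof.
by move=> Aa; apply: (@cvg_comp _ _ _ A (fun M : 'M[R]_(m, n) => M i j) _ _ _ Aa);
  exact: coord_continuous.
Qed.

Lemma cvg_bigsum J (r : seq J) (Q : pred J) (f : J -> I -> R) (a : J -> R) :
  (forall j, Q j -> f j x @[x --> F] --> a j) ->
  \sum_(j <- r | Q j) f j x @[x --> F] --> \sum_(j <- r | Q j) a j.
Proof.
by move=> fa; apply: cvg_big => //; exact: add_continuous.
Qed.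

Lemma cvg_bigprod J (r : seq J) (f : J -> I -> R) (a : J -> R) :
  (forall j, f j x @[x --> F] --> a j) ->
  \prod_(j <- r) f j x @[x --> F] --> \prod_(j <- r) a j.
Proof.
by move=> fa; apply: cvg_big => //; exact: mul_continuous.
Qed.

Lemma cvg_mulmx m n p (A : I -> 'M[R]_(m, n)) (B : I -> 'M[R]_(n, p))
    (a : 'M[R]_(m, n)) (b : 'M[R]_(n, p)) :
  A @ F --> a -> B @ F --> b -> A x *m B x @[x --> F] --> a *m b.
Proof.
move=> Aa Bb; apply: cvg_entries => i j; under eq_fun do rewrite mxE; rewrite mxE.
by apply: cvg_bigsum => l _; apply: cvgM; exact: cvg_entry.
Qed.

Lemma cvg_trmx m n (A : I -> 'M[R]_(m, n)) (a : 'M[R]_(m, n)) :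
  A @ F --> a -> (A x)^T @[x --> F] --> a^T.
Proof.
move=> Aa; apply: cvg_entries => i j; under eq_fun do rewrite mxE; rewrite mxE.
exact: cvg_entry.
Qed.

Lemma cvg_det n (A : I -> 'M[R]_n) (a : 'M[R]_n) :
  A @ F --> a -> \det (A x) @[x --> F] --> \det a.
Proof.
move=> Aa; apply: cvg_bigsum => s _; apply: cvgM; first exact: cvg_cst.
by apply: cvg_bigprod => i; exact: cvg_entry.
Qed.

Lemma cvg_invmx n (A : I -> 'M[R]_n) (a : 'M[R]_n) : a \in unitmx ->
  A @ F --> a -> invmx (A x) @[x --> F] --> invmx a.
Proof.
move=> ua Aa; have dA := cvg_det Aa; have da : \det a != 0 by rewrite -unitfE -unitmxE.
have nA : \forall x \near F, A x \in unitmx.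
  have : \forall x \near F, \det (A x) != 0 by exact: cvgr_neq0 dA da.
  by apply: filterS => x; rewrite unitmxE unitfE.
apply: (@cvg_trans _ ((fun x => (\det (A x))^-1 *: \adj (A x)) @ F)).
  apply: near_eq_cvg; apply: filterS nA => x ux.
  by rewrite /invmx ux.
rewrite /invmx ua; apply: cvgZ; first exact: cvgV.
apply: cvg_entries => i j; under eq_fun do rewrite !mxE; rewrite !mxE.
apply: cvgM; first exact: cvg_cst.
apply: cvg_det; apply: cvg_entries => k l.
by under eq_fun do rewrite !mxE; rewrite !mxE; exact: cvg_entry.
Qed.

End entrywise_limits.

(** * Means of real random variables *)

Section mean.
Context {R : realType} {d : measure_display} {T : measurableType d}.
Variable P : probability T R.
Implicit Types f g : T -> R.

Definition mean f : R := Rintegral P setT f.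

Definition summable f : Prop := P.-integrable setT (EFin \o f).

Lemma summable_measurable f : summable f -> measurable_fun setT f.
Proof. by move=> /measurable_int /measurable_EFinP. Qed.

Lemma summable_bounded f (M : R) : measurable_fun setT f ->
  (forall w, `|f w| <= M) -> summable f.
Proof.
move=> mf fM; apply: measurable_bounded_integrable => //.
  by apply: (le_lt_trans (probability_le1 P measurableT)); rewrite ltry.
by exists M; split; [exact: num_real|move=> x Mx w _; exact: le_trans (ltW Mx)].
Qed.

Lemma summable_le f g : measurable_fun setT f ->
  (forall w, `|f w| <= g w) -> summable g -> summable f.
Proof.
move=> mf fg; apply: le_integrable => //; first exact/measurable_EFinP.
by move=> w _ /=; rewrite lee_fin (le_trans (fg w))// ler_norm.
Qed.

Lemma summable_cst c : summable (cst c).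
Proof. exact: finite_measure_integrable_cst. Qed.

Lemma summableD f g : summable f -> summable g -> summable (fun w => f w + g w).
Proof. by move=> sf sg; exact: integrableD sf sg. Qed.

Lemma summableB f g : summable f -> summable g -> summable (fun w => f w - g w).
Proof. by move=> sf sg; exact: integrableB sf sg. Qed.

Lemma summableZ c f : summable f -> summable (fun w => c * f w).
Proof. by move=> sf; apply: (integrableZl _ c sf). Qed.

Lemma summable_norm f : summable f -> summable (fun w => `|f w|).
Proof. exact: integrable_norm. Qed.

Lemma summable_sum I (r : seq I) (Q : pred I) (F : I -> T -> R) :
  (forall i, Q i -> summable (F i)) ->
  summable (fun w => \sum_(i <- r | Q i) F i w).
Proof.
move=> sF; rewrite /summable (_ : EFin \o _ =
    (fun w => \sum_(i <- r | Q i) (F i w)%:E)%E); last first.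
  by apply/funext => w; rewrite /= sumEFin.
exact: integrable_sum.
Qed.

Lemma expectation_mean f : summable f -> ('E_P[f] = (mean f)%:E)%E.
Proof.
move=> sf; rewrite unlock /mean /Rintegral fineK//.
exact: integrable_fin_num.
Qed.

Lemma mean_cst c : mean (cst c) = c.
Proof.
rewrite /mean Rintegral_cst//.
by rewrite [X in fine X](_ : _ = 1%E) ?mulr1//; exact: probability_setT.
Qed.

Lemma meanD f g : summable f -> summable g ->
  mean (fun w => f w + g w) = mean f + mean g.
Proof. exact: RintegralD. Qed.

Lemma meanB f g : summable f -> summable g ->
  mean (fun w => f w - g w) = mean f - mean g.
Proof. exact: RintegralB. Qed.

Lemma meanZ c f : summable f -> mean (fun w => c * f w) = c * mean f.
Proof. exact: RintegralZl. Qed.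

Lemma mean_sum I (r : seq I) (Q : pred I) (F : I -> T -> R) :
  (forall i, Q i -> summable (F i)) ->
  mean (fun w => \sum_(i <- r | Q i) F i w) = \sum_(i <- r | Q i) mean (F i).
Proof.
move=> sF; elim: r => [|i r IH].
  by under eq_fun do rewrite big_nil; rewrite big_nil mean_cst.
under eq_fun do rewrite big_cons; rewrite big_cons; case: (boolP (Q i)) => Qi //.
by rewrite meanD ?IH//; [exact: sF|exact: summable_sum].
Qed.

Lemma le_mean f g : summable f -> summable g -> (forall w, f w <= g w) ->
  mean f <= mean g.
Proof. by move=> sf sg fg; apply: le_Rintegral => // w _; exact: fg. Qed.

Lemma mean_ge0 f : (forall w, 0 <= f w) -> 0 <= mean f.
Proof. by move=> f0; apply: Rintegral_ge0 => w _; exact: f0. Qed.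

Lemma norm_mean_le f g : summable f -> summable g ->
  (forall w, `|f w| <= g w) -> `|mean f| <= mean g.
Proof.
move=> sf sg fg; rewrite (le_trans (le_normr_Rintegral _ _))//.
by apply: le_mean => //; exact: summable_norm.
Qed.

Lemma norm_mean_bounded f M : measurable_fun setT f ->
  (forall w, `|f w| <= M) -> `|mean f| <= M.
Proof.
move=> mf fM; rewrite -[leRHS]mean_cst; apply: norm_mean_le => //.
- exact: summable_bounded fM.
- exact: summable_cst.
Qed.

Lemma eq_mean f g : f =1 g -> mean f = mean g.
Proof. by move=> fg; congr mean; exact/funext. Qed.

Lemma mean_indic A : measurable A -> mean \1_A = fine (P A).
Proof.
by move=> mA; rewrite /mean /Rintegral integral_indic// setIT.
Qed.

End mean.

Section same_law.
Context {R : realType} {d d' d'' : measure_display} {T : measurableType d}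
  {T' : measurableType d'} {S : measurableType d''}.
Variables (P : probability T R) (Q : probability T' R) (X : T -> S) (Y : T' -> S).
Hypotheses (mX : measurable_fun setT X) (mY : measurable_fun setT Y)
  (XY : forall A, measurable A -> P (X @^-1` A) = Q (Y @^-1` A)).

Lemma ge0_mean_same_law (f : S -> R) : measurable_fun setT f ->
  (forall x, 0 <= f x) -> mean P (f \o X) = mean Q (f \o Y).
Proof.
move=> mf f0; rewrite /mean /Rintegral; congr fine.
have mEf : measurable_fun setT (EFin \o f) by exact/measurable_EFinP.
have EX : (\int[P]_x (f (X x))%:E = \int[pushforward P X]_y (f y)%:E)%E.
  by rewrite ge0_integral_pushforward// => y _; rewrite /= lee_fin.
have EY : (\int[Q]_x (f (Y x))%:E = \int[pushforward Q Y]_y (f y)%:E)%E.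
  by rewrite ge0_integral_pushforward// => y _; rewrite /= lee_fin.
by rewrite /= EX EY; apply: eq_measure_integral => A mA _; exact: XY.
Qed.

Lemma mean_same_law (f : S -> R) (M : R) : measurable_fun setT f ->
  (forall x, `|f x| <= M) -> mean P (f \o X) = mean Q (f \o Y).
Proof.
move=> mf fM.
have H : mean P ((fun y => M + f y) \o X) = mean Q ((fun y => M + f y) \o Y).
  apply: ge0_mean_same_law; first exact: measurable_funD.
  by move=> y; have := fM y; rewrite ler_norml => /andP[? _]; lra.
have sP : summable P (f \o X).
  apply: (@summable_bounded _ _ _ _ _ M); first exact: measurableT_comp.
  by move=> w; exact: fM.
have sQ : summable Q (f \o Y).
  apply: (@summable_bounded _ _ _ _ _ M); first exact: measurableT_comp.
  by move=> w; exact: fM.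
move: H; rewrite /comp meanD//; last exact: summable_cst.
rewrite meanD//; last exact: summable_cst.
by rewrite !mean_cst => /addrI.
Qed.

End same_law.

(** * Taylor bounds for sine and cosine *)

Section trigonometric_bounds.
Context {R : realType}.
Implicit Types (x y : R) (f df : R -> R).

(** Each of the bounds that follow is the derivative of the next one, so
    positivity climbs the chain from 1 - cos to the quartic bound. *)
Lemma nonneg_antiderivative f df : (forall x, is_derive x 1 f (df x)) ->
  f 0 = 0 -> (forall x, 0 <= x -> 0 <= df x) -> forall y, 0 <= y -> 0 <= f y.
Proof.
move=> fdf f0 df0 y y0.
have cf : {within `[0, y], continuous f}.
  apply: continuous_subspaceT => x.
  by apply/differentiable_continuous/derivable1_diffP; case: (fdf x).
have [c] := MVT_segment y0 (fun x _ => fdf x) cf.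
rewrite in_itv/= => /andP[c0 _]; rewrite f0 !subr0 => ->.
by rewrite mulr_ge0// df0.
Qed.

Lemma sin_le_id x : 0 <= x -> sin x <= x.
Proof.
move=> x0; rewrite -subr_ge0.
apply: (@nonneg_antiderivative (fun y => y - sin y) (fun y => 1 - cos y)) => //.
by rewrite sin0 subr0.
Qed.

Lemma cos_ge_sqr x : 0 <= x -> 1 - x ^+ 2 / 2 <= cos x.
Proof.
move=> x0; rewrite -subr_ge0.
apply: (@nonneg_antiderivative (fun y => cos y - (1 - y ^+ 2 / 2))
  (fun y => y - sin y)) => //.
- by move=> y; apply: is_derive_eq; rewrite /GRing.scale/=; field.
- by rewrite cos0 expr2 mul0r mul0r subr0 subrr.
- by move=> y y0; rewrite subr_ge0 sin_le_id.
Qed.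

Lemma sin_ge_cube x : 0 <= x -> x - x ^+ 3 / 6 <= sin x.
Proof.
move=> x0; rewrite -subr_ge0.
apply: (@nonneg_antiderivative (fun y => sin y - (y - y ^+ 3 / 6))
  (fun y => cos y - (1 - y ^+ 2 / 2))) => //.
- by move=> y; apply: is_derive_eq; rewrite /GRing.scale/=; field.
- by rewrite sin0 expr0n/= mul0r subr0 subrr.
- by move=> y y0; rewrite subr_ge0 cos_ge_sqr.
Qed.

Lemma cos_le_quartic x : 0 <= x -> cos x <= 1 - x ^+ 2 / 2 + x ^+ 4 / 24.
Proof.
move=> x0; rewrite -subr_ge0.
apply: (@nonneg_antiderivative (fun y => 1 - y ^+ 2 / 2 + y ^+ 4 / 24 - cos y)
  (fun y => sin y - (y - y ^+ 3 / 6))) => //.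
- by move=> y; apply: is_derive_eq; rewrite /GRing.scale/=; field.
- by rewrite cos0 !expr0n/= !mul0r subr0 addr0 subrr.
- by move=> y y0; rewrite subr_ge0 sin_ge_cube.
Qed.

(** The minimum in the error bound makes it integrable against a law that has
    only a second moment, and still of smaller order than [x ^+ 2]. *)
Lemma cos_taylor x :
  `|cos x - (1 - x ^+ 2 / 2)| <= 2 * (x ^+ 2 * Num.min 1 `|x|).
Proof.
wlog x0 : x / 0 <= x.
  move=> H; have [|/ltW x0] := leP 0 x; first exact: H.
  by have := H (- x); rewrite oppr_ge0 cosN sqrrN normrN; exact.
rewrite ger0_norm; last by rewrite subr_ge0 cos_ge_sqr.
rewrite (ger0_norm x0).
have := cos_le_quartic x0; have := cos_le1 x.
have x2 : 0 <= x ^+ 2 by exact: sqr_ge0.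
have [x1|/ltW x1] := leP 1 x; first by rewrite mulr1; lra.
have : x ^+ 4 <= x ^+ 2 * x.
  rewrite -exprSr -(ger0_norm x0) ler_wiXn2l// ?normr_ge0// ger0_norm//.
have : 0 <= x ^+ 2 * x by rewrite mulr_ge0.
move: (x ^+ 2 * x) => z; lra.
Qed.

Lemma sin_taylor x : `|sin x - x| <= 2 * (x ^+ 2 * Num.min 1 `|x|).
Proof.
wlog x0 : x / 0 <= x.
  move=> H; have [|/ltW x0] := leP 0 x; first exact: H.
  have := H (- x); rewrite oppr_ge0 sinN sqrrN normrN -opprD normrN; exact.
rewrite ler0_norm; last by rewrite subr_le0 sin_le_id.
rewrite (ger0_norm x0).
have := sin_ge_cube x0; have := sin_geN1 x.
have [x1|/ltW x1] := leP 1 x.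
  rewrite mulr1; have : x <= x ^+ 2 by rewrite expr2 ler_peMr.
  lra.
rewrite -exprSr; have : 0 <= x ^+ 3 by rewrite exprn_ge0.
lra.
Qed.

End trigonometric_bounds.

(** * Bernstein polynomials and trigonometric polynomials *)

Section uniform_on_cubes.
Context {R : realType}.

Definition cube N (L : R) : set 'rV[R]_N := [set u | forall j, `|u 0 j| <= L].
Arguments cube : clear implicits.

Lemma compact_cube N L : compact (cube N L).
Proof.
have := @rV_compact R N (fun=> `[(- L), L]%classic) (fun=> @segment_compact _ _ _).
congr compact; apply/seteqP; split=> u /= uL j.
  by have := uL j; rewrite /= in_itv/= ler_norml.
by have := uL j; rewrite /= in_itv/= ler_norml.
Qed.

(** Uniform continuity on a compact cube, in a form where only the first of the
    two points has to lie in the cube. *)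
Lemma uniform_near_cube N (f : 'rV[R]_N -> R) (L e : R) : continuous f -> 0 < e ->
  exists2 del : R, 0 < del & forall u v : 'rV[R]_N, cube N L u ->
    (forall j, `|u 0 j - v 0 j| < del) -> `|f u - f v| < e.
Proof.
move=> cf e0.
have /compact_near_coveringP cK := @compact_cube N L.
have : \forall h \near nbhs (0 : 'rV[R]_N), cube N L `<=`
    (fun u => `|f u - f (u + h)| < e).
  apply: (cK _ _ (fun h u => `|f u - f (u + h)| < e)) => u Ku.
  have H : (fun z : 'rV[R]_N * 'rV[R]_N => f z.1 - f (z.1 + z.2)) @ (u, 0 : 'rV[R]_N)
      --> f u - f (u + 0).
    apply: cvgB.
      by apply: (@cvg_comp _ _ _ fst f _ (nbhs u)); [exact: cvg_fst|exact: cf].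
    apply: (@cvg_comp _ _ _ (fun z : 'rV[R]_N * 'rV[R]_N => z.1 + z.2) f _
      (nbhs (u + 0))); last exact: cf.
    by apply: cvgD; [exact: cvg_fst|exact: cvg_snd].
  rewrite addr0 subrr in H.
  have /cvgr0Pnorm_lt /(_ _ e0) := H.
  done.
move=> /nbhs_ballP[del /= del0 Hd]; exists del => // u v Ku uv.
have B : ball (0 : 'rV[R]_N) del (v - u).
  by split => // i j; rewrite /ball/= !mxE sub0r normrN distrC ord1; exact: uv.
by have := Hd _ B u Ku; rewrite /= [u + _]addrC subrK.
Qed.

End uniform_on_cubes.
Arguments cube {R} N L _.

Section bernstein.
Context {R : realType}.
Implicit Types (u : R) (m i : nat).

(** The probability that [m] Bernoulli(u) trials give [i] successes, i.e. the
    Bernstein polynomial of degree [m] and index [i] at [u]; the recursion makes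
    its moments and its membership in algebras of functions immediate. *)
Fixpoint bernstein u m i : R :=
  if m is m'.+1 then
    u * (if i is i'.+1 then bernstein u m' i' else 0)
      + (1 - u) * bernstein u m' i
  else (i == 0%N)%:R.

Lemma bernstein_ge0 u m i : 0 <= u <= 1 -> 0 <= bernstein u m i.
Proof.
move=> /andP[u0 u1]; elim: m i => [|m IH] i /=; first by rewrite ler0n.
rewrite addr_ge0// mulr_ge0// ?subr_ge0//.
by case: i.
Qed.

Lemma bernstein_small u m i : (m < i)%N -> bernstein u m i = 0.
Proof.
elim: m i => [|m IH] [|i] //= mi.
by rewrite !IH ?mulr0 ?addr0// ltnW.
Qed.

Lemma bernstein_sumS u m (phi : nat -> R) :
  \sum_(i < m.+2) bernstein u m.+1 i * phi i =
  u * (\sum_(i < m.+1) bernstein u m i * phi i.+1) +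
  (1 - u) * (\sum_(i < m.+1) bernstein u m i * phi i).
Proof.
rewrite /=; under eq_bigr do rewrite mulrDl.
rewrite big_split/=; congr (_ + _).
  rewrite big_ord_recl/= mulr0 mul0r add0r mulr_sumr.
  by apply: eq_bigr => i _; rewrite mulrA.
rewrite big_ord_recr/= bernstein_small// mulr0 mul0r addr0 mulr_sumr.
by apply: eq_bigr => i _; rewrite mulrA.
Qed.

Lemma bernstein_sum u m : \sum_(i < m.+1) bernstein u m i = 1.
Proof.
have -> : \sum_(i < m.+1) bernstein u m i = \sum_(i < m.+1) bernstein u m i * 1.
  by apply: eq_bigr => i _; rewrite mulr1.
elim: m => [|m IH]; first by rewrite big_ord1 mulr1.
by rewrite (bernstein_sumS u m (fun=> 1)) IH; ring.
Qed.

Lemma bernstein_mean u m : \sum_(i < m.+1) bernstein u m i * i%:R = m%:R * u.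
Proof.
elim: m => [|m IH]; first by rewrite big_ord1 mulr0 mul0r.
rewrite (bernstein_sumS u m (fun i => i%:R)) IH.
under eq_bigr do rewrite -natr1 mulrDr mulr1.
by rewrite big_split/= IH bernstein_sum -natr1; ring.
Qed.

Lemma bernstein_square u m : \sum_(i < m.+1) bernstein u m i * i%:R ^+ 2 =
  m%:R * (m%:R - 1) * u ^+ 2 + m%:R * u.
Proof.
elim: m => [|m IH]; first by rewrite big_ord1 !mul0r addr0 expr2 mul0r mulr0.
rewrite (bernstein_sumS u m (fun i => i%:R ^+ 2)) IH.
have -> : \sum_(i < m.+1) bernstein u m i * i.+1%:R ^+ 2 =
    \sum_(i < m.+1) (bernstein u m i * i%:R ^+ 2 +
      (2 * (bernstein u m i * i%:R) + bernstein u m i)).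
  by apply: eq_bigr => i _; rewrite -natr1; ring.
rewrite !big_split/= IH -mulr_sumr bernstein_mean bernstein_sum -natr1; ring.
Qed.

Lemma bernstein_variance u m :
  \sum_(i < m.+2) bernstein u m.+1 i * (u - i%:R / m.+1%:R) ^+ 2 =
  u * (1 - u) / m.+1%:R.
Proof.
have m0 : m.+1%:R != 0 :> R by rewrite pnatr_eq0.
have -> : \sum_(i < m.+2) bernstein u m.+1 i * (u - i%:R / m.+1%:R) ^+ 2 =
    \sum_(i < m.+2) (u ^+ 2 * bernstein u m.+1 i +
      (- (2 * u / m.+1%:R) * (bernstein u m.+1 i * i%:R) +
       (m.+1%:R ^- 2) * (bernstein u m.+1 i * i%:R ^+ 2))).
  by apply: eq_bigr => i _; move: (bernstein _ _ _) => b; field.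
rewrite !big_split/= -!mulr_sumr bernstein_mean bernstein_sum bernstein_square.
by field.
Qed.

End bernstein.

Section trigonometric_polynomials.
Context {R : realType} {N : nat}.
Implicit Types (s u x : 'rV[R]_N) (f g : 'rV[R]_N -> R).

Definition dotv s u : R := \sum_j s 0 j * u 0 j.

Lemma dotvDl s t u : dotv (s + t) u = dotv s u + dotv t u.
Proof. by rewrite -big_split/=; apply: eq_bigr => j _; rewrite mxE mulrDl. Qed.

Lemma dotvNl s u : dotv (- s) u = - dotv s u.
Proof. by rewrite -sumrN; apply: eq_bigr => j _; rewrite mxE mulNr. Qed.

Lemma dotv0l u : dotv 0 u = 0.
Proof. by apply: big1 => j _; rewrite mxE mul0r. Qed.

Lemma dotv_delta (c : R) j u : dotv (c *: delta_mx 0 j) u = c * u 0 j.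
Proof.
rewrite /dotv (bigD1 j)//= !mxE !eqxx mulr1 big1 ?addr0// => l lj.
by rewrite !mxE (negbTE lj) andbF mulr0 mul0r.
Qed.

(** The phases theta let one generator stand for both cosines and sines. *)
Inductive trigpoly : ('rV[R]_N -> R) -> Prop :=
| trigpoly_cos s theta : trigpoly (fun x => cos (dotv s x + theta))
| trigpolyD f g : trigpoly f -> trigpoly g -> trigpoly (fun x => f x + g x)
| trigpolyZ c f : trigpoly f -> trigpoly (fun x => c * f x).

Lemma eq_trigpoly f g : f =1 g -> trigpoly f -> trigpoly g.
Proof. by move=> /funext ->. Qed.

Lemma trigpoly_cst c : trigpoly (fun=> c).
Proof.
apply: (@eq_trigpoly (fun x => c * cos (dotv 0 x + 0))).
  by move=> x; rewrite dotv0l addr0 cos0 mulr1.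
by apply: trigpolyZ; exact: trigpoly_cos.
Qed.

Lemma trigpoly_sin s : trigpoly (fun x => sin (dotv s x)).
Proof.
apply: (@eq_trigpoly (fun x => cos (dotv s x + - (pi / 2)))) => [x|].
  exact: cosBpihalf.
exact: trigpoly_cos.
Qed.

Lemma trigpoly_sum I (r : seq I) (F : I -> 'rV[R]_N -> R) :
  (forall i, trigpoly (F i)) -> trigpoly (fun x => \sum_(i <- r) F i x).
Proof.
move=> tF; elim: r => [|i r IH].
  by under eq_fun do rewrite big_nil; exact: trigpoly_cst.
by under eq_fun do rewrite big_cons; exact: trigpolyD.
Qed.

(** Product-to-sum formulas. *)
Lemma trigpolyM f g : trigpoly f -> trigpoly g -> trigpoly (fun x => f x * g x).
Proof.
move=> tf tg; elim: tf => {f} [s a|f1 f2 _ t1 _ t2|c f _ t]; last 2 first.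
- by apply: (eq_trigpoly _ (trigpolyD t1 t2)) => x; rewrite mulrDl.
- by apply: (eq_trigpoly _ (trigpolyZ c t)) => x; rewrite mulrA.
elim: tg => {g} [t b|g1 g2 _ t1 _ t2|c g _ t]; last 2 first.
- by apply: (eq_trigpoly _ (trigpolyD t1 t2)) => x; rewrite mulrDr.
- by apply: (eq_trigpoly _ (trigpolyZ c t)) => x; rewrite mulrCA.
apply: (@eq_trigpoly (fun x => 2^-1 *
    (cos (dotv (s + t) x + (a + b)) + cos (dotv (s - t) x + (a - b))))) => [x|].
  have -> : dotv (s + t) x + (a + b) = (dotv s x + a) + (dotv t x + b).
    by rewrite dotvDl addrACA.
  have -> : dotv (s - t) x + (a - b) = (dotv s x + a) - (dotv t x + b).
    by rewrite dotvDl dotvNl; ring.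
  by rewrite cosD cosB; field.
by apply: trigpolyZ; apply: trigpolyD; exact: trigpoly_cos.
Qed.

Lemma trigpoly_prod I (r : seq I) (F : I -> 'rV[R]_N -> R) :
  (forall i, trigpoly (F i)) -> trigpoly (fun x => \prod_(i <- r) F i x).
Proof.
move=> tF; elim: r => [|i r IH].
  by under eq_fun do rewrite big_nil; exact: trigpoly_cst.
by under eq_fun do rewrite big_cons; exact: trigpolyM.
Qed.

Lemma trigpoly_bernstein f m i :
  trigpoly f -> trigpoly (fun x => bernstein (f x) m i).
Proof.
move=> tf; elim: m i => [|m IH] i /=; first exact: trigpoly_cst.
apply: trigpolyD; apply: trigpolyM => //.
- by case: i => [|i]; [exact: trigpoly_cst|exact: IH].
- apply: (@eq_trigpoly (fun x => 1 + (-1) * f x)) => [x|].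
    by rewrite mulN1r.
  by apply: trigpolyD; [exact: trigpoly_cst|exact: trigpolyZ].
Qed.

Section bernstein_approximation.
Variables (F : 'rV[R]_N -> R) (m : nat).

Let node (k : {ffun 'I_N -> 'I_m.+2}) : 'rV[R]_N := \row_j ((k j)%:R / m.+1%:R).

Let weight u (k : {ffun 'I_N -> 'I_m.+2}) : R :=
  \prod_j bernstein (u 0 j) m.+1 (k j).

Definition bernstein_approx u : R := \sum_k weight u k * F (node k).

Let weight_sum u : \sum_k weight u k = 1.
Proof.
rewrite -(bigA_distr_bigA (fun j (i : 'I_m.+2) => bernstein (u 0 j) m.+1 i)).
by apply: big1 => j _; exact: bernstein_sum.
Qed.

Let weight_variance u j : \sum_k weight u k * (u 0 j - node k 0 j) ^+ 2 =
  u 0 j * (1 - u 0 j) / m.+1%:R.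
Proof.
pose a (l : 'I_N) (i : 'I_m.+2) := bernstein (u 0 l) m.+1 i *
  (if l == j then (u 0 j - i%:R / m.+1%:R) ^+ 2 else 1).
have -> : \sum_k weight u k * (u 0 j - node k 0 j) ^+ 2 =
    \sum_(k : {ffun 'I_N -> 'I_m.+2}) \prod_l a l (k l).
  apply: eq_bigr => k _; rewrite /a big_split/=; congr (_ * _).
  rewrite (bigD1 j)//= eqxx mxE big1 ?mulr1// => l /negbTE ->.
  by [].
rewrite -(bigA_distr_bigA a) (bigD1 j)//= [X in _ * X]big1 ?mulr1; last first.
  move=> l lj; rewrite /a (negbTE lj); under eq_bigr do rewrite mulr1.
  exact: bernstein_sum.
by rewrite /a eqxx bernstein_variance.
Qed.

Let weight_ge0 u k : (forall j, 0 <= u 0 j <= 1) -> 0 <= weight u k.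
Proof. by move=> u01; apply: prodr_ge0 => j _; exact: bernstein_ge0. Qed.

Lemma bernstein_approx_bound M u : (forall x, `|F x| <= M) ->
  (forall j, 0 <= u 0 j <= 1) -> `|bernstein_approx u| <= M.
Proof.
move=> FM u01; rewrite (le_trans (ler_norm_sum _ _ _))//.
rewrite -[leRHS]mul1r -(weight_sum u) mulr_suml; apply: ler_sum => k _.
by rewrite normrM ger0_norm ?weight_ge0// ler_wpM2l ?weight_ge0.
Qed.

(** Bernstein's argument: the weights average F over nodes with mean u and
    with variance at most 1 / (m + 1) in each coordinate, so a quadratic modulus
    of continuity at u is all that is needed of F. *)
Lemma bernstein_approx_error (a C : R) u : 0 <= C ->
  (forall j, 0 <= u 0 j <= 1) ->
  (forall v, `|F u - F v| <= a + C * \sum_j (u 0 j - v 0 j) ^+ 2) ->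
  `|F u - bernstein_approx u| <= a + C * N%:R / m.+1%:R.
Proof.
move=> C0 u01 Fu.
have -> : F u - bernstein_approx u = \sum_k weight u k * (F u - F (node k)).
  under eq_bigr do rewrite mulrBr.
  by rewrite sumrB -mulr_suml weight_sum mul1r.
rewrite (le_trans (ler_norm_sum _ _ _))//.
apply: (@le_trans _ _ (\sum_k (a * weight u k +
    C * \sum_j weight u k * (u 0 j - node k 0 j) ^+ 2))).
  apply: ler_sum => k _; rewrite normrM ger0_norm ?weight_ge0//.
  rewrite -mulr_sumr mulrCA [a * _]mulrC -mulrDr ler_wpM2l ?weight_ge0//.
rewrite big_split/= -!mulr_sumr weight_sum mulr1 lerD2l -mulrA ler_wpM2l//.
rewrite exchange_big/=; apply: (@le_trans _ _ (\sum_(j < N) m.+1%:R^-1)).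
  apply: ler_sum => j _.
  rewrite weight_variance ler_piMl ?invr_ge0//.
  by have /andP[u0 u1] := u01 j; nra.
by rewrite sumr_const card_ord mulr_natl.
Qed.

End bernstein_approximation.

End trigonometric_polynomials.

(** * Levy's continuity theorem *)

Lemma cvg_seq_unique {R : realType} (u : nat -> R) (a b : R) :
  u @ \oo --> a -> u @ \oo --> b -> a = b.
Proof. by move=> ua ub; apply: (@cvg_unique _ (@norm_hausdorff _ R) _ _ a b ua ub). Qed.

Lemma Rintegral_dominated_convergence {R : realType} {d} {T : measurableType d}
    (mu : {measure set T -> \bar R}) (f_ : nat -> T -> R) (f h : T -> R) :
  (forall n, measurable_fun setT (f_ n)) -> measurable_fun setT f ->
  mu.-integrable setT (EFin \o h) -> (forall n w, `|f_ n w| <= h w) ->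
  (forall w, f_ n w @[n --> \oo] --> f w) ->
  Rintegral mu setT (f_ n) @[n --> \oo] --> Rintegral mu setT f.
Proof.
move=> mf_ mf sh f_h f_f.
have cE w : (f_ n w)%:E @[n --> \oo] --> (f w)%:E.
  by apply: cvg_EFin; [exact: nearW|exact: f_f].
have [If _ Hc] := @dominated_convergence _ T R mu setT measurableT
  (fun n => EFin \o f_ n) (EFin \o f) (EFin \o h)
  (fun n => (measurable_EFinP _ _).2 (mf_ n)) ((measurable_EFinP _ _).2 mf)
  (aeW _ (fun w _ => cE w)) sh
  (aeW _ (fun w n _ => f_h n w)).
apply: fine_cvg; rewrite fineK//.
exact: integrable_fin_num.
Qed.

Lemma mean_dominated_convergence {R : realType} {d} {T : measurableType d}
    (P : probability T R) (f_ : nat -> T -> R) (f h : T -> R) :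
  (forall n, measurable_fun setT (f_ n)) -> measurable_fun setT f ->
  summable P h -> (forall n w, `|f_ n w| <= h w) ->
  (forall w, f_ n w @[n --> \oo] --> f w) ->
  mean P (f_ n) @[n --> \oo] --> mean P f.
Proof. exact: Rintegral_dominated_convergence. Qed.

Section trigonometric_approximation.
Context {R : realType} {N : nat}.
Implicit Types (f g : 'rV[R]_N -> R).

(** A bounded continuous function agrees up to [e] on a cube with a
    trigonometric polynomial that obeys the same bound on the whole space: on
    the cube, [x] is close to [tau * sin (x / tau)] for large [tau], and
    a continuous function of sines is uniformly close to its Bernstein
    polynomial in those sines. *)
Lemma trigonometric_approximation f (M L e : R) : continuous f ->
  (forall x, `|f x| <= M) -> 0 < e ->
  exists g, [/\ trigpoly g, forall x, `|g x| <= M &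
    forall x, cube N L x -> `|f x - g x| <= e].
Proof.
move=> cf fM e0.
have M0 : 0 <= M by exact: le_trans (fM 0).
have e2 : 0 < e / 2 by lra.
have [del1 del1_gt0 Hdel1] := uniform_near_cube L cf e2.
pose tau := 1 + 2 * L ^+ 2 / del1.
have L2 : 0 <= 2 * L ^+ 2 / del1.
  by apply: divr_ge0; [apply: mulr_ge0 => //; exact: sqr_ge0|exact: ltW].
have tau_gt0 : 0 < tau by rewrite /tau ltr_pwDl.
pose G (v : 'rV[R]_N) : 'rV[R]_N := \row_j (tau * (2 * v 0 j - 1)).
have cG : continuous G.
  move=> v; apply: (@cvg_entries R _ (nbhs v) _ 1 N G (G v)) => i j.
  rewrite /G; under eq_fun do rewrite mxE; rewrite mxE.
  apply: cvgMr; apply: cvgB; last exact: cvg_cst.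
  by apply: cvgMr; exact: coord_continuous.
pose F (v : 'rV[R]_N) := f (G v).
have cF : continuous F by move=> v; apply: continuous_comp; [exact: cG|exact: cf].
have e4 : 0 < e / 4 by lra.
have [del2 del2_gt0 Hdel2] := uniform_near_cube 1 cF e4.
pose C := 2 * M / del2 ^+ 2.
have C0 : 0 <= C by apply: divr_ge0; [exact: mulr_ge0|exact: sqr_ge0].
pose m := Num.truncn (C * N%:R / (e / 4)).
pose h (x : 'rV[R]_N) : 'rV[R]_N := \row_j ((1 + sin (tau^-1 * x 0 j)) / 2).
have h01 x j : 0 <= h x 0 j <= 1.
  rewrite mxE; have := sin_geN1 (tau^-1 * x 0 j).
  by have := sin_le1 (tau^-1 * x 0 j); move=> *; apply/andP; split; lra.
exists (fun x => bernstein_approx F m (h x)); split.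
- apply: trigpoly_sum => k.
  apply: (@eq_trigpoly _ _ (fun x => F (\row_j ((k j)%:R / m.+1%:R)) *
    \prod_j bernstein (h x 0 j) m.+1 (k j))); first by move=> x; rewrite mulrC.
  apply: trigpolyZ; apply: trigpoly_prod => j; apply: trigpoly_bernstein.
  apply: (@eq_trigpoly _ _ (fun x => 2^-1 *
      (1 + sin (dotv (tau^-1 *: delta_mx 0 j) x)))) => [x|].
    by rewrite mxE dotv_delta mulrC.
  by apply: trigpolyZ; apply: trigpolyD; [exact: trigpoly_cst|exact: trigpoly_sin].
- by move=> x; apply: bernstein_approx_bound => // v; exact: fM.
- move=> x Lx.
  have fF : `|f x - F (h x)| <= e / 2.
    apply/ltW/Hdel1 => // j; rewrite !mxE.
    have -> : x 0 j - tau * (2 * ((1 + sin (tau^-1 * x 0 j)) / 2) - 1) =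
        - (tau * (sin (tau^-1 * x 0 j) - tau^-1 * x 0 j)).
      by field; rewrite gt_eqF.
    rewrite normrN normrM gtr0_norm//.
    apply: (@le_lt_trans _ _ (2 * L ^+ 2 / tau)); last first.
      rewrite ltr_pdivrMr// (_ : del1 * tau = del1 + 2 * L ^+ 2) ?ltrDr//.
      by rewrite /tau; field; rewrite gt_eqF.
    rewrite mulrC -ler_pdivlMr// (le_trans (sin_taylor _))//.
    apply: (@le_trans _ _ (2 * (tau^-1 * x 0 j) ^+ 2)).
      by rewrite ler_pM2l// ler_piMr ?sqr_ge0// ge_min lexx.
    rewrite [leRHS](_ : _ = 2 * (tau^-1 ^+ 2 * L ^+ 2)); last by field; rewrite gt_eqF.
    rewrite exprMn ler_pM2l// ler_wpM2l ?sqr_ge0//.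
    by rewrite -[leLHS]real_normK ?num_real// lerXn2r ?nnegrE ?(le_trans _ (Lx j)).
  have FB : `|F (h x) - bernstein_approx F m (h x)| <= e / 4 + C * N%:R / m.+1%:R.
    apply: bernstein_approx_error => // v.
    have S0 j : 0 <= (h x 0 j - v 0 j) ^+ 2 by exact: sqr_ge0.
    have [H|] := pselect (forall j, `|h x 0 j - v 0 j| < del2).
      rewrite (@le_trans _ _ (e / 4))//.
        apply/ltW/Hdel2 => // j.
        by have /andP[? ?] := h01 x j; rewrite ger0_norm.
      by rewrite lerDl mulr_ge0// sumr_ge0.
    move=> /existsNP[j /negP]; rewrite -leNgt => jd.
    have : `|F (h x) - F v| <= 2 * M.
      rewrite (le_trans (ler_normB _ _))//.
      by have := fM (G (h x)); have := fM (G v); rewrite /F; lra.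
    move=> /le_trans; apply; rewrite (@le_trans _ _ (C * del2 ^+ 2))//.
      by rewrite /C divfK// sqrf_eq0 gt_eqF.
    rewrite (@le_trans _ _ (C * \sum_j (h x 0 j - v 0 j) ^+ 2))//; last first.
      by rewrite lerDr ltW.
    rewrite ler_wpM2l// (bigD1 j)//= -[leLHS]addr0 lerD ?sumr_ge0//.
    by rewrite -[leRHS]real_normK ?num_real// lerXn2r ?nnegrE// ltW.
  have Cm : C * N%:R / m.+1%:R <= e / 4.
    rewrite ler_pdivrMr ?ltr0n// [leRHS]mulrC -ler_pdivrMr//; apply/ltW.
    exact: Num.Theory.truncnS_gt.
  rewrite (_ : _ - _ = (f x - F (h x)) +
    (F (h x) - bernstein_approx F m (h x))); last by ring.
  rewrite (le_trans (ler_normD _ _))//.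
  move: fF FB Cm; move: (C * _ / _) => z; lra.
Qed.

End trigonometric_approximation.

Section levy.
Context {R : realType} {d d' : measure_display} {T : measurableType d}
  {T' : measurableType d'} {N : nat}.
Variables (P : probability T R) (Q : probability T' R).
Variables (X : nat -> T -> 'rV[R]_N) (W : T' -> 'rV[R]_N).
Hypotheses (mX : forall n, measurable_entries (X n))
  (mW : measurable_entries W).

Lemma summable_comp_bounded {d1} {S : measurableType d1} (P1 : probability S R)
    (V : S -> 'rV[R]_N) (f : 'rV[R]_N -> R) M :
  measurable_entries V -> continuous f -> (forall x, `|f x| <= M) ->
  summable P1 (f \o V).
Proof.
move=> mV cf fM; apply: (@summable_bounded _ _ _ _ _ M).
  exact: measurable_continuous_entries.
by move=> w; exact: fM.
Qed.

Lemma continuous_dotv (s : 'rV[R]_N) : continuous (dotv s).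
Proof.
move=> x; apply: (@cvg_bigsum R _ (nbhs x)) => j _; apply: cvgM; first exact: cvg_cst.
exact: coord_continuous.
Qed.

Lemma continuous_cos_dotv (s : 'rV[R]_N) (theta : R) :
  continuous (fun x => cos (dotv s x + theta)).
Proof.
move=> x; apply: (@continuous_comp _ _ _ (fun x => dotv s x + theta) cos); last exact: continuous_cos.
exact: (cvgD (@continuous_dotv s x) (cvg_cst theta)).
Qed.

Lemma continuous_trigpoly (g : 'rV[R]_N -> R) : trigpoly g -> continuous g.
Proof.
elim=> [s theta|f1 f2 _ c1 _ c2|c f _ cf] x.
- exact: continuous_cos_dotv.
- exact: (cvgD (c1 x) (c2 x)).
- exact: (cvgM (cvg_cst c) (cf x)).
Qed.

Lemma bounded_trigpoly (g : 'rV[R]_N -> R) :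
  trigpoly g -> exists M, forall x, `|g x| <= M.
Proof.
elim=> [s theta|f1 f2 _ [M1 c1] _ [M2 c2]|c f _ [M cf]].
- by exists 1 => x; exact: cos_max.
- exists (M1 + M2) => x; rewrite (le_trans (ler_normD _ _))//.
  by rewrite lerD.
- by exists (`|c| * M) => x; rewrite normrM ler_wpM2l.
Qed.

Lemma summable_trigpoly {d1} {S : measurableType d1} (P1 : probability S R)
    (V : S -> 'rV[R]_N) (g : 'rV[R]_N -> R) :
  measurable_entries V -> trigpoly g -> summable P1 (g \o V).
Proof.
move=> mV tg; have [M gM] := bounded_trigpoly tg.
by apply: (summable_comp_bounded _ mV _ gM); exact: continuous_trigpoly.
Qed.

Lemma trigpoly_sequence (f : 'rV[R]_N -> R) (M : R) : continuous f ->
  (forall x, `|f x| <= M) -> exists g : nat -> 'rV[R]_N -> R, forall L,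
    [/\ trigpoly (g L), forall x, `|g L x| <= M &
      forall x, cube N L.+1%:R x -> `|f x - g L x| <= L.+1%:R^-1].
Proof.
move=> cf fM.
have step (L : nat) : exists g, [/\ trigpoly g, forall x, `|g x| <= M &
    forall x, cube N L.+1%:R x -> `|f x - g x| <= L.+1%:R^-1].
  by apply: trigonometric_approximation => //; rewrite invr_gt0.
by have [g gP] := boolp.choice step; exists g.
Qed.

Lemma trigpoly_sequence_cvg {d1} {S : measurableType d1} (P1 : probability S R)
    (V : S -> 'rV[R]_N) (f : 'rV[R]_N -> R) (M : R) (g : nat -> 'rV[R]_N -> R) :
  continuous f -> measurable_entries V ->
  (forall L, [/\ trigpoly (g L), forall x, `|g L x| <= M &
      forall x, cube N L.+1%:R x -> `|f x - g L x| <= L.+1%:R^-1]) ->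
  mean P1 (g L \o V) @[L --> \oo] --> mean P1 (f \o V).
Proof.
move=> cf mV gP.
apply: (@mean_dominated_convergence _ _ _ _ _ _ (cst M)).
- move=> L; apply: (@summable_measurable _ _ _ P1); apply: summable_trigpoly => //.
  by case: (gP L).
- exact: measurable_continuous_entries.
- exact: summable_cst.
- by move=> L w; case: (gP L) => _ + _; exact.
move=> w; apply/cvgrPdist_le => e e0.
near=> L; case: (gP L) => _ _ /(_ (V w)) H; rewrite /=.
apply: (le_trans (H _)); last by apply/ltW; near: L; exact: near_infty_natSinv_lt (PosNum e0).
move=> j; apply: (@le_trans _ _ (\sum_l `|V w 0 l|)).
  by rewrite (bigD1 j)//= lerDl sumr_ge0.
by apply: (@le_trans _ _ L%:R); [near: L; exact: nbhs_infty_ger|rewrite ler_nat].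
Unshelve. all: by end_near.
Qed.

Hypothesis cvg_cosX : forall s theta,
  mean P (fun w => cos (dotv s (X n w) + theta)) @[n --> \oo] -->
  mean Q (fun w => cos (dotv s (W w) + theta)).

Lemma cvg_mean_trigpoly g : trigpoly g ->
  mean P (g \o X n) @[n --> \oo] --> mean Q (g \o W).
Proof.
elim=> [s theta|f1 f2 t1 c1 t2 c2|c f t cf].
- exact: cvg_cosX.
- rewrite /comp meanD; [|exact: summable_trigpoly mW t1|exact: summable_trigpoly mW t2].
  rewrite (_ : (fun n => _) = (fun n => mean P (f1 \o X n) + mean P (f2 \o X n))).
    exact: cvgD.
  apply/funext => n; rewrite meanD//; exact: summable_trigpoly.
- rewrite /comp meanZ; last exact: summable_trigpoly mW t.
  rewrite (_ : (fun n => _) = (fun n => c * mean P (f \o X n))).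
    by apply: cvgM => //; exact: cvg_cst.
  apply/funext => n; rewrite meanZ//; exact: summable_trigpoly.
Qed.

Variable C : R.
Hypothesis sX : forall n j, summable P (fun w => X n w 0 j ^+ 2).
Hypothesis X2 : forall n j, mean P (fun w => X n w 0 j ^+ 2) <= C.

(** Off the cube of half-width [L], the function [sum_j x_j^2 / L^2] exceeds
    [1], so bounded second moments control the error there. *)
Lemma tail_error (f g : 'rV[R]_N -> R) (M L e : R) n :
  measurable_fun setT (f \o X n) -> measurable_fun setT (g \o X n) ->
  (forall x, `|f x| <= M) -> (forall x, `|g x| <= M) -> 0 < L -> 0 <= e ->
  (forall x, cube N L x -> `|f x - g x| <= e) ->
  `|mean P (f \o X n) - mean P (g \o X n)| <= e + 2 * M * (N%:R * C) / L ^+ 2.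
Proof.
move=> mf mg fM gM L0 e0 fg; have M0 : 0 <= M by exact: le_trans (fM 0).
have sf : summable P (f \o X n).
  by apply: (@summable_bounded _ _ _ _ _ M) => // w; exact: fM.
have sg : summable P (g \o X n).
  by apply: (@summable_bounded _ _ _ _ _ M) => // w; exact: gM.
rewrite -meanB//.
pose h w := e + (2 * M / L ^+ 2) * \sum_j X n w 0 j ^+ 2.
have sS : summable P (fun w => \sum_j X n w 0 j ^+ 2) by exact: summable_sum.
have sh : summable P h by apply: summableD; [exact: summable_cst|exact: summableZ].
have c0 : 0 <= 2 * M / L ^+ 2 by apply: divr_ge0; [exact: mulr_ge0|exact: sqr_ge0].
apply: (@le_trans _ _ (mean P h)).
  apply: norm_mean_le => //.
    exact: summableB.
  move=> w; rewrite /h /=.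
  have S0 j : 0 <= X n w 0 j ^+ 2 by exact: sqr_ge0.
  have [H|] := pselect (cube N L (X n w)).
    by rewrite (le_trans (fg _ H))// lerDl mulr_ge0// sumr_ge0.
  move=> /existsNP[j /negP]; rewrite -ltNge => jL.
  rewrite (@le_trans _ _ (2 * M))//.
    rewrite (le_trans (ler_normB _ _))//.
    by have := fM (X n w); have := gM (X n w); lra.
  rewrite (@le_trans _ _ (2 * M / L ^+ 2 * L ^+ 2))//.
    by rewrite divfK// sqrf_eq0 gt_eqF.
  rewrite -[leLHS]add0r lerD// ler_wpM2l//.
  rewrite (bigD1 j)//= -[leLHS]addr0 lerD ?sumr_ge0//.
  by rewrite -[leRHS]real_normK ?num_real// lerXn2r ?nnegrE// ltW.
rewrite /h meanD; [|exact: summable_cst|exact: summableZ].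
rewrite mean_cst lerD2l meanZ// mean_sum// mulrAC ler_pM2r ?invr_gt0 ?exprn_gt0//.
rewrite ler_wpM2l ?mulr_ge0//.
by rewrite -[N in leRHS]card_ord -sum1_card natr_sum mulr_suml ler_sum// => j _; rewrite mul1r.
Qed.

(** On a large cube f is close to a trigonometric polynomial, whose means
    converge by hypothesis; off the cube both are bounded, and Chebyshev's
    inequality bounds the mass there by the second moments. *)
Lemma levy_continuity (f : 'rV[R]_N -> R) (M : R) : continuous f ->
  (forall x, `|f x| <= M) ->
  mean P (f \o X n) @[n --> \oo] --> mean Q (f \o W).
Proof.
move=> cf fM; have M0 : 0 <= M by exact: le_trans (fM 0).
have [g gP] := trigpoly_sequence cf fM.
have gW : mean Q (g L \o W) @[L --> \oo] --> mean Q (f \o W).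
  exact: trigpoly_sequence_cvg cf mW gP.
apply/cvgrPdist_le => e e0.
pose B L := L.+1%:R^-1 + 2 * M * (N%:R * C) / L.+1%:R ^+ 2.
have B0 : B L @[L --> \oo] --> 0.
  rewrite -[X in _ --> X](addr0 0) -[X in _ --> _ + X](mulr0 (2 * M * (N%:R * C))).
  apply: cvgD; first exact: cvg_harmonic.
  apply: cvgM; first exact: cvg_cst.
  rewrite -[X in _ --> X](mulr0 0); under eq_fun do rewrite expr2 invfM.
  by apply: cvgM; exact: cvg_harmonic.
have [L [LB Lg]] : exists L, B L <= e / 3 /\ `|mean Q (f \o W) - mean Q (g L \o W)| <= e / 3.
  have e3 : 0 < e / 3 by lra.
  have H1 : \forall L \near \oo, B L <= e / 3.
    move/cvgrPdist_le : B0 => /(_ _ e3); apply: filterS => L.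
    by rewrite sub0r normrN; exact: le_trans (ler_norm _).
  have H2 : \forall L \near \oo, `|mean Q (f \o W) - mean Q (g L \o W)| <= e / 3.
    by move/cvgrPdist_le : gW; apply.
  have [L [? ?]] := filter_ex (filterI H1 H2).
  by exists L.
have [tg gM fg] := gP L.
have := cvg_mean_trigpoly tg => /cvgrPdist_le /(_ (e / 3)) cg.
have {}cg := cg ltac:(lra).
apply: filterS cg => n cg.
have := tail_error (measurable_continuous_entries (mX n) cf)
  (measurable_continuous_entries (mX n) (continuous_trigpoly tg)) fM gM _ _ fg.
rewrite ltr0n invr_ge0 ler0n => /(_ isT isT); rewrite -/(B L) => Xn.
rewrite (_ : _ - _ = (mean Q (f \o W) - mean Q (g L \o W)) +
  ((mean Q (g L \o W) - mean P (g L \o X n)) -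
   (mean P (f \o X n) - mean P (g L \o X n)))); last by ring.
rewrite (le_trans (ler_normD _ _))// (_ : e = e / 3 + (e / 3 + e / 3)); last by field.
rewrite lerD// (le_trans (ler_normB _ _))// lerD//.
exact: le_trans LB.
Unshelve. all: by end_near.
Qed.

End levy.

Section uniqueness.
Context {R : realType} {d d' : measure_display} {T : measurableType d}
  {T' : measurableType d'} {N : nat}.
Variables (P : probability T R) (Q : probability T' R).
Variables (X : T -> 'rV[R]_N) (W : T' -> 'rV[R]_N).
Hypotheses (mX : measurable_entries X) (mW : measurable_entries W).
Hypothesis eq_cos : forall s theta,
  mean P (fun w => cos (dotv s (X w) + theta)) = mean Q (fun w => cos (dotv s (W w) + theta)).

Lemma characteristic_uniqueness (f : 'rV[R]_N -> R) (M : R) : continuous f ->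
  (forall x, `|f x| <= M) -> mean P (f \o X) = mean Q (f \o W).
Proof.
move=> cf fM; have [g gP] := trigpoly_sequence cf fM.
have gX : mean P (g L \o X) @[L --> \oo] --> mean P (f \o X).
  exact: trigpoly_sequence_cvg cf mX gP.
have gW : mean Q (g L \o W) @[L --> \oo] --> mean Q (f \o W).
  exact: trigpoly_sequence_cvg cf mW gP.
have E L : mean P (g L \o X) = mean Q (g L \o W).
  have [tg _ _] := gP L.
  elim: tg => [s theta|f1 f2 t1 e1 t2 e2|c h t eh]; first exact: eq_cos.
  - by rewrite /comp !meanD; [congr (_ + _)|
      exact: summable_trigpoly mW t1|exact: summable_trigpoly mW t2|
      exact: summable_trigpoly mX t1|exact: summable_trigpoly mX t2].
  - by rewrite /comp !meanZ; [congr (_ * _)|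
      exact: summable_trigpoly mW t|exact: summable_trigpoly mX t].
have {}gW : mean P (g L \o X) @[L --> \oo] --> mean Q (f \o W).
  by under eq_fun do rewrite E.
exact: cvg_seq_unique gX gW.
Qed.

End uniqueness.

(** * A continuous mapping theorem for varying maps *)

Section continuous_convergence.
Context {R : realType} {d : measure_display} {T : measurableType d} {D N : nat}.
Variables (P : probability T R) (U : nat -> T -> 'rV[R]_D) (C : R).
Hypotheses (mU : forall n, measurable_entries (U n))
  (sU : forall n j, summable P (fun w => U n w 0 j ^+ 2))
  (U2 : forall n j, mean P (fun w => U n w 0 j ^+ 2) <= C).
Variables (F_ : nat -> 'rV[R]_D -> 'rV[R]_N) (F : 'rV[R]_D -> 'rV[R]_N).
Hypotheses (cF : continuous F)
  (F_F : forall u, F_ z.2 z.1 @[z --> (nbhs u, \oo)] --> F u).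
Variable X : nat -> T -> 'rV[R]_N.
Hypotheses (mX : forall n, measurable_entries (X n))
  (XE : \forall n \near \oo, forall w, X n w = F_ n (U n w)).

(** Convergence along neighbourhoods of each point is uniform on a cube, by
    compactness. *)
Lemma continuous_convergence_uniform (f : 'rV[R]_N -> R) (L e : R) :
  continuous f -> 0 < e ->
  \forall n \near \oo, forall u, cube D L u -> `|f (F_ n u) - f (F u)| <= e.
Proof.
move=> cf e0; have /compact_near_coveringP cK := @compact_cube R D L.
apply: (cK _ _ (fun n u => `|f (F_ n u) - f (F u)| <= e)) => u _.
have H : (fun z : 'rV[R]_D * nat => f (F_ z.2 z.1) - f (F z.1))
    @ (nbhs u, \oo) --> f (F u) - f (F u).
  apply: cvgB.
    by apply: (@cvg_comp _ _ _ (fun z : 'rV[R]_D * nat => F_ z.2 z.1) f _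
      (nbhs (F u))); [exact: F_F|exact: cf].
  apply: (@cvg_comp _ _ _ fst (f \o F) _ (nbhs u)); first exact: cvg_fst.
  have : continuous (f \o F).
    by move=> v; apply: continuous_comp; [exact: cF|exact: cf].
  exact.
rewrite subrr in H.
have /cvgr0Pnorm_le /(_ _ e0) := H.
done.
Qed.

(** A continuous mapping theorem for maps that vary with [n]: it contains
    Slutsky's lemma, because deterministic and vanishing random corrections can
    be absorbed in [F_ n]. *)
Lemma continuous_convergence_mean (f : 'rV[R]_N -> R) (M : R) :
  continuous f -> (forall x, `|f x| <= M) ->
  mean P (f \o X n) - mean P (f \o (F \o U n)) @[n --> \oo] --> 0.
Proof.
move=> cf fM; apply/cvgr0Pnorm_le => e e0.
have [L L0 LC] : exists2 L, 0 < L & 2 * M * (D%:R * C) / L ^+ 2 <= e / 2.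
  set K := 2 * M * _; have K0 : 0 <= 2 * `|K| / e.
    by apply: divr_ge0; [apply: mulr_ge0|exact: ltW].
  exists (1 + 2 * `|K| / e); first by rewrite ltr_pwDl.
  set L := 1 + _; have L1 : 1 <= L by rewrite /L lerDl.
  rewrite ler_pdivrMr ?exprn_gt0 ?(lt_le_trans ltr01 L1)//.
  rewrite (le_trans (ler_norm K))// (@le_trans _ _ (e / 2 * L))//.
    by rewrite /L (_ : _ * _ = e / 2 + `|K|); [rewrite lerDr; lra|field; rewrite gt_eqF].
  by rewrite ler_pM2l ?divr_gt0// expr2 ler_peMr// (le_trans ler01 L1).
have e2 : 0 < e / 2 by lra.
have := continuous_convergence_uniform L cf e2.
apply: filterS2 XE => n XnE uni.
have -> : f \o X n = (f \o F_ n) \o U n by apply/funext => w; rewrite /= XnE.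
have mfX : measurable_fun setT ((f \o F_ n) \o U n).
  rewrite (_ : _ \o _ = f \o X n); first exact: measurable_continuous_entries.
  by apply/funext => w; rewrite /= XnE.
have mfU : measurable_fun setT ((f \o F) \o U n).
  apply: measurable_continuous_entries => // u.
  by apply: continuous_comp; [exact: cF|exact: cf].
have := @tail_error _ _ _ _ P U C sU U2 (f \o F_ n) (f \o F) M L (e / 2) n mfX mfU.
move=> /(_ _ _ L0 _ uni) H; apply: (le_trans (H _ _ _)).
- by move=> u; exact: fM.
- by move=> u; exact: fM.
- exact: ltW.
- by rewrite [leRHS](_ : e = e / 2 + e / 2); [rewrite lerD2l|field].
Qed.

Context {d' : measure_display} {T' : measurableType d'}.
Variables (Q : probability T' R) (W : T' -> 'rV[R]_N) (C' : R).
Hypotheses (mW : measurable_entries W)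
  (sF : forall n j, summable P (fun w => F (U n w) 0 j ^+ 2))
  (F2 : forall n j, mean P (fun w => F (U n w) 0 j ^+ 2) <= C').
Hypothesis cvg_cosF : forall s theta,
  mean P (fun w => cos (dotv s (F (U n w)) + theta)) @[n --> \oo] -->
  mean Q (fun w => cos (dotv s (W w) + theta)).

Lemma continuous_convergence_law (f : 'rV[R]_N -> R) (M : R) :
  continuous f -> (forall x, `|f x| <= M) ->
  mean P (f \o X n) @[n --> \oo] --> mean Q (f \o W).
Proof.
move=> cf fM.
have mFU n : measurable_entries (F \o U n).
  move=> i j; rewrite (ord1 i); apply: (@measurable_continuous_entries _ _ _ _ _ (U n)
    (fun u => F u 0 j)) => // u.
  have H := @cvg_entry R _ (nbhs u) 1 N F (F u) 0 j (@cF u).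
  exact: H.
have : (mean P (f \o X n) - mean P (f \o (F \o U n))) +
    mean P (f \o (F \o U n)) @[n --> \oo] --> 0 + mean Q (f \o W).
  apply: cvgD; first exact: continuous_convergence_mean cf fM.
  exact: (levy_continuity mFU mW cvg_cosF sF F2 cf fM).
by rewrite add0r; under eq_fun do rewrite subrK.
Qed.

End continuous_convergence.

(** * Independence and means of products *)

Section bounded_measurable_functions.
Context {R : realType} {d d' : measure_display} {T : measurableType d}
  {S : measurableType d'}.
Variables (P : probability T R).

Definition bounded_measurable {d1} {S1 : measurableType d1} (g : S1 -> R) : Prop :=
  measurable_fun setT g /\ exists M, forall x, `|g x| <= M.

Lemma bounded_measurable_summable (g : T -> R) :
  bounded_measurable g -> summable P g.
Proof. by case=> mg [M gM]; exact: summable_bounded gM. Qed.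

Lemma bounded_measurable_comp (X : T -> S) (g : S -> R) :
  measurable_fun setT X -> bounded_measurable g -> bounded_measurable (g \o X).
Proof.
move=> mX [mg [M gM]]; split; first exact: measurableT_comp.
by exists M => w; exact: gM.
Qed.

Lemma bounded_measurableM (f g : T -> R) : bounded_measurable f ->
  bounded_measurable g -> bounded_measurable (fun w => f w * g w).
Proof.
move=> [mf [M fM]] [mg [M' gM]]; split; first exact: measurable_funM.
by exists (M * M') => w; rewrite normrM ler_pM.
Qed.

Lemma bounded_measurable_indic {d1} {S1 : measurableType d1} (A : set S1) :
  measurable A -> bounded_measurable (\1_A : S1 -> R).
Proof.
move=> mA; split; first exact: measurable_indic.
by exists 1 => x; rewrite indicE; case: (_ \in _); rewrite ?normr1 ?normr0.
Qed.

Lemma bounded_measurable_prod I (r : seq I) (Q : pred I) (f : I -> T -> R) :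
  (forall i, bounded_measurable (f i)) ->
  bounded_measurable (fun w => \prod_(i <- r | Q i) f i w).
Proof.
move=> bf; elim: r => [|i r IH].
  under eq_fun do rewrite big_nil; split; first exact: measurable_cst.
  by exists 1 => x; rewrite normr1.
under eq_fun do rewrite big_cons; case: (Q i) => //.
exact: bounded_measurableM.
Qed.

Lemma bounded_measurable_cos {d1} {S1 : measurableType d1} (f : S1 -> R) :
  measurable_fun setT f -> bounded_measurable (fun x => cos (f x)).
Proof.
move=> mf; split; last by exists 1 => x; exact: cos_max.
have mc : measurable_fun setT (@cos R).
  by apply: continuous_measurable_fun; exact: continuous_cos.
exact: measurableT_comp mc mf.
Qed.

Lemma bounded_measurable_sin {d1} {S1 : measurableType d1} (f : S1 -> R) :
  measurable_fun setT f -> bounded_measurable (fun x => sin (f x)).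
Proof.
move=> mf; split; last by exists 1 => x; exact: sin_max.
have mc : measurable_fun setT (@sin R).
  by apply: continuous_measurable_fun; exact: continuous_sin.
exact: measurableT_comp mc mf.
Qed.

End bounded_measurable_functions.

Section weighted_integrals.
Context {R : realType} {d d' : measure_display} {S : measurableType d'}.

Lemma step_approximation (g : S -> R) (del : R) : bounded_measurable g ->
  0 < del -> exists n (c : 'I_n -> R) (B : 'I_n -> set S),
    (forall k, measurable (B k)) /\
    forall x, `|g x - \sum_k c k * \1_(B k) x| <= del.
Proof.
move=> [mg [M gM]] del0.
pose idx x := Num.truncn ((g x + M) / del).
have gM0 x : 0 <= (g x + M) / del.
  by apply: divr_ge0; [have := gM x; rewrite ler_norml => /andP[? _]; lra|exact: ltW].
have idxP x : (idx x)%:R * del <= g x + M < (idx x).+1%:R * del.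
  rewrite -ler_pdivlMr// -ltr_pdivrMr//.
  exact: Num.Theory.truncn_itv.
pose n := (Num.truncn ((M + M) / del)).+1.
exists n, (fun k : 'I_n => k%:R * del - M), (fun k : 'I_n => [set x | idx x = k]).
split=> [k|x].
  rewrite (_ : [set x | _] = g @^-1` `[k%:R * del - M, k.+1%:R * del - M[).
    by rewrite -[X in measurable X]setTI; apply: mg.
  apply/seteqP; split=> x /=; rewrite in_itv/=.
    by move=> xk; have /andP[] := idxP x; rewrite xk => *; apply/andP; split; lra.
  move=> /andP[h1 h2]; apply/eqP; rewrite /idx Num.Theory.truncn_eq//.
  by rewrite ler_pdivlMr// ltr_pdivrMr//; apply/andP; split; lra.
have idxn : (idx x < n)%N.
  rewrite ltnS; apply: Num.Theory.le_truncn; rewrite ler_pM2r ?invr_gt0// lerD2r.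
  by have := gM x; rewrite ler_norml => /andP[].
rewrite (bigD1 (Ordinal idxn))//= big1 ?addr0; last first.
  move=> k kx; rewrite indicE memNset ?mulr0//= => xk.
  by move/eqP : kx; apply; apply/val_inj.
rewrite indicE mem_set//= mulr1.
have /andP[] := idxP x; rewrite -natr1 mulrDl mul1r => h1 h2.
by rewrite ler_norml; apply/andP; split; lra.
Qed.

Context {T : measurableType d} (mu : {measure set T -> \bar R}).
Variables (X : T -> S) (H : T -> R).
Hypotheses (mX : measurable_fun setT X) (iH : mu.-integrable setT (EFin \o H)).

(** Means of products of independent factors and means against a density both
    have this form, with a fixed weight H. *)
Definition weighted_integral (g : S -> R) : R :=
  Rintegral mu setT (fun w => g (X w) * H w).

Lemma integrable_weighted (g : S -> R) : bounded_measurable g ->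
  mu.-integrable setT (EFin \o (fun w => g (X w) * H w)).
Proof.
move=> [mg [M gM]].
have mH : measurable_fun setT H by exact/measurable_EFinP/measurable_int/iH.
apply: (@le_integrable _ _ R mu setT measurableT _ (fun w => (M%:E * (`|H w|)%:E)%E)).
- by apply/measurable_EFinP; apply: measurable_funM => //; exact: measurableT_comp.
- move=> w _; rewrite /= lee_fin normrM (le_trans _ (ler_norm _))// ler_wpM2r//.
- have iN : mu.-integrable setT (EFin \o (fun w => `|H w|)) by exact: integrable_norm.
  by apply: (integrableZl _ M iN).
Qed.

Lemma weighted_integral_step n (c : 'I_n -> R) (B : 'I_n -> set S) :
  (forall k, measurable (B k)) ->
  weighted_integral (fun x => \sum_k c k * \1_(B k) x) = \sum_k c k * weighted_integral \1_(B k).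
Proof.
move=> mB; have iB k := integrable_weighted (bounded_measurable_indic (mB k)).
have iaB k : mu.-integrable setT (fun w => (c k * (\1_(B k) (X w) * H w))%:E).
  by apply: (integrableZl _ (c k) (iB k)).
rewrite /weighted_integral /Rintegral (_ : (fun w => _) = (fun w =>
    \sum_k (c k * (\1_(B k) (X w) * H w))%:E)%E); last first.
  apply/funext => w; rewrite sumEFin mulr_suml; congr EFin.
  by apply: eq_bigr => k _; rewrite mulrA.
rewrite integral_sum//= -[LHS]/(fine _) (eq_bigr (fun k => (c k * weighted_integral \1_(B k))%:E)).
  by rewrite sumEFin.
move=> k _; rewrite (integralZl _ (iB k))//= EFinM; congr (_ * _)%E.
by rewrite /weighted_integral /Rintegral fineK//; exact: integrable_fin_num (iB k).
Qed.

Lemma weighted_integral_lipschitz (g h : S -> R) del : bounded_measurable g ->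
  bounded_measurable h -> (forall x, `|g x - h x| <= del) ->
  `|weighted_integral g - weighted_integral h| <= del * Rintegral mu setT (fun w => `|H w|).
Proof.
move=> bg bh gh; have ig := integrable_weighted bg; have ih := integrable_weighted bh.
rewrite /weighted_integral -RintegralB//.
have iB : mu.-integrable setT (EFin \o (fun w => g (X w) * H w - h (X w) * H w)).
  by rewrite /comp; under eq_fun do rewrite EFinB; apply: integrableB.
have iN : mu.-integrable setT (EFin \o (fun w => `|H w|)) by exact: integrable_norm.
rewrite (le_trans (le_normr_Rintegral _ iB))// -RintegralZl//.
apply: le_Rintegral => //.
- exact: integrable_norm.
- by apply: (integrableZl _ del iN).
- by move=> w _; rewrite -mulrBl normrM ler_wpM2r.
Qed.

End weighted_integrals.

(** Two weighted integrals that agree on indicators agree on bounded functions,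
    because steps are uniformly dense in those. *)
Lemma weighted_integral_ext {R : realType} {d d1 d2} {S : measurableType d}
    {T1 : measurableType d1} {T2 : measurableType d2}
    (mu1 : {measure set T1 -> \bar R}) (mu2 : {measure set T2 -> \bar R})
    (X1 : T1 -> S) (X2 : T2 -> S) (H1 : T1 -> R) (H2 : T2 -> R) :
  measurable_fun setT X1 -> measurable_fun setT X2 ->
  mu1.-integrable setT (EFin \o H1) -> mu2.-integrable setT (EFin \o H2) ->
  (forall B, measurable B ->
    weighted_integral mu1 X1 H1 \1_B = weighted_integral mu2 X2 H2 \1_B) ->
  forall g, bounded_measurable g ->
    weighted_integral mu1 X1 H1 g = weighted_integral mu2 X2 H2 g.
Proof.
move=> mX1 mX2 iH1 iH2 HB g bg.
apply/eqP; rewrite -subr_eq0 -normr_le0; apply/ler_addgt0Pl => e e0; rewrite addr0.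
set K1 := Rintegral mu1 setT (fun w => `|H1 w|); set K2 := Rintegral mu2 setT (fun w => `|H2 w|).
have K1_ge0 : 0 <= K1 by apply: Rintegral_ge0.
have K2_ge0 : 0 <= K2 by apply: Rintegral_ge0.
have K0 : 0 < K1 + K2 + 1 by lra.
have [n [c [B [mB gB]]]] := step_approximation bg (divr_gt0 e0 K0).
pose h x := \sum_k c k * \1_(B k) x.
have bh : bounded_measurable h.
  split; first by apply: measurable_sum => k; apply: measurable_funM.
  exists (\sum_k `|c k|) => x; rewrite (le_trans (ler_norm_sum _ _ _))//.
  apply: ler_sum => k _; rewrite normrM ler_piMr// indicE.
  by case: (_ \in _); rewrite ?normr1 ?normr0.
have d1' := weighted_integral_lipschitz mX1 iH1 bg bh gB.
have d2' := weighted_integral_lipschitz mX2 iH2 bg bh gB.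
rewrite -/K1 in d1'; rewrite -/K2 in d2'.
have hE : weighted_integral mu1 X1 H1 h = weighted_integral mu2 X2 H2 h.
  by rewrite !weighted_integral_step//; apply: eq_bigr => k _; rewrite HB.
rewrite (_ : _ - _ = (weighted_integral mu1 X1 H1 g - weighted_integral mu1 X1 H1 h) -
  (weighted_integral mu2 X2 H2 g - weighted_integral mu2 X2 H2 h)); last by rewrite hE; ring.
rewrite (le_trans (ler_normB _ _))// (le_trans (lerD d1' d2'))// -mulrDr.
by rewrite mulrAC ler_pdivrMr// ler_pM2l//; lra.
Qed.

Section independent_products.
Context {R : realType} {d d' : measure_display} {T : measurableType d}
  {S : measurableType d'}.
Variables (P : probability T R).

Lemma mean_factor (X : T -> S) (H : T -> R) (c : R) :
  measurable_fun setT X -> bounded_measurable H ->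
  (forall B, measurable B ->
    mean P (fun w => \1_B (X w) * H w) = mean P (\1_B \o X) * c) ->
  forall g, bounded_measurable g ->
    mean P (fun w => g (X w) * H w) = mean P (g \o X) * c.
Proof.
move=> mX bH HB.
have E g : bounded_measurable g -> mean P (g \o X) * c = weighted_integral P X (cst c) g.
  move=> bg; rewrite mulrC -meanZ; last first.
    exact/bounded_measurable_summable/(bounded_measurable_comp mX).
  by apply: eq_mean => w; rewrite mulrC.
move=> g bg; rewrite E//; apply: weighted_integral_ext => //.
- exact: bounded_measurable_summable.
- exact: summable_cst.
- by move=> B mB; rewrite -E; [exact: HB|exact: bounded_measurable_indic].
Qed.

Variable e : nat -> T -> S.
Hypotheses (me : forall t, measurable_fun setT (e t))
  (ie : mutually_independent P e).

Lemma mean_prod_indic (A : nat -> set S) n : (forall t, measurable (A t)) ->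
  mean P (fun w => \prod_(t < n) \1_(A t) (e t w)) =
  \prod_(t < n) mean P (\1_(A t) \o e t).
Proof.
move=> mA.
have mP t : mean P (\1_(A t) \o e t) = fine (P (e t @^-1` A t)).
  rewrite -mean_indic; first by congr mean.
  by rewrite -[X in measurable X]setTI; exact: me.
under [RHS]eq_bigr do rewrite mP.
have := ie (iota_uniq 0 n) mA; set B := (X in P X) => PB.
have -> : (fun w => \prod_(t < n) \1_(A t) (e t w)) = \1_B :> (T -> R).
  apply/funext => w; rewrite [RHS]indicE.
  have [wB|wB] := boolP (w \in B).
    have {}wB t : t \in iota 0 n -> A t (e t w) by move: (set_mem wB) => /(_ t).
    by apply: big1 => t _; rewrite indicE mem_set//; apply: wB; rewrite mem_iota/=.
  have /existsNP[t /not_implyP[/= ti nt]] : ~ B w by move/mem_set; exact/negP.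
  move: ti; rewrite mem_iota add0n => /andP[_ tn].
  by rewrite (bigD1 (Ordinal tn))//= indicE memNset// mul0r.
rewrite mean_indic.
  by rewrite PB /= (_ : iota 0 n = index_iota 0 n) ?big_mkord// /index_iota subn0.
apply: fin_bigcap_measurable; first exact: finite_seq.
move=> t _.
by rewrite -[X in measurable X]setTI; exact: me.
Qed.

(** Independence gives the claim for indicators. They are traded for bounded
    functions one index at a time: at stage j, the factors of index at least j
    are still indicators. *)
Lemma mean_prod (g : nat -> S -> R) n : (forall t, bounded_measurable (g t)) ->
  mean P (fun w => \prod_(t < n) g t (e t w)) = \prod_(t < n) mean P (g t \o e t).
Proof.
suff : forall j, (j <= n)%N -> forall g : nat -> S -> R,
    (forall t, bounded_measurable (g t)) ->
    (forall t, (j <= t)%N -> exists2 A, measurable A & g t = \1_A) ->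
    mean P (fun w => \prod_(t < n) g t (e t w)) = \prod_(t < n) mean P (g t \o e t).
  move=> /(_ n (leqnn n)) H bg.
  pose g' t := if (t < n)%N then g t else \1_setT.
  have gg' (t : 'I_n) : g t = g' t by rewrite /g' ltn_ord.
  under eq_fun do under eq_bigr do rewrite gg'.
  under [RHS]eq_bigr do rewrite gg'.
  apply: H => t; rewrite /g'.
    by case: ifP => // _; exact: bounded_measurable_indic.
  by rewrite leqNgt => /negbTE ->; exists setT.
elim=> [|j IH] jn {}g bg gA.
  have gA' t : exists A, measurable A /\ g t = \1_A.
    by have [A ? ?] := gA t (leq0n t); exists A.
  have [A AP] := boolp.choice gA'.
  have -> : g = fun t => \1_(A t) by apply/funext => t; exact: (AP t).2.
  by apply: mean_prod_indic => t; exact: (AP t).1.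
pose jo := Ordinal jn.
rewrite (bigD1 jo)//=.
under eq_fun do rewrite (bigD1 jo)//=.
apply: (@mean_factor (e j) (fun w => \prod_(t < n | t != jo) g t (e t w))) => //.
  by apply: bounded_measurable_prod => t; exact: bounded_measurable_comp.
move=> B mB.
pose g' t := if t == j then \1_B else g t.
have g'j : g' j = \1_B by rewrite /g' eqxx.
have g'E (t : 'I_n) : t != jo -> g' t = g t.
  by move=> tj; rewrite /g' ifN//.
have := IH (ltnW jn) g'.
rewrite (bigD1 jo)//= g'j (eq_bigr (fun t : 'I_n => mean P (g t \o e t))); last first.
  by move=> t tj; rewrite g'E.
move=> <-.
- congr mean; apply/funext => w; rewrite [RHS](bigD1 jo)//= g'j; congr (_ * _).
  by apply: eq_bigr => t tj; rewrite g'E.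
- move=> t; rewrite /g'; case: ifP => _; last exact: bg.
  exact: bounded_measurable_indic.
- move=> t jt; rewrite /g'; case: eqP => [_|/eqP tj]; first by exists B.
  by apply: gA; rewrite ltn_neqAle eq_sym tj.
Qed.

Section cosine_of_sums.
Variable g : nat -> S -> R.
Hypothesis mg : forall t, measurable_fun setT (g t).

Let cos_sum n theta w := cos (\sum_(t < n) g t (e t w) + theta).

Let bcos t theta : bounded_measurable (fun x => cos (g t x + theta)).
Proof. by apply: bounded_measurable_cos; exact: measurable_funD. Qed.

Let bcosS n theta : bounded_measurable (cos_sum n theta).
Proof.
apply: bounded_measurable_cos; apply: measurable_funD => //.
by apply: measurable_sum => t; exact: measurableT_comp.
Qed.

Let cosDshift (a b : R) : cos (a + b) = cos a * cos b - cos (a - pi / 2) * cos (b - pi / 2).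
Proof. by rewrite cosD !cosBpihalf. Qed.

(** The addition formula moves the last term of the sum into the product, where
    independence applies. *)
Lemma mean_cos_factor j n (phi : nat -> S -> R) theta : (j <= n)%N ->
  (forall t, bounded_measurable (phi t)) ->
  mean P (fun w => cos_sum j theta w * \prod_(j <= t < n) phi t (e t w)) =
    mean P (cos_sum j theta) * \prod_(j <= t < n) mean P (phi t \o e t).
Proof.
elim: j n phi theta => [|j IH] n phi theta jn bphi.
  have c0 w : cos_sum 0 theta w = cos theta by rewrite /cos_sum big_ord0 add0r.
  have -> : mean P (cos_sum 0 theta) = cos theta.
    by rewrite (eq_mean _ c0) -[RHS](mean_cst P).
  under eq_fun do rewrite c0 big_mkord; rewrite meanZ ?mean_prod ?big_mkord//.
  apply/bounded_measurable_summable/bounded_measurable_prod => t.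
  exact: bounded_measurable_comp.
pose put (f : S -> R) (f' : nat -> S -> R) t := if t == j then f else f' t.
have bput f f' : bounded_measurable f -> (forall t, bounded_measurable (f' t)) ->
    forall t, bounded_measurable (put f f' t).
  by move=> bf bf' t; rewrite /put; case: eqP.
have putj f f' : put f f' j = f by rewrite /put eqxx.
have putE f f' n' w : (j < n')%N -> \prod_(j <= t < n') put f f' t (e t w) =
    f (e j w) * \prod_(j.+1 <= t < n') f' t (e t w).
  move=> jn'; rewrite big_ltn// putj; congr (_ * _).
  by apply: eq_big_nat => t /andP[jt _]; rewrite /put gtn_eqF.
have putM f f' n' : (j < n')%N -> \prod_(j <= t < n') mean P (put f f' t \o e t) =
    mean P (f \o e j) * \prod_(j.+1 <= t < n') mean P (f' t \o e t).
  move=> jn'; rewrite big_ltn// putj; congr (_ * _).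
  by apply: eq_big_nat => t /andP[jt _]; rewrite /put gtn_eqF.
pose C a x := cos (g j x + a).
have cosS w : cos_sum j.+1 theta w = cos_sum j theta w * C 0 (e j w) -
    cos_sum j (theta - pi / 2) w * C (- (pi / 2)) (e j w).
  by rewrite /cos_sum /C big_ord_recr/= addr0 addrAC [LHS]cosDshift addrA.
have main n' f' : (j < n')%N -> (forall t, bounded_measurable (f' t)) ->
   mean P (fun w => cos_sum j.+1 theta w * \prod_(j.+1 <= t < n') f' t (e t w)) =
   (mean P (cos_sum j theta) * mean P (C 0 \o e j) -
    mean P (cos_sum j (theta - pi / 2)) * mean P (C (- (pi / 2)) \o e j)) *
     \prod_(j.+1 <= t < n') mean P (f' t \o e t).
  move=> jn' bf'.
  have bC a := bput (C a) f' (bcos j a) bf'.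
  have sC a b : summable P (fun w => cos_sum j a w *
      \prod_(j <= t < n') put (C b) f' t (e t w)).
    apply/bounded_measurable_summable/bounded_measurableM; first exact: bcosS.
    by apply: bounded_measurable_prod => t; exact: bounded_measurable_comp.
  rewrite (_ : (fun w => _) = (fun w =>
      cos_sum j theta w * \prod_(j <= t < n') put (C 0) f' t (e t w) -
      cos_sum j (theta - pi / 2) w * \prod_(j <= t < n') put (C (- (pi / 2))) f' t (e t w)));
      last first.
    apply/funext => w; rewrite !putE// cosS; ring.
  by rewrite meanB// !(IH _ _ _ (ltnW jn'))// !putM//; ring.
have m1 := main j.+1 phi (leqnn _) bphi.
rewrite big_geq// mulr1 in m1; rewrite main// -m1; congr (mean P _ * _).
by apply/funext => w; rewrite big_geq// mulr1.
Qed.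

Lemma mean_cos_sumS n theta : mean P (cos_sum n.+1 theta) =
  mean P (cos_sum n theta) * mean P (fun w => cos (g n (e n w))) -
  mean P (cos_sum n (theta - pi / 2)) * mean P (fun w => sin (g n (e n w))).
Proof.
have sC f a : bounded_measurable f -> summable P (fun w => cos_sum n a w * f (e n w)).
  move=> bf; apply/bounded_measurable_summable/bounded_measurableM; first exact: bcosS.
  exact: bounded_measurable_comp.
have fE f a : bounded_measurable f ->
    mean P (fun w => cos_sum n a w * f (e n w)) = mean P (cos_sum n a) * mean P (f \o e n).
  move=> bf; have := mean_cos_factor a (leqnSn n) (fun _ => bf); rewrite big_nat1 => <-.
  by apply: eq_mean => w; rewrite big_nat1.
have bc := bounded_measurable_cos (mg n); have bs := bounded_measurable_sin (mg n).
rewrite -(fE _ _ bc) -(fE _ _ bs) -meanB; [|exact: (sC _ _ bc)|exact: (sC _ _ bs)].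
apply: eq_mean => w; rewrite /cos_sum big_ord_recr/= addrAC cosD.
by rewrite -[X in _ - X * _]cosBpihalf addrA.
Qed.

End cosine_of_sums.

End independent_products.

(** * Lindeberg's theorem *)

Section lindeberg.
Context {R : realType} {d d' : measure_display} {T : measurableType d}
  {S : measurableType d'}.
Variables (P : probability T R) (e : nat -> T -> S).
Hypotheses (me : forall t, measurable_fun setT (e t))
  (ie : mutually_independent P e) (de : identically_distributed P e).
Variables (g : nat -> S -> R) (h : S -> R) (b : nat -> R).
Hypotheses (mg : forall t, measurable_fun setT (g t))
  (mh : measurable_fun setT h) (h0 : forall x, 0 <= h x)
  (b0 : forall t, 0 <= b t) (gh : forall t x, `|g t x| <= b t * h x)
  (h2 : summable P (fun w => h (e 0%N w) ^+ 2))
  (g0 : forall t, mean P (fun w => g t (e 0%N w)) = 0).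

Let v t := mean P (fun w => g t (e 0%N w) ^+ 2).
Let K := mean P (fun w => h (e 0%N w) ^+ 2).
(* The truncated second moment of Lindeberg's condition, with a continuous
   cutoff in place of the indicator of a large value of h. *)
Let trunc eps := mean P (fun w => h (e 0%N w) ^+ 2 * Num.min 1 (eps * h (e 0%N w))).

Let K0 : 0 <= K. Proof. by apply: mean_ge0 => w; exact: sqr_ge0. Qed.

Let mhe : measurable_fun setT (fun w => h (e 0%N w)).
Proof. exact: measurableT_comp mh (me 0). Qed.

Let mge t : measurable_fun setT (fun w => g t (e 0%N w)).
Proof. exact: measurableT_comp (mg t) (me 0). Qed.

Let sge2 t : summable P (fun w => g t (e 0%N w) ^+ 2).
Proof.
apply: (@summable_le _ _ _ _ _ (fun w => b t ^+ 2 * h (e 0%N w) ^+ 2)).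
- exact: measurable_funX.
- move=> w; rewrite normrX -exprMn lerXn2r ?nnegrE//.
  by rewrite mulr_ge0.
- exact: summableZ.
Qed.

Let sge t : summable P (fun w => g t (e 0%N w)).
Proof.
apply: (@summable_le _ _ _ _ _ (fun w => 1 + g t (e 0%N w) ^+ 2)) => //.
- move=> w; rewrite -[X in _ <= 1 + X]real_normK ?num_real//.
  by have := sqr_ge0 (`|g t (e 0%N w)| - 1); nra.
- by apply: summableD => //; exact: summable_cst.
Qed.

Let strunc eps : 0 <= eps ->
  summable P (fun w => h (e 0%N w) ^+ 2 * Num.min 1 (eps * h (e 0%N w))).
Proof.
move=> e0; apply: summable_le h2.
  apply: measurable_funM; first exact: measurable_funX.
  by apply: measurable_minr => //; exact: measurable_funM.
move=> w; rewrite ger0_norm ?mulr_ge0 ?sqr_ge0// ?le_min ?ler01 ?mulr_ge0//.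
by rewrite ler_piMr ?sqr_ge0// ge_min lexx.
Qed.

Lemma trunc_cvg0 : trunc n.+1%:R^-1 @[n --> \oo] --> 0.
Proof.
rewrite -(mean_cst P 0).
apply: (@mean_dominated_convergence _ _ _ _ _ _ (fun w => h (e 0%N w) ^+ 2)) => //.
- by move=> n; apply: summable_measurable; apply: strunc; rewrite invr_ge0.
- move=> n w; rewrite ger0_norm ?mulr_ge0 ?sqr_ge0// ?le_min ?ler01 ?mulr_ge0 ?invr_ge0//.
  by rewrite ler_piMr ?sqr_ge0// ge_min lexx.
- move=> w; rewrite /cst -[X in _ --> X](mulr0 (h (e 0%N w) ^+ 2)).
  apply: cvgM; first exact: cvg_cst.
  apply: (@squeeze_cvgr _ _ _ _ (cst 0) (fun n => n.+1%:R^-1 * h (e 0%N w))).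
  + by apply: nearW => n; rewrite /cst le_min ler01 ge_min lexx orbT mulr_ge0 ?invr_ge0.
  + exact: cvg_cst.
  + rewrite -[X in _ --> X](mul0r (h (e 0%N w))).
    by apply: cvgM; [exact: cvg_harmonic|exact: cvg_cst].
Qed.

Section one_step.
Variables (n t : nat) (eps : R).
Hypotheses (n0 : (0 < n)%N) (eps0 : 0 <= eps) (bt : b t <= eps * Num.sqrt n%:R).

Let sn0 : 0 < Num.sqrt n%:R :> R. Proof. by rewrite sqrtr_gt0 ltr0n. Qed.
Let y w := g t (e 0%N w) / Num.sqrt n%:R.

Let y2E w : y w ^+ 2 = n%:R^-1 * g t (e 0%N w) ^+ 2.
Proof. by rewrite /y expr_div_n sqr_sqrtr ?ler0n// mulrC. Qed.

Let y_trunc w : y w ^+ 2 * Num.min 1 `|y w| <=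
  (b t ^+ 2 / n%:R) * (h (e 0%N w) ^+ 2 * Num.min 1 (eps * h (e 0%N w))).
Proof.
have bh0 : 0 <= b t * h (e 0%N w) by rewrite mulr_ge0.
rewrite y2E mulrA; apply: ler_pM.
- by rewrite mulr_ge0 ?invr_ge0 ?sqr_ge0.
- by rewrite le_min ler01 normr_ge0.
- rewrite mulrAC [leRHS]mulrC ler_wpM2l ?invr_ge0// -exprMn.
  by rewrite -[leLHS]real_normK ?num_real// lerXn2r ?nnegrE.
- rewrite le_min ge_min lexx/= ge_min; apply/orP; right.
  rewrite /y normrM normfV (gtr0_norm sn0) ler_pdivrMr//.
  by rewrite (le_trans (gh t _))// mulrAC ler_wpM2r.
Qed.

Let c := mean P (fun w => cos (y w)).
Let s := mean P (fun w => sin (y w)).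

Let err := 2 * (b t ^+ 2 / n%:R * trunc eps).

Let my : measurable_fun setT y. Proof. exact: measurable_funM. Qed.

Let serr : summable P (fun w => 2 * ((b t ^+ 2 / n%:R) *
  (h (e 0%N w) ^+ 2 * Num.min 1 (eps * h (e 0%N w))))).
Proof. by do 2 apply: summableZ; exact: strunc. Qed.

Let mean_err : mean P (fun w => 2 * ((b t ^+ 2 / n%:R) *
  (h (e 0%N w) ^+ 2 * Num.min 1 (eps * h (e 0%N w))))) = err.
Proof. by rewrite !meanZ//; [exact: strunc|apply: summableZ; exact: strunc]. Qed.

Let sy2 : summable P (fun w => y w ^+ 2).
Proof. by under eq_fun do rewrite y2E; exact: summableZ. Qed.

(** One term contributes 1 - v / (2 n) to the characteristic function, up to an
    error that the truncated moment makes small: b t <= eps sqrt n bounds the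
    term by eps h. *)
Lemma char_step_cos : `|c - (1 - v t / (2 * n%:R))| <= err.
Proof.
have -> : 1 - v t / (2 * n%:R) = mean P (fun w => 1 - y w ^+ 2 / 2).
  rewrite meanB; [|exact: summable_cst|]; last first.
    by under eq_fun do rewrite mulrC; exact: summableZ.
  rewrite mean_cst; congr (_ - _).
  rewrite (_ : (fun w => _) = fun w => (2 * n%:R)^-1 * g t (e 0%N w) ^+ 2).
    by rewrite meanZ// mulrC.
  by apply/funext => w; rewrite y2E invfM; ring.
have s1 : summable P (fun w => 1 - y w ^+ 2 / 2).
  apply: summableB; first exact: summable_cst.
  by under eq_fun do rewrite mulrC; exact: summableZ.
have s2 := bounded_measurable_summable P (bounded_measurable_cos my).
rewrite -(meanB s2 s1) -mean_err; apply: norm_mean_le => //.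
  exact: summableB s2 s1.
by move=> w; rewrite (le_trans (cos_taylor _))// ler_pM2l.
Qed.

Lemma char_step_sin : `|s| <= err.
Proof.
have sy : summable P y by rewrite /y; under eq_fun do rewrite mulrC; exact: summableZ.
have y0 : mean P y = 0.
  by rewrite /y; under eq_fun do rewrite mulrC; rewrite meanZ// g0 mulr0.
have s2 := bounded_measurable_summable P (bounded_measurable_sin my).
rewrite -[s]subr0 -y0 -meanB// -mean_err; apply: norm_mean_le => //.
  exact: summableB.
by move=> w; rewrite (le_trans (sin_taylor _))// ler_pM2l.
Qed.

Lemma char_step_expR : `|expR (- (v t / (2 * n%:R))) - (1 - v t / (2 * n%:R))| <=
  b t ^+ 2 / n%:R * (eps ^+ 2 * K ^+ 2).
Proof.
have v0 : 0 <= v t by apply: mean_ge0 => w; exact: sqr_ge0.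
have vK : v t <= b t ^+ 2 * K.
  rewrite /v /K -meanZ//; apply: le_mean => //; first exact: summableZ.
  by move=> w; rewrite -exprMn -[leLHS]real_normK ?num_real// lerXn2r ?nnegrE ?mulr_ge0.
set x := v t / _; have x0 : 0 <= x by rewrite divr_ge0 ?mulr_ge0.
have x2 : `|expR (- x) - (1 - x)| <= x ^+ 2.
  rewrite ger0_norm; last by rewrite subr_ge0 expR_ge1Dx.
  have H : expR (- x) <= (1 + x)^-1.
    by rewrite expRN lef_pV2 ?posrE ?expR_gt0 ?expR_ge1Dx// ltr_pwDl.
  have : (1 + x)^-1 <= 1 - x + x ^+ 2.
    rewrite -[leLHS]mul1r ler_pdivrMr ?ltr_pwDl//.
    have : 0 <= x ^+ 3 by rewrite exprn_ge0.
    rewrite exprS; nra.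
  lra.
rewrite (le_trans x2)//.
have nn0 : 0 < n%:R :> R by rewrite ltr0n.
have xb : x <= b t ^+ 2 / n%:R * K.
  apply: (@le_trans _ _ (v t / n%:R)); last by rewrite mulrAC ler_pM2r ?invr_gt0.
  by rewrite ler_wpM2l// lef_pV2 ?posrE ?mulr_gt0// ler_peMl// ler1n.
have beps : b t ^+ 2 / n%:R <= eps ^+ 2.
  rewrite ler_pdivrMr// -[X in _ * X](sqr_sqrtr (ler0n R n)) -exprMn.
  by rewrite lerXn2r ?nnegrE ?mulr_ge0// ltW.
apply: (@le_trans _ _ ((b t ^+ 2 / n%:R * K) ^+ 2)); first by rewrite lerXn2r ?nnegrE// (le_trans x0).
have -> : b t ^+ 2 / n%:R * (eps ^+ 2 * K ^+ 2) =
  eps ^+ 2 * (b t ^+ 2 / n%:R) * K ^+ 2 by ring.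
rewrite exprMn ler_wpM2r ?sqr_ge0// expr2 ler_wpM2r//.
by apply: divr_ge0; [exact: sqr_ge0|exact: ltW].
Qed.

End one_step.

Let mean_e (t : nat) (phi : S -> R) : bounded_measurable phi ->
  mean P (fun w => phi (e t w)) = mean P (fun w => phi (e 0%N w)).
Proof.
move=> [mphi [M phiM]].
by apply: (@mean_same_law _ _ _ _ _ _ _ P P (e t) (e 0%N) _ _ _ phi M) => // A mA; exact: de.
Qed.

Let rate n eps := (\sum_(t < n) b t ^+ 2) / n%:R *
  (4 * trunc eps + eps ^+ 2 * K ^+ 2).

(** Lindeberg's telescoping: multiplying the characteristic function of the
    partial sum by that of the next term, or by the Gaussian factor of the same
    variance, differs by the error of one step. *)
Lemma lindeberg_bound n eps theta : (0 < n)%N -> 0 <= eps ->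
  (forall t, (t < n)%N -> b t <= eps * Num.sqrt n%:R) ->
  `|mean P (fun w => cos ((\sum_(t < n) g t (e t w)) / Num.sqrt n%:R + theta)) -
    cos theta * expR (- (n%:R^-1 * (\sum_(t < n) v t)) / 2)| <= rate n eps.
Proof.
move=> n0 eps0 bn.
pose G t x := g t x / Num.sqrt n%:R.
have mG t : measurable_fun setT (G t) by exact: measurable_funM.
pose phi j th := mean P (fun w => cos (\sum_(t < j) G t (e t w) + th)).
pose q t := expR (- (v t / (2 * n%:R))).
have q01 t : 0 <= q t <= 1.
  rewrite expR_ge0/= -expR0 ler_expR oppr_le0 divr_ge0//.
  by apply: mean_ge0 => w; exact: sqr_ge0.
pose err t := b t ^+ 2 / n%:R * (4 * trunc eps + eps ^+ 2 * K ^+ 2).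
have phi1 j th : `|phi j th| <= 1.
  apply: norm_mean_bounded => [|w]; last exact: cos_max.
  apply: (bounded_measurable_cos _).1; apply: measurable_funD => //.
  by apply: measurable_sum => t; exact: measurableT_comp (mG t) (me t).
have H j : (j <= n)%N ->
   `|phi j theta - cos theta * \prod_(t < j) q t| <= \sum_(t < j) err t.
  elim: j => [_|j IH jn].
    rewrite /phi !big_ord0; under eq_fun do rewrite big_ord0 add0r.
    by rewrite mulr1 -[X in mean P X]/(cst (cos theta)) mean_cst subrr normr0.
  have {}IH := IH (ltnW jn).
  rewrite /phi (mean_cos_sumS me ie mG) -/(phi j _) -/(phi j _) !big_ord_recr/=.
  rewrite (mean_e _ (bounded_measurable_cos (mG j))) (mean_e _ (bounded_measurable_sin (mG j))).
  have := char_step_sin n0 eps0 (bn _ jn); have := char_step_expR n0 eps0 (bn _ jn).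
  have := char_step_cos n0 eps0 (bn _ jn); rewrite -/(q j) -/(G j _).
  set c := mean P (fun w => cos _); set s := mean P (fun w => sin _).
  set m := 1 - v j / _ => c1 c2 s1; rewrite mulrA.
  move: IH; set Q := cos theta * _ => IH.
  have shrink (z1 z2 : R) : `|z2| <= 1 -> `|z1 * z2| <= `|z1|.
    by move=> z21; rewrite normrM ler_piMr.
  have /andP[q0 q1] := q01 j.
  have k1 := shrink (c - q j) _ (phi1 j theta).
  have k2 := shrink s _ (phi1 j (theta - pi / 2)).
  have k3 : `|(phi j theta - Q) * q j| <= `|phi j theta - Q| by apply: shrink; rewrite ger0_norm.
  rewrite (_ : _ - _ = (c - q j) * phi j theta +
    ((phi j theta - Q) * q j - s * phi j (theta - pi / 2))); last by ring.
  have := ler_normD ((c - q j) * phi j theta)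
    ((phi j theta - Q) * q j - s * phi j (theta - pi / 2)).
  have := ler_normB ((phi j theta - Q) * q j) (s * phi j (theta - pi / 2)).
  have := ler_normB (c - m) (q j - m); rewrite (_ : c - m - (q j - m) = c - q j); last by ring.
  have -> : err j = 2 * (b j ^+ 2 / n%:R * trunc eps) +
    b j ^+ 2 / n%:R * (eps ^+ 2 * K ^+ 2) + 2 * (b j ^+ 2 / n%:R * trunc eps).
    by rewrite /err; ring.
  by move=> *; lra.
have := H n (leqnn n).
have -> : \sum_(t < n) err t = rate n eps.
  by rewrite /err /rate !mulr_suml; apply: eq_bigr => t _.
have -> : \prod_(t < n) q t = expR (- (n%:R^-1 * (\sum_(t < n) v t)) / 2).
  rewrite /q -expR_sum; congr expR; rewrite sumrN mulNr; congr (- _).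
  by rewrite mulr_sumr mulr_suml; apply: eq_bigr => t _; rewrite invfM; ring.
by rewrite /phi; under eq_fun do rewrite -mulr_suml.
Qed.

Hypotheses (vlim : R)
  (v_cvg : n%:R^-1 * (\sum_(t < n) v t) @[n --> \oo] --> vlim).
Variable C : R.
Hypotheses (b_le : forall n, (\sum_(t < n) b t ^+ 2) / n%:R <= C)
  (b_small : forall eps, 0 < eps -> \forall n \near \oo,
    forall t, (t < n)%N -> b t <= eps * Num.sqrt n%:R).

Let rate_small del : 0 < del -> exists2 eps, 0 < eps & forall n, rate n eps <= del.
Proof.
move=> del0.
have C0 : 0 <= C.
  apply: le_trans (b_le 0); rewrite big_ord0 mul0r//.
pose r k := C * (4 * trunc k.+1%:R^-1 + k.+1%:R^-1 ^+ 2 * K ^+ 2).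
have r0 : r k @[k --> \oo] --> 0.
  have -> : 0 = C * (4 * 0 + 0 * 0 * K ^+ 2) :> R by ring.
  apply: cvgM; first exact: cvg_cst.
  apply: cvgD; first by apply: cvgM; [exact: cvg_cst|exact: trunc_cvg0].
  apply: cvgM; last exact: cvg_cst.
  by under eq_fun do rewrite expr2; apply: cvgM; exact: cvg_harmonic.
have [k rk] : exists k, r k <= del.
  have : \forall k \near \oo, r k <= del.
    move/cvgr0Pnorm_le : r0 => /(_ _ del0); apply: filterS => k.
    exact: le_trans (ler_norm _).
  by move/filter_ex.
exists k.+1%:R^-1; first by rewrite invr_gt0.
move=> n; rewrite (le_trans _ rk)// /rate /r ler_wpM2r//.
rewrite addr_ge0 ?mulr_ge0 ?sqr_ge0//.
apply: mean_ge0 => w; rewrite mulr_ge0 ?sqr_ge0// le_min ler01 mulr_ge0//.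
Qed.

(** Lindeberg's central limit theorem for weighted functions of an i.i.d.
    sequence, in terms of characteristic functions. *)
Theorem lindeberg theta :
  mean P (fun w => cos ((\sum_(t < n) g t (e t w)) / Num.sqrt n%:R + theta)) @[n --> \oo]
  --> cos theta * expR (- vlim / 2).
Proof.
pose E n := cos theta * expR (- (n%:R^-1 * (\sum_(t < n) v t)) / 2).
have E_cvg : E n @[n --> \oo] --> cos theta * expR (- vlim / 2).
  apply: cvgM; first exact: cvg_cst.
  apply: (@cvg_comp _ _ _ (fun n => - (n%:R^-1 * (\sum_(t < n) v t)) / 2) expR _
    (nbhs (- vlim / 2))); last exact: continuous_expR.
  by apply: cvgM; [exact: cvgN|exact: cvg_cst].
pose A n := mean P (fun w => cos ((\sum_(t < n) g t (e t w)) / Num.sqrt n%:R + theta)).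
have D_cvg : A n - E n @[n --> \oo] --> 0.
  apply/cvgr0Pnorm_le => del del0; have [eps eps0 He] := rate_small del0.
  apply: filterS2 (b_small eps0) (nbhs_infty_gt 0) => n bn n0.
  exact: le_trans (lindeberg_bound theta n0 (ltW eps0) bn) (He n).
have : (A n - E n) + E n @[n --> \oo] --> 0 + cos theta * expR (- vlim / 2) by exact: cvgD.
by rewrite add0r; under eq_fun do rewrite subrK.
Qed.

End lindeberg.

(** * The characteristic function of a normal law *)

Section density.
Context {R : realType} {d : measure_display} {S : measurableType d}.
Variables (mu : {measure set S -> \bar R}) (Q : probability S R) (phi : S -> R).
Hypotheses (mphi : measurable_fun setT phi) (phi0 : forall x, 0 <= phi x)
  (Qphi : forall A, measurable A -> Q A = (\int[mu]_(x in A) (phi x)%:E)%E).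

Let iphi : mu.-integrable setT (EFin \o phi).
Proof.
apply/integrableP; split; first exact/measurable_EFinP.
under eq_integral do rewrite /= ger0_norm//.
rewrite -Qphi// (le_lt_trans (probability_le1 Q measurableT))//.
by rewrite ltry.
Qed.

Lemma mean_density (f : S -> R) : bounded_measurable f ->
  mean Q f = Rintegral mu setT (fun x => f x * phi x).
Proof.
move=> bf; rewrite -[LHS]/(mean Q (fun x => f x)).
have E g : mean Q g = weighted_integral Q idfun (cst 1) g.
  by apply: eq_mean => x; rewrite mulr1.
rewrite E; apply: (@weighted_integral_ext _ _ _ _ _ _ _ Q mu idfun idfun (cst 1) phi) => //.
- exact: measurable_id.
- exact: measurable_id.
- exact: summable_cst.
move=> B mB; rewrite -E mean_indic// /weighted_integral /Rintegral Qphi// integral_mkcond.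
congr fine; apply: eq_integral => x _.
by rewrite /= patchE indicE; case: (x \in B); rewrite /= ?mul1r ?mul0r.
Qed.

End density.

Section integral_of_derivative.
Context {R : realType}.
Notation mu := (@lebesgue_measure R).

(** The fundamental theorem of calculus on [-n, n], for n tending to infinity. *)
Lemma Rintegral_derivative (F f : R -> R) : (forall x : R, is_derive x (1 : R) F (f x)) ->
  continuous f -> mu.-integrable setT (EFin \o f) ->
  F n%:R @[n --> \oo] --> 0 -> F (- n%:R) @[n --> \oo] --> 0 ->
  Rintegral mu setT f = 0.
Proof.
move=> dF cf intf Fn FNn.
have mf : measurable_fun setT f by exact: continuous_measurable_fun.
have cF : continuous F.
  by move=> x; apply/differentiable_continuous/derivable1_diffP; case: (dF x).
pose fn (n : nat) (x : R) : R := (f \_ `[(- n%:R), n%:R]) x.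
have H : Rintegral mu setT (fn n) @[n --> \oo] --> Rintegral mu setT f.
  apply: (@Rintegral_dominated_convergence R _ _ mu fn f (fun x => `|f x|)) => //.
  - by move=> n; rewrite /fn -measurable_restrictT//; exact: measurable_funTS.
  - exact: integrable_norm.
  - by move=> n x; rewrite /fn patchE; case: ifP => // _; rewrite normr0.
  - move=> x; apply: (@cvg_trans _ (cst (f x) @ \oo)); last exact: cvg_cst.
    apply: near_eq_cvg; near=> n; rewrite /fn /= patchE mem_set//=.
    rewrite in_itv/= -ler_norml; near: n; exact: nbhs_infty_ger.
have E n : Rintegral mu setT (fn n.+1) = F n.+1%:R - F (- n.+1%:R).
  have nn : - n.+1%:R < n.+1%:R :> R by rewrite gtrN// ltr0n.
  rewrite /fn -Rintegral_mkcond /Rintegral (@continuous_FTC2 _ f F)//.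
  - exact: continuous_subspaceT.
  - split=> [x _||]; first exact: ex_derive.
      by apply: cvg_at_right_filter; exact: cF.
    by apply: cvg_at_left_filter; exact: cF.
  - by move=> x _; rewrite derive1E; case: (dF x).
move: H; rewrite -cvg_shiftS /=; under eq_fun do rewrite E.
have : F n.+1%:R - F (- n.+1%:R) @[n --> \oo] --> 0 - 0.
  by move: Fn FNn; rewrite -cvg_shiftS -(cvg_shiftS (fun n => F (- n%:R))); exact: cvgB.
by rewrite subr0 => K {}H; exact: cvg_seq_unique H K.
Unshelve. all: by end_near.
Qed.

End integral_of_derivative.

Section normal_characteristic_function.
Context {R : realType}.
Notation mu := (@lebesgue_measure R).
Variable sigma : R.
Hypothesis sigma0 : 0 < sigma.

Let sigma_neq0 : sigma != 0. Proof. by rewrite gt_eqF. Qed.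

Let phi := normal_pdf 0 sigma.

Let phiE x : phi x = normal_peak sigma * expR (- x ^+ 2 / (sigma ^+ 2 *+ 2)).
Proof. by rewrite /phi normal_pdfE ?gt_eqF// /normal_fun subr0. Qed.

Let phi0 x : 0 <= phi x. Proof. exact: normal_pdf_ge0. Qed.

(** Gaussian tails: a polynomial weight costs no more than doubling the
    standard deviation. *)
Lemma normal_pdf_weight : exists2 K : R, 0 < K &
  forall x : R, (1 + `|x| + x ^+ 2) * phi x <= K * normal_pdf 0 (2 * sigma) x.
Proof.
have s2 : 2 * sigma != 0 by rewrite mulf_neq0// pnatr_eq0.
pose a := 3 / (8 * sigma ^+ 2).
have a0 : 0 < a by rewrite divr_gt0 ?mulr_gt0 ?exprn_gt0.
have expE (x : R) : - x ^+ 2 / (sigma ^+ 2 *+ 2) =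
    - (a * x ^+ 2) + - x ^+ 2 / ((2 * sigma) ^+ 2 *+ 2).
  by rewrite /a -!(mulr_natr (_ ^+ 2) 2); field.
clearbody a; have p1 := normal_peak_gt0 sigma_neq0; have p2 := normal_peak_gt0 s2.
exists (2 * (1 + a^-1) * (normal_peak sigma / normal_peak (2 * sigma))).
  by rewrite mulr_gt0 ?divr_gt0// mulr_gt0// addr_gt0// invr_gt0.
move=> x; rewrite phiE normal_pdfE// /normal_fun subr0 expE expRD.
move: p1 p2 (expR_ge0 (- x ^+ 2 / ((2 * sigma) ^+ 2 *+ 2))).
move: (normal_peak _) (normal_peak _) (expR (- x ^+ 2 / _)) => k2 k1 E k10 k20 E0.
have -> : 2 * (1 + a^-1) * (k1 / k2) * (k2 * E) = (2 * (1 + a^-1)) * (k1 * E).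
  by rewrite -mulrA; congr (_ * _); rewrite mulrA divfK ?gt_eqF.
rewrite [leLHS](_ : _ = ((1 + `|x| + x ^+ 2) * expR (- (a * x ^+ 2))) * (k1 * E));
  last by ring.
rewrite ler_wpM2r ?mulr_ge0 ?(ltW k10)// expRN ler_pdivrMr ?expR_gt0//.
have h1 : 1 + a * x ^+ 2 <= expR (a * x ^+ 2) by exact: expR_ge1Dx.
have x2 : `|x| <= 1 + x ^+ 2.
  by rewrite -[x ^+ 2]real_normK ?num_real//; have := sqr_ge0 (`|x| - 1); nra.
apply: (@le_trans _ _ (2 * (1 + a^-1) * (1 + a * x ^+ 2))); last first.
  by rewrite ler_pM2l// mulr_gt0// addr_gt0// invr_gt0.
have -> : 2 * (1 + a^-1) * (1 + a * x ^+ 2) = 2 * (1 + x ^+ 2) + 2 * (a^-1 + a * x ^+ 2).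
  by field; rewrite gt_eqF.
have : 0 <= a^-1 + a * x ^+ 2.
  by rewrite addr_ge0 ?invr_ge0 ?(ltW a0)// mulr_ge0 ?sqr_ge0// ltW.
by have := sqr_ge0 x; lra.
Qed.

Let mphi : measurable_fun setT phi. Proof. exact: measurable_normal_pdf. Qed.

Let integrable_weight (f : R -> R) : measurable_fun setT f ->
  (forall x, `|f x| <= 1 + `|x| + x ^+ 2) ->
  mu.-integrable setT (EFin \o (fun x => f x * phi x)).
Proof.
move=> mf fx; have [K K0 HK] := normal_pdf_weight.
apply: (@le_integrable _ _ R mu setT measurableT (EFin \o (fun x => f x * phi x))
  (fun x => (K%:E * (normal_pdf 0 (2 * sigma) x)%:E)%E)).
- by apply/measurable_EFinP; exact: measurable_funM.
- move=> x _; rewrite /= lee_fin normrM (ger0_norm (phi0 x)).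
  rewrite (le_trans _ (ler_norm _))// (le_trans _ (HK x))// ler_wpM2r//.
- by apply: (integrableZl measurableT K (integrable_normal_pdf 0 (2 * sigma))).
Qed.

Let is_derive_phi (x : R) : is_derive x (1 : R) phi (- (x / sigma ^+ 2) * phi x).
Proof.
have -> : phi = fun x => normal_peak sigma * expR (- x ^+ 2 / (sigma ^+ 2 *+ 2)).
  by apply/funext => y; exact: phiE.
apply: is_derive_eq; rewrite /GRing.scale/=.
by rewrite -!(mulr_natr (_ ^+ 2) 2); field.
Qed.

Let phi_cvg0 (b : bool) : phi ((-1) ^+ b * n%:R) @[n --> \oo] --> 0.
Proof.
have [K K0 HK] := normal_pdf_weight.
have p0 := @normal_peak_ge0 R (2 * sigma).
apply: (@squeeze_cvgr _ _ _ _ (cst 0)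
   (fun n => n.+1%:R^-1 * (K * normal_peak (2 * sigma)))).
- apply: nearW => n; rewrite phi0/= [leRHS]mulrC ler_pdivlMr ?ltr0n//.
  have := HK ((-1) ^+ b * n%:R); rewrite normrM normr_nat.
  rewrite normrX normrN1 expr1n mul1r => H; apply: le_trans (le_trans H _).
    rewrite mulrC ler_wpM2r// -natr1 addrC ler_wpDr// sqr_ge0//.
  rewrite ler_pM2l// normal_pdf_ub//.
  by rewrite mulf_neq0 ?gt_eqF.
- exact: cvg_cst.
- rewrite -[X in _ --> X](mul0r (K * normal_peak (2 * sigma))).
  by apply: cvgM; [exact: cvg_harmonic|exact: cvg_cst].
Qed.

Variable theta : R.

Let c (t : R) : R := Rintegral mu setT (fun x => cos (t * x + theta) * phi x).

Let mcos (t : R) : measurable_fun setT (fun x : R => cos (t * x + theta)).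
Proof.
apply: (bounded_measurable_cos _).1; apply: measurable_funD => //.
Qed.

Let msin (t : R) : measurable_fun setT (fun x : R => sin (t * x + theta)).
Proof.
apply: (bounded_measurable_sin _).1; apply: measurable_funD => //.
Qed.

(* Integration by parts, since x phi(x) = - sigma^2 phi'(x). *)
Let int_sin t : Rintegral mu setT (fun x => x * sin (t * x + theta) * phi x) =
  sigma ^+ 2 * t * c t.
Proof.
have i1 : mu.-integrable setT (EFin \o (fun x => cos (t * x + theta) * phi x)).
  apply: integrable_weight => // x; rewrite (le_trans (cos_max _))//.
  by rewrite -addrA lerDl addr_ge0 ?sqr_ge0.
have i2 : mu.-integrable setT (EFin \o (fun x => x * sin (t * x + theta) * phi x)).
  apply: integrable_weight; first exact: measurable_funM.
  move=> x; rewrite normrM (@le_trans _ _ `|x|) ?ler_piMr ?sin_max//.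
  by rewrite addrAC lerDr addr_ge0 ?sqr_ge0.
pose f x := t * (cos (t * x + theta) * phi x) -
  (sigma ^+ 2)^-1 * (x * sin (t * x + theta) * phi x).
have dphi := is_derive_phi.
have cf : continuous f.
  move=> x; apply/differentiable_continuous/derivable1_diffP.
  exact: ex_derive.
have lim0 (b : bool) : sin (t * ((-1) ^+ b * n%:R) + theta) * phi ((-1) ^+ b * n%:R)
    @[n --> \oo] --> 0.
  apply: (@squeeze_cvgr _ _ _ _ (fun n => - phi ((-1) ^+ b * n%:R))
    (fun n => phi ((-1) ^+ b * n%:R))).
  - apply: nearW => n; rewrite -ler_norml normrM (ger0_norm (phi0 _)).
    by rewrite ler_piMl ?sin_max.
  - have : - phi ((-1) ^+ b * n%:R) @[n --> \oo] --> - (0 : R).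
      by apply: cvgN; exact: (phi_cvg0 b).
    by rewrite oppr0.
  - exact: (phi_cvg0 b).
have : Rintegral mu setT f = 0.
  apply: (@Rintegral_derivative _ (fun x => sin (t * x + theta) * phi x)) => //.
  - move=> x; apply: is_derive_eq; rewrite /GRing.scale/= /f.
    by field; rewrite gt_eqF.
  - rewrite /comp /f; under eq_fun do rewrite EFinB.
    by apply: integrableB => //; [apply: (integrableZl _ t i1)|apply: (integrableZl _ _ i2)].
  - by have := lim0 false; under eq_fun do rewrite expr0 mul1r.
  - by have := lim0 true; under eq_fun do rewrite expr1 mulN1r.
rewrite /f RintegralB//; [|by apply: (integrableZl _ t i1)|by apply: (integrableZl _ _ i2)].
rewrite !RintegralZl// -/(c t) => /eqP; rewrite subr_eq0 => /eqP H.
by rewrite -mulrA H mulrA divff ?mul1r// gt_eqF// exprn_gt0.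
Qed.

(* Differentiation under the integral gives the equation c' = - sigma^2 t c,
   whose solutions are multiples of the Gaussian. *)
Let derivative_c (t : R) : is_derive t (1 : R) c (- (sigma ^+ 2 * t * c t)).
Proof.
pose f (u x : R) := cos (u * x + theta) * phi x.
have df (u x : R) : is_derive u (1 : R) (f ^~ x) (- (x * sin (u * x + theta) * phi x)).
  by apply: is_derive_eq; rewrite /GRing.scale/=; ring.
have dfable u x : derivable (f ^~ x) u 1 by case: (df u x).
have d1f u x : partial1of2 f u x = - (x * sin (u * x + theta) * phi x).
  by rewrite partial1of2E; case: (df u x).
have tI : t \in `]t - 1, t + 1[ by rewrite in_itv/= ltrBlDr ltrDl ltr01.
have i1 u : mu.-integrable setT (EFin \o f u).
  apply: integrable_weight => // x; rewrite (le_trans (cos_max _))//.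
  by rewrite -addrA lerDl addr_ge0 ?sqr_ge0.
have iG : mu.-integrable setT (EFin \o (fun x => `|x| * phi x)).
  apply: integrable_weight => // x; rewrite normr_id.
  by rewrite addrAC lerDr addr_ge0 ?sqr_ge0.
have G0 x : 0 <= `|x| * phi x by rewrite mulr_ge0.
have dG u x : `|partial1of2 f u x| <= `|x| * phi x.
  rewrite d1f normrN !normrM (ger0_norm (phi0 x)) ler_wpM2r//.
  by rewrite ler_piMr ?sin_max.
have dc : derivable c t 1.
  apply: (@derivable_under_integral _ _ _ mu f setT measurableT t (t - 1) (t + 1)
    tI _ _ (fun x => `|x| * phi x)) => //.
split; first exact: dc.
have -> : 'D_1 c t = Rintegral mu setT (fun x => partial1of2 f t x).
  rewrite -derive1E; apply: (@differentiation_under_integral _ _ _ mu f setT measurableT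
    t (t - 1) (t + 1) tI _ _ (fun x => `|x| * phi x)) => //.
rewrite -int_sin -mulN1r -RintegralZl//; last first.
  apply: integrable_weight; first exact: measurable_funM.
  move=> x; rewrite normrM (@le_trans _ _ `|x|) ?ler_piMr ?sin_max//.
  by rewrite addrAC lerDr addr_ge0 ?sqr_ge0.
by apply: eq_Rintegral => x _; rewrite d1f mulN1r.
Qed.

Let c_formula t : c t = cos theta * expR (- (sigma ^+ 2 * t ^+ 2) / 2).
Proof.
pose D t := c t * expR (sigma ^+ 2 * t ^+ 2 / 2).
have dD (u : R) : is_derive u (1 : R) D 0.
  have dc := derivative_c.
  by apply: is_derive_eq; rewrite /GRing.scale/=; field.
have := @is_derive_0_is_cst _ D t 0 dD; rewrite /D expr0n mulr0 mul0r expR0 mulr1.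
have -> : c 0 = cos theta.
  rewrite /c; under eq_Rintegral do rewrite mul0r add0r.
  rewrite RintegralZl//; last exact: integrable_normal_pdf.
  by rewrite /Rintegral integral_normal_pdf mulr1.
by move=> <-; rewrite mulNr expRN -mulrA divff ?mulr1// gt_eqF// expR_gt0.
Qed.

Lemma mean_cos_normal t :
  mean (normal_prob 0 sigma) (fun x => cos (t * x + theta)) =
  cos theta * expR (- (sigma ^+ 2 * t ^+ 2) / 2).
Proof.
rewrite -c_formula; apply: mean_density => //.
apply: bounded_measurable_cos; exact: measurable_funD.
Qed.

End normal_characteristic_function.

(** * Product laws, and uniqueness on the line *)

Section product_mean.
Context {R : realType} {d d' : measure_display} {T : measurableType d}
  {T' : measurableType d'}.
Variables (P : probability T R) (Q : probability T' R).

Let mean_fst f : bounded_measurable f ->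
  mean (P \x Q)%E (fun z => f z.1) = mean P f.
Proof.
move=> [mf [M fM]].
apply: (@mean_same_law _ _ _ _ _ _ _ (P \x Q)%E P fst idfun measurable_fst
  (@measurable_id _ _ _) _ f M) => //.
move=> A mA; have E : fst @^-1` A = A `*` setT :> set (T * T').
  by apply/seteqP; split=> [[x y]/=|[x y]/= []].
apply: (eq_trans (congr1 (P \x Q)%E E)).
apply: (eq_trans (product_measure1E P Q mA measurableT)).
by rewrite [X in (_ * X)%E](_ : _ = 1%E) ?mule1//; exact: probability_setT.
Qed.

Let mean_snd g : bounded_measurable g ->
  mean (P \x Q)%E (fun z => g z.2) = mean Q g.
Proof.
move=> [mg [M gM]].
apply: (@mean_same_law _ _ _ _ _ _ _ (P \x Q)%E Q snd idfun measurable_snd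
  (@measurable_id _ _ _) _ g M) => //.
move=> A mA; have E : snd @^-1` A = setT `*` A :> set (T * T').
  by apply/seteqP; split=> [[x y]/=|[x y]/= []].
apply: (eq_trans (congr1 (P \x Q)%E E)).
apply: (eq_trans (product_measure1E P Q measurableT mA)).
by rewrite [X in (X * _)%E](_ : _ = 1%E) ?mul1e//; exact: probability_setT.
Qed.

Lemma mean_product (f : T -> R) (g : T' -> R) :
  bounded_measurable f -> bounded_measurable g ->
  mean (P \x Q)%E (fun z => f z.1 * g z.2) = mean P f * mean Q g.
Proof.
move=> bf bg.
have bg2 : bounded_measurable (fun z : T * T' => g z.2).
  exact: (bounded_measurable_comp measurable_snd bg).
rewrite -(mean_fst bf).
apply: (@mean_factor _ _ _ _ _ (P \x Q)%E fst (fun z => g z.2) (mean Q g)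
  measurable_fst bg2 _ f bf) => B mB.
have bB : bounded_measurable (\1_B : T -> R) by exact: bounded_measurable_indic.
have bB1 : bounded_measurable (fun z : T * T' => (\1_B z.1 : R)).
  exact: (bounded_measurable_comp measurable_fst bB).
rewrite [RHS]mulrC [X in _ * X](mean_fst bB) -(mean_snd bg).
under eq_fun do rewrite mulrC.
apply: (@mean_factor _ _ _ _ _ (P \x Q)%E snd (fun z => \1_B z.1) (mean P \1_B)
  measurable_snd bB1 _ g bg) => C mC.
have bC : bounded_measurable (\1_C : T' -> R) by exact: bounded_measurable_indic.
rewrite [X in X * _](mean_snd bC) !mean_indic//.
rewrite (_ : (fun w => _) = (\1_(B `*` C) : _ -> R)); last first.
  apply/funext => -[x y]; rewrite !indicE/= in_setX.
  by case: (x \in B); case: (y \in C); rewrite /= ?mulr1 ?mulr0 ?mul0r.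
rewrite mean_indic; last exact: measurableX.
have PQ : (P \x Q)%E (B `*` C) = (P B * Q C)%E by exact: product_measure1E.
by rewrite [X in fine X = _]PQ fineM ?fin_num_measure// mulrC.
Qed.

End product_mean.

Lemma law_exists {R : realType} {d d'} {T : measurableType d}
    {S : measurableType d'} (P : probability T R) (X : T -> S) :
  measurable_fun setT X ->
  exists Q : probability S R, forall A, measurable A -> Q A = P (X @^-1` A).
Proof.
move=> mX; pose mX' := isMeasurableFun.Build _ _ _ _ _ mX.
pose X' : {mfun T >-> S} := HB.pack X mX'.
by exists (distribution P X').
Qed.

Section real_laws.
Context {R : realType} {d d' : measure_display} {T : measurableType d}
  {T' : measurableType d'}.
Variables (P : probability T R) (Q : probability T' R) (X : T -> R) (Y : T' -> R).
Hypotheses (mX : measurable_fun setT X) (mY : measurable_fun setT Y).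
Hypothesis eq_cos : forall t theta : R,
  mean P (fun w => cos (t * X w + theta)) = mean Q (fun w => cos (t * Y w + theta)).

Let eq_mean_continuous (f : R -> R) (M : R) : continuous f ->
  (forall x, `|f x| <= M) -> mean P (f \o X) = mean Q (f \o Y).
Proof.
move=> cf fM.
have dE (s : 'rV[R]_1) x : dotv s (const_mx x) = s 0 0 * x.
  by rewrite /dotv big_ord1 mxE.
have EX : f \o X = (fun v : 'rV[R]_1 => f (v 0 0)) \o (fun w => const_mx (X w)).
  by apply/funext => w; rewrite /= mxE.
have EY : f \o Y = (fun v : 'rV[R]_1 => f (v 0 0)) \o (fun w => const_mx (Y w)).
  by apply/funext => w; rewrite /= mxE.
rewrite EX EY; apply: (@characteristic_uniqueness _ _ _ _ _ 1 P Q _ _ _ _ _ _ M).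
- by move=> i j; under eq_fun do rewrite mxE.
- by move=> i j; under eq_fun do rewrite mxE.
- move=> s theta; under eq_fun do rewrite dE.
  by under [in RHS]eq_fun do rewrite dE.
- move=> v; apply: (@continuous_comp _ _ _ (fun v : 'rV[R]_1 => v 0 0) f).
    exact: coord_continuous.
  exact: cf.
- by move=> v; exact: fM.
Qed.

(* Continuous functions increasing with n to the indicator of ]a, +oo[. *)
Let ray (a : R) (n : nat) (x : R) : R :=
  1 - expR (- (n%:R * ((x - a + `|x - a|) / 2))).

Let ray01 a n x : `|ray a n x| <= 1.
Proof.
have h : 0 <= n%:R * ((x - a + `|x - a|) / 2).
  rewrite mulr_ge0// divr_ge0//; have := ler_norm (- (x - a)); rewrite normrN; lra.
rewrite /ray ler_norml; have := expR_ge0 (- (n%:R * ((x - a + `|x - a|) / 2))).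
have : expR (- (n%:R * ((x - a + `|x - a|) / 2))) <= 1.
  by rewrite -[leRHS]expR0 ler_expR oppr_le0.
by move=> *; apply/andP; split; lra.
Qed.

Let continuous_ray a n : continuous (ray a n).
Proof.
move=> x; apply: cvgB; first exact: cvg_cst.
apply: (@cvg_comp _ _ _ _ expR _ (nbhs (- (n%:R * ((x - a + `|x - a|) / 2)))));
  last exact: continuous_expR.
apply: cvgN; apply: cvgM; first exact: cvg_cst.
apply: cvgM; last exact: cvg_cst.
have xa : (y - a) @[y --> x] --> x - a by apply: cvgB; [exact: cvg_id|exact: cvg_cst].
by apply: cvgD => //; exact: cvg_norm.
Qed.

Let ray_cvg a x : ray a n x @[n --> \oo] --> (\1_(`]a, +oo[%classic) x : R).
Proof.
have [ax|xa] := ltP a x.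
  rewrite indicE mem_set/=; last by rewrite /= in_itv/= ax.
  rewrite -[X in _ --> X]subr0; apply: cvgB; first exact: cvg_cst.
  have xa0 : 0 < x - a by rewrite subr_gt0.
  rewrite /ray (gtr0_norm xa0).
  rewrite (_ : (fun n : nat => _) = (fun n => expR (- (x - a)) ^+ n)); last first.
    by apply/funext => n; rewrite -expRM_natr; congr expR; field.
  by apply: cvg_expr; rewrite ger0_norm ?expR_ge0// -[ltRHS]expR0 ltr_expR oppr_lt0.
rewrite indicE memNset/=; last by rewrite in_itv/= andbT; apply/negP; rewrite -leNgt.
rewrite /ray; have -> : x - a + `|x - a| = 0 by rewrite ler0_norm ?subr_le0// subrr.
rewrite mul0r; under eq_fun do rewrite mulr0 oppr0 expR0 subrr.
exact: cvg_cst.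
Qed.

(** A real law is determined by its characteristic function: equality of means
    extends from trigonometric polynomials to bounded continuous functions, to
    open rays, and from these, which are stable under intersection, to all Borel
    sets. *)
Lemma eq_real_law (B : set R) : measurable B -> P (X @^-1` B) = Q (Y @^-1` B).
Proof.
have [PX PXE] := law_exists P mX; have [QY QYE] := law_exists Q mY.
move=> mB; rewrite -PXE// -QYE//; move: B mB.
have rayE a : PX `]a, +oo[%classic = QY `]a, +oo[%classic.
  have mr : measurable (`]a, +oo[%classic : set R) by exact: measurable_itv.
  rewrite PXE// QYE//.
  have bm : bounded_measurable (\1_(`]a, +oo[%classic) : R -> R) by exact: bounded_measurable_indic.
  have limX : mean P (ray a n \o X) @[n --> \oo] --> mean P (\1_(`]a, +oo[%classic) \o X).
    apply: (@mean_dominated_convergence _ _ _ _ _ _ (cst 1)).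
    - move=> n; apply: measurableT_comp => //.
      by apply: continuous_measurable_fun; exact: continuous_ray.
    - by apply: measurableT_comp => //; case: bm.
    - exact: summable_cst.
    - by move=> n w; exact: ray01.
    - by move=> w; exact: ray_cvg.
  have limY : mean P (ray a n \o X) @[n --> \oo] --> mean Q (\1_(`]a, +oo[%classic) \o Y).
    under eq_fun do rewrite (eq_mean_continuous (@continuous_ray a _) (ray01 a _)).
    apply: (@mean_dominated_convergence _ _ _ _ _ _ (cst 1)).
    - move=> n; apply: measurableT_comp => //.
      by apply: continuous_measurable_fun; exact: continuous_ray.
    - by apply: measurableT_comp => //; case: bm.
    - exact: summable_cst.
    - by move=> n w; exact: ray01.
    - by move=> w; exact: ray_cvg.
  have E := cvg_seq_unique limX limY.
  have mX1 : measurable (X @^-1` `]a, +oo[%classic).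
    by rewrite -[X in measurable X]setTI; exact: mX.
  have mY1 : measurable (Y @^-1` `]a, +oo[%classic).
    by rewrite -[X in measurable X]setTI; exact: mY.
  have EX : mean P (\1_(`]a, +oo[%classic) \o X) = fine (P (X @^-1` `]a, +oo[%classic)).
    by rewrite -mean_indic.
  have EY : mean Q (\1_(`]a, +oo[%classic) \o Y) = fine (Q (Y @^-1` `]a, +oo[%classic)).
    by rewrite -mean_indic.
  by rewrite -[LHS]fineK ?fin_num_measure// -[RHS]fineK ?fin_num_measure// -EX -EY E.
apply: (@measure_unique _ R _ (@RGenOInfty.G R) (fun k => `](- k%:R), +oo[%classic)).
- exact: RGenOInfty.measurableE.
- move=> _ _ [a ->] [b ->]; exists (Num.max a b).
  apply/seteqP; split=> x /=; rewrite !in_itv/= !andbT gt_max.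
    by move=> [-> ->].
  by move=> /andP[].
- by move=> i; exists (- i%:R).
- apply/seteqP; split=> // x _.
  exists (Num.truncn (- x)).+1 => //=; rewrite in_itv/= andbT.
  by rewrite ltrNl Num.Theory.truncnS_gt.
- by move=> _ [a ->]; exact: rayE.
- by move=> k; rewrite (le_lt_trans (probability_le1 _ _))// ltry.
Qed.

End real_laws.

Section gaussian_characteristics.
Context {R : realType}.

(** The characteristic function at 1 of the centered normal law of variance v,
    real and imaginary parts being read off at two phases theta. *)
Definition gaussian_characteristic {d} {T : measurableType d} (P : probability T R)
    (Y : T -> R) (v : R) : Prop :=
  forall theta, mean P (fun w => cos (Y w + theta)) = cos theta * expR (- v / 2).

Lemma gaussian_characteristic_cos {d} {T : measurableType d} (P : probability T R) Y v :
  gaussian_characteristic P Y v -> mean P (fun w => cos (Y w)) = expR (- v / 2).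
Proof.
move=> /(_ 0); rewrite cos0 mul1r => <-.
by apply: eq_mean => w; rewrite addr0.
Qed.

Lemma gaussian_characteristic_sin {d} {T : measurableType d} (P : probability T R) Y v :
  gaussian_characteristic P Y v -> mean P (fun w => sin (Y w)) = 0.
Proof.
move=> /(_ (- (pi / 2))); rewrite cosN cos_pihalf mul0r => Y0; rewrite -[RHS]Y0.
by apply: eq_mean => w; rewrite cosBpihalf.
Qed.

Lemma gaussian_characteristic0 {d} {T : measurableType d} (P : probability T R) :
  gaussian_characteristic P (fun=> 0) 0.
Proof.
move=> theta; rewrite oppr0 mul0r expR0 mulr1 -[RHS](mean_cst P).
by apply: eq_mean => w; rewrite add0r.
Qed.

(** Variances of independent summands add. *)
Lemma gaussian_characteristic_prod {d d'} {T : measurableType d} {T' : measurableType d'}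
    (P : probability T R) (Q : probability T' R) (Y : T -> R) (Z : T' -> R) v v' :
  measurable_fun setT Y -> measurable_fun setT Z ->
  gaussian_characteristic P Y v -> gaussian_characteristic Q Z v' ->
  gaussian_characteristic (P \x Q)%E (fun z => Y z.1 + Z z.2) (v + v').
Proof.
move=> mY mZ Yv Zv' theta.
have bcY := bounded_measurable_cos mY; have bsY := bounded_measurable_sin mY.
have mZt : measurable_fun setT (fun w => Z w + theta) by exact: measurable_funD.
have bcZ := bounded_measurable_cos mZt; have bsZ := bounded_measurable_sin mZt.
have sprod f g (bf : bounded_measurable f) (bg : bounded_measurable g) :
  summable (P \x Q)%E (fun z : T * T' => (f z.1 * g z.2 : R)).
  apply/bounded_measurable_summable; apply: bounded_measurableM.
    exact: (bounded_measurable_comp measurable_fst bf).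
  exact: (bounded_measurable_comp measurable_snd bg).
have prodE f g (bf : bounded_measurable f) (bg : bounded_measurable g) :
  mean (P \x Q)%E (fun z : T * T' => (f z.1 * g z.2 : R)) = mean P f * mean Q g.
  exact: mean_product.
under eq_fun do rewrite -addrA cosD.
rewrite meanB; [|exact: (sprod _ _ bcY bcZ)|exact: (sprod _ _ bsY bsZ)].
rewrite (prodE _ _ bcY bcZ) (prodE _ _ bsY bsZ) Zv'.
rewrite (gaussian_characteristic_cos Yv) (gaussian_characteristic_sin Yv) mul0r subr0 mulrCA.
by rewrite -expRD; congr (_ * expR _); field.
Qed.

(** Independent standard normal variables, built by iterated products. *)
Lemma standard_normal_vector (N : nat) :
  exists (d : measure_display) (T : measurableType d) (Q : probability T R)
    (G : T -> 'rV[R]_N),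
  measurable_entries G /\
  forall s : 'rV[R]_N, gaussian_characteristic Q (fun w => dotv s (G w)) (dotv s s).
Proof.
elim: N => [|N [d [T [Q [G [mG IH]]]]]].
  exists _, _, (@normal_prob R 0 1), (fun=> 0); split; first exact: measurable_entries_cst.
  move=> s; rewrite {2}/dotv big_ord0 (_ : (fun w => _) = fun=> 0).
    exact: gaussian_characteristic0.
  by apply/funext => w; rewrite /dotv big_ord0.
exists _, _, (Q \x (normal_prob 0 1 : probability _ R))%E,
  (fun z => \row_(j < N.+1) (if unlift ord0 j is Some i then G z.1 0 i else z.2)).
split.
  move=> i j; under eq_fun do rewrite mxE; case: (unlift ord0 j) => [l|].
    exact: measurableT_comp (mG 0 l) measurable_fst.
  exact: measurable_snd.
move=> s; pose s' : 'rV[R]_N := \row_i s 0 (lift ord0 i).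
rewrite (_ : (fun z => _) = (fun z => dotv s' (G z.1) + s 0 ord0 * z.2)); last first.
  apply/funext => z; rewrite /dotv big_ord_recl mxE unlift_none addrC; congr (_ + _).
  by apply: eq_bigr => i _; rewrite !mxE liftK.
rewrite (_ : dotv s s = dotv s' s' + s 0 ord0 ^+ 2); last first.
  rewrite /dotv big_ord_recl addrC expr2; congr (_ + _).
  by apply: eq_bigr => i _; rewrite !mxE.
apply: (gaussian_characteristic_prod _ _ (IH s')).
- by apply: measurable_sum => j; apply: measurable_funM.
- exact: measurable_funM.
by move=> theta; rewrite (@mean_cos_normal R 1 ltr01 theta (s 0 ord0)) expr1n mul1r.
Qed.

End gaussian_characteristics.

(** * Gaussian laws *)

Section gaussian_laws.
Context {R : realType}.

Lemma dotv_mx N (s u : 'rV[R]_N) : dotv s u = (s *m u^T) 0 0.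
Proof. by rewrite mxE; apply: eq_bigr => j _; rewrite mxE. Qed.

Lemma dotv_mulmx N K (s : 'rV[R]_N) (u : 'rV[R]_K) (A : 'M[R]_(K, N)) :
  dotv s (u *m A) = dotv (s *m A^T) u.
Proof. by rewrite !dotv_mx trmx_mul mulmxA. Qed.

Lemma dotvZl N c (s u : 'rV[R]_N) : dotv (c *: s) u = c * dotv s u.
Proof. by rewrite /dotv mulr_sumr; apply: eq_bigr => j _; rewrite mxE mulrA. Qed.

Lemma normal_law_characteristic {d} {T : measurableType d} (P : probability T R)
    (Z : T -> R) (v : R) : measurable_fun setT Z -> 0 <= v ->
  (forall t, gaussian_characteristic P (fun w => t * Z w) (t ^+ 2 * v)) ->
  forall B, measurable B -> P (Z @^-1` B) = normal_law 0 v B.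
Proof.
move=> mZ v0 Zv B mB; rewrite /normal_law; case: eqP => [v_eq0|/eqP v_neq0].
  rewrite (@eq_real_law _ _ _ _ _ P (@normal_prob R 0 1) Z (cst 0) _ _ _ B mB) //.
    rewrite diracE; have [B0|B0] := boolP (0 \in B).
      rewrite (_ : _ @^-1` _ = setT) ?probability_setT//.
      by apply/seteqP; split=> // x _; exact: set_mem B0.
    rewrite (_ : _ @^-1` _ = set0) ?measure0//.
    by apply/seteqP; split=> // x /= Bx; move: B0; rewrite mem_set.
  move=> t theta; rewrite Zv v_eq0 mulr0 -(gaussian_characteristic0 (@normal_prob R 0 1)).
  by apply: eq_mean => x; rewrite mulr0.
have sv0 : 0 < Num.sqrt v by rewrite sqrtr_gt0 lt0r v_neq0.
apply: (@eq_real_law _ _ _ _ _ P (normal_prob 0 (Num.sqrt v)) Z idfun) => //.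
  exact: measurable_id.
by move=> t theta; rewrite Zv mean_cos_normal// sqr_sqrtr// [v * _]mulrC.
Qed.

Definition psdmx n (V : 'M[R]_n) : Prop :=
  V^T = V /\ forall x : 'cV[R]_n, 0 <= (x^T *m V *m x) 0 0.

(* When the corner a vanishes, so does its row b; otherwise the Schur complement
   C - b' b / a is again nonnegative. *)
Let psdmx_factor_block n (a : R) (b : 'rV[R]_n) (C : 'M[R]_n) :
  (forall C' : 'M[R]_n, psdmx C' -> exists A : 'M[R]_n, C' = A^T *m A) ->
  psdmx (block_mx a%:M b b^T C) ->
  exists A : 'M[R]_(1 + n), block_mx a%:M b b^T C = A^T *m A.
Proof.
move=> IH [sV pV].
have sC : C^T = C by move: sV; rewrite tr_block_mx => /eq_block_mx[].
have qE (y : R) (z : 'cV[R]_n) :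
    0 <= a * y ^+ 2 + 2 * y * (b *m z) 0 0 + (z^T *m C *m z) 0 0.
  have := pV (col_mx y%:M z).
  rewrite tr_col_mx mul_row_block mul_row_col !mulmxDl tr_scalar_mx.
  rewrite !mul_scalar_mx -!scalemxAl.
  have -> : z^T *m b^T *m y%:M = y *: (b *m z)^T by rewrite -trmx_mul mul_mx_scalar.
  rewrite mul_mx_scalar !mxE => /le_trans; apply.
  by rewrite le_eqVlt; apply/orP; left; apply/eqP; rewrite eqxx mulr1n; ring.
have a0 : 0 <= a.
  by have := qE 1 0; rewrite !mulmx0 !mxE expr1n mulr1 mulr0 !addr0.
have [a_eq0|a_neq0] := eqVneq a 0.
  have bz (z : 'cV[R]_n) : (b *m z) 0 0 = 0.
    apply/eqP/negPn/negP => bz0; set q := (z^T *m C *m z) 0 0.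
    have := qE (- (q + 1) / (2 * (b *m z) 0 0)) z; rewrite a_eq0 -/q.
    have -> : 0 * (- (q + 1) / (2 * (b *m z) 0 0)) ^+ 2 +
      2 * (- (q + 1) / (2 * (b *m z) 0 0)) * (b *m z) 0 0 + q = - 1 by field.
    by rewrite lerNr oppr0 ler10.
  have b0 : b = 0.
    by apply/rowP => j; have := bz (delta_mx j 0); rewrite -colE !mxE.
  have [A CE] : exists A : 'M[R]_n, C = A^T *m A.
    apply: IH; split=> // z.
    by have := qE 0 z; rewrite expr0n/= !(mulr0, mul0r) !add0r.
  exists (block_mx 0 0 0 A : 'M[R]_(1 + n)).
  rewrite tr_block_mx mulmx_block !trmx0 !(mulmx0, mul0mx) !addr0 !add0r -CE b0 a_eq0 ?trmx0.
  by congr block_mx; rewrite raddf0.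
have a_gt0 : 0 < a by rewrite lt0r a_neq0.
pose sa := Num.sqrt a.
have sa0 : sa != 0 by rewrite gt_eqF// sqrtr_gt0.
have saa : sa * sa = a by rewrite -expr2 sqr_sqrtr.
have [A CE] : exists A : 'M[R]_n, C - a^-1 *: (b^T *m b) = A^T *m A.
  apply: IH; split.
    by rewrite linearB/= linearZ/= trmx_mul trmxK sC.
  move=> z; have := qE (- (b *m z) 0 0 / a) z => /le_trans; apply.
  have bb : (z^T *m (b^T *m b) *m z) 0 0 = (b *m z) 0 0 ^+ 2.
    by rewrite mulmxA -mulmxA -trmx_mul mxE big_ord1 mxE.
  rewrite mulmxBr mulmxBl -scalemxAr -scalemxAl.
  rewrite [X in _ <= X]mxE [X in _ <= _ + X]mxE [X in _ <= _ - X]mxE bb.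
  by rewrite le_eqVlt; apply/orP; left; apply/eqP; field.
exists (block_mx sa%:M (sa^-1 *: b) 0 A : 'M[R]_(1 + n)).
rewrite tr_block_mx mulmx_block !trmx0 !(mulmx0, mul0mx) !addr0 -CE.
rewrite tr_scalar_mx !mul_scalar_mx mul_mx_scalar.
rewrite [(_ *: b)^T]linearZ/= !scalerA (mulfV sa0) ?(mulVf sa0) !scale1r -scalemxAl -scalemxAr scalerA.
rewrite -invfM saa [X in _ = block_mx _ _ _ X]addrC subrK; congr block_mx.
by rewrite scale_scalar_mx saa.
Qed.

(** Cholesky factorization, by Schur complements. *)
Lemma psdmx_factor n (V : 'M[R]_n) : psdmx V -> exists A : 'M[R]_n, V = A^T *m A.
Proof.
elim: n V => [|n IH] V pV; first by exists 0; apply/matrixP => -[].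
have VE : V = block_mx (V 0 0)%:M (ursubmx (V : 'M[R]_(1 + n))) (ursubmx (V : 'M[R]_(1 + n)))^T
    (drsubmx (V : 'M[R]_(1 + n))) :> 'M[R]_(1 + n).
  rewrite -[LHS](@submxK _ 1 n 1 n); congr block_mx.
    by rewrite [LHS]mx11_scalar !mxE; congr (_ %:M); congr (V _ _); exact/val_inj.
  by rewrite trmx_ursub pV.1.
have [|A E] := @psdmx_factor_block n (V 0 0) (ursubmx (V : 'M[R]_(1 + n)))
    (drsubmx (V : 'M[R]_(1 + n))) IH.
  by rewrite -VE.
by exists A; rewrite VE.
Qed.

Lemma gaussian_vector_exists N (V : 'M[R]_N) : psdmx V ->
  exists (d : measure_display) (T : measurableType d) (Q : probability T R)
    (G : T -> 'rV[R]_N),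
  measurable_entries G /\ forall s : 'rV[R]_N,
    gaussian_characteristic Q (fun w => dotv s (G w)) ((s *m V *m s^T) 0 0).
Proof.
move=> /psdmx_factor[A ->]; have [d [T [Q [G [mG GE]]]]] := @standard_normal_vector R N.
exists d, T, Q, (fun w => G w *m A); split.
  by apply: measurable_entriesM => //; exact: measurable_entries_cst.
move=> s; have -> : (s *m (A^T *m A) *m s^T) 0 0 = dotv (s *m A^T) (s *m A^T).
  by rewrite dotv_mx trmx_mul trmxK !mulmxA.
under eq_fun do rewrite dotv_mulmx.
exact: GE.
Qed.

Lemma matrix_law_exists {d} {T : measurableType d} (Q : probability T R) m n
    (X : T -> 'M[R]_(m, n)) : measurable_entries X ->
  exists mu : probability (borel_mx R m n) R,
    (forall A : set (borel_mx R m n), measurable A -> mu A = Q (X @^-1` A)) /\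
    forall f : borel_mx R m n -> R, bounded_measurable f ->
      mean mu f = mean Q (f \o X).
Proof.
move=> /measurable_entriesP mX.
have [mu muE] := @law_exists R _ _ T (borel_mx R m n) Q X mX.
exists mu; split=> // f [mf [M fM]].
apply: (@mean_same_law _ _ _ _ _ _ _ mu Q idfun X _ mX _ f M) => //; exact: measurable_id.
Qed.

(** Linear images of a Gaussian vector are Gaussian, by uniqueness of
    characteristic functions on the line. *)
Lemma multivariate_normal_exists N (V : 'M[R]_N) : psdmx V ->
  exists mu : probability (borel_mx R N 1) R, is_multivariate_normal 0 V mu /\
    forall s : 'rV[R]_N, gaussian_characteristic mu
      (fun u : borel_mx R N 1 => dotv s (u : 'cV[R]_N)^T) ((s *m V *m s^T) 0 0).
Proof.
move=> pV; have [d [T [Q [G [mG GE]]]]] := gaussian_vector_exists pV.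
have mGt : measurable_entries (fun w => (G w)^T) by exact: measurable_entries_tr.
have [mu [muE mu_mean]] := matrix_law_exists Q mGt.
have mdot (s : 'rV[R]_N) : measurable_fun setT
    (fun u : borel_mx R N 1 => dotv s (u : 'cV[R]_N)^T).
  apply: measurable_sum => j; apply: measurable_funM => //.
  under eq_fun do rewrite mxE.
  by have /measurable_entriesP := @measurable_id _ (borel_mx R N 1) setT; apply.
exists mu; split=> [a B mB|s theta].
  rewrite muE; last first.
    have := mdot a^T measurableT B mB; rewrite setTI.
    congr measurable; by apply/seteqP; split=> u /=; rewrite dotv_mx trmxK.
  rewrite mulmx0 mxE.
  rewrite -(@normal_law_characteristic _ _ Q (fun w => dotv a^T (G w))) => //.
  - by congr (Q _); apply/seteqP; split=> w /=; rewrite dotv_mx.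
  - by apply: measurable_sum => j; exact: measurable_funM.
  - exact: pV.2.
  - move=> t; have := GE (t *: a^T).
    rewrite (_ : ((t *: a^T) *m V *m (t *: a^T)^T) 0 0 = t ^+ 2 * (a^T *m V *m a) 0 0).
      by under [X in gaussian_characteristic Q X]eq_fun do rewrite dotvZl.
    by rewrite linearZ/= trmxK -!scalemxAl -scalemxAr scalerA mxE -expr2.
rewrite mu_mean; last by apply: bounded_measurable_cos; exact: measurable_funD.
by rewrite -GE; apply: eq_mean => w /=; rewrite trmxK.
Qed.

End gaussian_laws.

(** * Sums of uncorrelated terms *)

Section uncorrelated.
Context {R : realType} {d d' : measure_display} {T : measurableType d}
  {S : measurableType d'}.
Variables (P : probability T R) (e : nat -> T -> S).
Hypotheses (me : forall t, measurable_fun setT (e t))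
  (ie : mutually_independent P e) (de : identically_distributed P e).

Lemma summable_same_law (f : S -> R) t : measurable_fun setT f ->
  (forall x, 0 <= f x) -> summable P (fun w => f (e 0%N w)) ->
  summable P (fun w => f (e t w)).
Proof.
move=> mf f0 /integrableP[_ f_lty]; apply/integrableP; split.
  by apply/measurable_EFinP; exact: measurableT_comp mf (me t).
apply: le_lt_trans f_lty; rewrite le_eqVlt; apply/orP; left; apply/eqP.
have mEf : measurable_fun setT (EFin \o f) by exact/measurable_EFinP.
have E s : (\int[P]_x `|(EFin \o (fun w => f (e s w))) x| =
    \int[pushforward P (e s)]_y (f y)%:E)%E.
  rewrite ge0_integral_pushforward//; last by move=> y _; rewrite /= lee_fin.
  by apply: eq_integral => w _ /=; rewrite ger0_norm.
by rewrite !E; apply: eq_measure_integral => A mA _; exact: de.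
Qed.

Let prod_two (n t u : nat) (a b : R) : t != u -> (t < n)%N -> (u < n)%N ->
  \prod_(s < n) (if s == t :> nat then a else if s == u :> nat then b else 1) = a * b.
Proof.
move=> tu tn un; rewrite (bigD1 (Ordinal tn))//= eqxx (bigD1 (Ordinal un))/=; last first.
  by rewrite -val_eqE eq_sym.
rewrite eq_sym (negbTE tu) eqxx big1 ?mulr1// => s.
by rewrite -!val_eqE/= => /andP[/negbTE -> /negbTE ->].
Qed.

Let mean_mul_bounded t u (f g : S -> R) : t != u ->
  bounded_measurable f -> bounded_measurable g ->
  mean P (fun w => f (e t w) * g (e u w)) =
  mean P (fun w => f (e 0%N w)) * mean P (fun w => g (e 0%N w)).
Proof.
move=> tu bf bg.
have b1 : bounded_measurable (fun _ : S => 1 : R).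
  by split; [exact: measurable_cst|exists 1 => x; rewrite normr1].
pose G s := if s == t then f else if s == u then g else fun=> 1.
have bG s : bounded_measurable (G s) by rewrite /G; case: ifP => // _; case: ifP.
pose n := (maxn t u).+1.
have tn : (t < n)%N by rewrite ltnS leq_maxl.
have un : (u < n)%N by rewrite ltnS leq_maxr.
have := mean_prod me ie n bG.
rewrite (_ : (fun w => _) = (fun w => f (e t w) * g (e u w))); last first.
  apply/funext => w; rewrite -(prod_two _ _ tu tn un).
  by apply: eq_bigr => s _; rewrite /G; case: eqP => [->//|_]; case: eqP => [->//|_].
move=> ->.
have sl h : bounded_measurable h ->
      forall s, mean P (fun w => h (e s w)) = mean P (fun w => h (e 0%N w)).
  move=> [mh [M hM]] s.
  exact: (@mean_same_law _ _ _ _ _ _ _ P P (e s) (e 0%N) (me s) (me 0%N) (de s) h M).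
rewrite -(sl f bf t) -(sl g bg u) -(prod_two _ _ tu tn un).
apply: eq_bigr => s _; rewrite /G.
case: eqP => [->//|_]; case: eqP => [->//|_].
by rewrite (_ : _ \o _ = cst 1) ?mean_cst.
Qed.

Let clip (n : nat) (y : R) : R := Num.max (- n%:R) (Num.min y n%:R).

Let clip_le n y : `|clip n y| <= n%:R.
Proof.
have n0 : 0 <= n%:R :> R by [].
by rewrite /clip ler_norml le_max lexx/= ge_max ge_min lexx orbT andbT; lra.
Qed.

Let clip_norm n y : `|clip n y| <= `|y|.
Proof.
have n0 : 0 <= n%:R :> R by [].
rewrite /clip; have [yn|yn] := leP y n%:R; last first.
  by rewrite (max_idPr _) ?(ger0_norm n0) ?(le_trans (ltW yn)) ?ler_norm//; lra.
have [ny|ny] := leP (- n%:R) y => //.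
by rewrite normrN (ger0_norm n0) ler0_norm; lra.
Qed.

Let clip_cvg y : clip n y @[n --> \oo] --> y.
Proof.
apply: cvg_near_cst; exists (Num.truncn `|y|).+1 => // n /= yn.
have yn' : `|y| <= n%:R.
  apply: ltW; apply: lt_le_trans (Num.Theory.truncnS_gt _) _.
  by rewrite ler_nat.
move: yn'; rewrite ler_norml => /andP[y1 y2].
by rewrite /clip (min_idPl y2) (max_idPr y1).
Qed.

Let measurable_clip n (f : S -> R) : measurable_fun setT f ->
  measurable_fun setT (fun x => clip n (f x)).
Proof.
move=> mf; apply: measurable_maxr; first exact: measurable_cst.
by apply: measurable_minr => //; exact: measurable_cst.
Qed.

(** Truncation extends the product rule from bounded functions to square
    integrable ones. *)
Lemma uncorrelated t u (f g : S -> R) : t != u ->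
  measurable_fun setT f -> measurable_fun setT g ->
  summable P (fun w => f (e 0%N w) ^+ 2) ->
  summable P (fun w => g (e 0%N w) ^+ 2) ->
  mean P (fun w => f (e 0%N w)) = 0 ->
  mean P (fun w => f (e t w) * g (e u w)) = 0.
Proof.
move=> tu mf mg sf sg f0.
have mfe s : measurable_fun setT (fun w => f (e s w)) by exact: measurableT_comp mf (me s).
have mge s : measurable_fun setT (fun w => g (e s w)) by exact: measurableT_comp mg (me s).
have sft s : summable P (fun w => f (e s w) ^+ 2).
  apply: (@summable_same_law (fun x => f x ^+ 2)) => //; first exact: measurable_funX.
  by move=> x; exact: sqr_ge0.
have sgt s : summable P (fun w => g (e s w) ^+ 2).
  apply: (@summable_same_law (fun x => g x ^+ 2)) => //; first exact: measurable_funX.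
  by move=> x; exact: sqr_ge0.
have le1 (y : R) : `|y| <= 1 + y ^+ 2.
  rewrite -[X in _ <= 1 + X]real_normK ?num_real//.
  by have := sqr_ge0 (`|y| - 1); have := normr_ge0 y; nra.
have s1 (h : S -> R) : summable P (fun w => h (e 0%N w) ^+ 2) ->
    summable P (fun w => 1 + h (e 0%N w) ^+ 2).
  by move=> sh; apply: summableD => //; exact: summable_cst.
have fc : mean P (fun w => clip n (f (e 0%N w))) @[n --> \oo] --> (0 : R).
  rewrite -[X in _ --> X]f0.
  apply: (@mean_dominated_convergence _ _ _ _ _ _ (fun w => 1 + f (e 0%N w) ^+ 2)).
  - by move=> n; exact: measurableT_comp (measurable_clip n mf) (me 0%N).
  - exact: mfe.
  - exact: s1.
  - by move=> n w; exact: le_trans (clip_norm _ _) (le1 _).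
  - by move=> w; exact: clip_cvg.
have gc : mean P (fun w => clip n (g (e 0%N w))) @[n --> \oo] --> mean P (fun w => g (e 0%N w)).
  apply: (@mean_dominated_convergence _ _ _ _ _ _ (fun w => 1 + g (e 0%N w) ^+ 2)).
  - by move=> n; exact: measurableT_comp (measurable_clip n mg) (me 0%N).
  - exact: mge.
  - exact: s1.
  - by move=> n w; exact: le_trans (clip_norm _ _) (le1 _).
  - by move=> w; exact: clip_cvg.
have c1 := cvgM fc gc; rewrite mul0r in c1.
have c2 : mean P (fun w => clip n (f (e t w)) * clip n (g (e u w))) @[n --> \oo] --> (0 : R).
  have E n : mean P (fun w => clip n (f (e t w)) * clip n (g (e u w))) =
      mean P (fun w => clip n (f (e 0%N w))) * mean P (fun w => clip n (g (e 0%N w))).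
    apply: (@mean_mul_bounded t u (clip n \o f) (clip n \o g) tu).
    by split; [exact: measurable_clip|exists n%:R => x; exact: clip_le].
    by split; [exact: measurable_clip|exists n%:R => x; exact: clip_le].
  under eq_fun do rewrite E.
  exact: c1.
apply: (@cvg_seq_unique R _ _ _ _ c2).
apply: (@mean_dominated_convergence _ _ _ _ _ _ (fun w => f (e t w) ^+ 2 + g (e u w) ^+ 2)).
- move=> n; apply: measurable_funM.
    exact: measurableT_comp (measurable_clip n mf) (me t).
  exact: measurableT_comp (measurable_clip n mg) (me u).
- exact: measurable_funM.
- by apply: summableD; [exact: sft|exact: sgt].
- move=> n w; rewrite normrM; apply: (@le_trans _ _ (`|f (e t w)| * `|g (e u w)|)).
    by apply: ler_pM.
  rewrite -[X in _ <= X + _]real_normK ?num_real// -[X in _ <= _ + X]real_normK ?num_real//.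
  by have := sqr_ge0 (`|f (e t w)| - `|g (e u w)|); have := normr_ge0 (f (e t w));
    have := normr_ge0 (g (e u w)); nra.
- by move=> w; apply: cvgM; exact: clip_cvg.
Qed.

Lemma mean_sqr_sum (g : nat -> S -> R) n : (forall t, measurable_fun setT (g t)) ->
  (forall t, summable P (fun w => g t (e 0%N w) ^+ 2)) ->
  (forall t, mean P (fun w => g t (e 0%N w)) = 0) ->
  summable P (fun w => (\sum_(t < n) g t (e t w)) ^+ 2) /\
  mean P (fun w => (\sum_(t < n) g t (e t w)) ^+ 2) =
    \sum_(t < n) mean P (fun w => g t (e 0%N w) ^+ 2).
Proof.
move=> mg sg g0.
have mge t : measurable_fun setT (fun w => g t (e t w)) by exact: measurableT_comp (mg t) (me t).
have sgt t : summable P (fun w => g t (e t w) ^+ 2).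
  apply: (@summable_same_law (fun x => g t x ^+ 2)) => //; first exact: measurable_funX.
  by move=> x; exact: sqr_ge0.
have sgg t u : summable P (fun w => g t (e t w) * g u (e u w)).
  apply: (@summable_le _ _ _ _ _ (fun w => g t (e t w) ^+ 2 + g u (e u w) ^+ 2)).
  - exact: measurable_funM.
  - move=> w; rewrite normrM.
    rewrite -[X in _ <= X + _]real_normK ?num_real// -[X in _ <= _ + X]real_normK ?num_real//.
    by have := sqr_ge0 (`|g t (e t w)| - `|g u (e u w)|); have := normr_ge0 (g t (e t w));
      have := normr_ge0 (g u (e u w)); nra.
  - by apply: summableD; [exact: sgt|exact: sgt].
have E : (fun w => (\sum_(t < n) g t (e t w)) ^+ 2) =
    (fun w => \sum_(t < n) \sum_(u < n) g t (e t w) * g u (e u w)).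
  apply/funext => w; rewrite expr2 mulr_suml; apply: eq_bigr => t _.
  by rewrite mulr_sumr.
rewrite E; split; first by apply: summable_sum => t _; exact: summable_sum.
rewrite mean_sum; last by move=> t _; exact: summable_sum.
apply: eq_bigr => t _; rewrite mean_sum//.
rewrite (bigD1 t)//= big1 ?addr0 => [|u ut].
  under eq_mean do rewrite -expr2.
  apply: (@ge0_mean_same_law _ _ _ _ _ _ _ P P (e t) (e 0%N) (me t) (me 0%N) (de t)
      (fun x => g t x ^+ 2)).
    exact: measurable_funX.
  by move=> x; exact: sqr_ge0.
by apply: uncorrelated => //; rewrite eq_sym.
Qed.

End uncorrelated.

(** * The estimators as functions of the normalized statistics *)

Section packing.
Context {R : realType} {k p : nat} {m : 'I_k -> nat}.

(** All statistics are carried by one row vector, indexed by a finite type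
    because the sizes m i of the blocks depend on i. *)
Definition stat_index := ({i : 'I_k & 'I_(m i)} * 'I_p + 'I_p * 'I_p)%type.

Definition pack (M : forall i, 'M[R]_(m i, p)) (N : 'M[R]_p) : 'rV[R]_#|{: stat_index}| :=
  \row_a match enum_val a with
         | inl z => M (tag z.1) (tagged z.1) z.2
         | inr z => N z.1 z.2
         end.

Definition linear_part i (u : 'rV[R]_#|{: stat_index}|) : 'M[R]_(m i, p) :=
  \matrix_(r, b) u 0 (enum_rank (inl (Tagged (fun i => 'I_(m i)) r, b) : stat_index)).

Definition quadratic_part (u : 'rV[R]_#|{: stat_index}|) : 'M[R]_p :=
  \matrix_(a, b) u 0 (enum_rank (inr (a, b) : stat_index)).

Lemma linear_part_pack M N i : linear_part i (pack M N) = M i.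
Proof. by apply/matrixP => r b; rewrite !mxE enum_rankK. Qed.

Lemma quadratic_part_pack M N : quadratic_part (pack M N) = N.
Proof. by apply/matrixP => a b; rewrite !mxE enum_rankK. Qed.

Lemma mxtrace_mul_tr a b (A B : 'M[R]_(a, b)) :
  \tr (A *m B^T) = \sum_i \sum_j A i j * B i j.
Proof. by apply: eq_bigr => i _; rewrite mxE; apply: eq_bigr => j _; rewrite mxE. Qed.

Lemma dotv_parts s u : dotv s u =
  \sum_i \tr (linear_part i s *m (linear_part i u)^T) +
  \tr (quadratic_part s *m (quadratic_part u)^T).
Proof.
rewrite /dotv (reindex (@enum_rank stat_index))/=; last first.
  by exists enum_val => j _; rewrite ?enum_rankK ?enum_valK.
rewrite big_sumType/=; congr (_ + _); last first.
  rewrite mxtrace_mul_tr pair_big/=; apply: eq_bigr => -[a b] _.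
  by rewrite !mxE.
under [RHS]eq_bigr do rewrite mxtrace_mul_tr.
rewrite sig_big_dep/= pair_big/=; apply: eq_bigr => -[[i r] b] _.
by rewrite !mxE.
Qed.

Lemma continuous_linear_part i : continuous (linear_part i).
Proof.
move=> u; apply: (@cvg_entries R _ (nbhs u) (@nbhs_filter _ u)) => r b; rewrite mxE.
set j := enum_rank _.
have -> : (fun v => linear_part i v r b) = (fun v => v 0 j) by apply/funext => v; rewrite mxE.
exact: coord_continuous.
Qed.

Lemma continuous_quadratic_part : continuous quadratic_part.
Proof.
move=> u; apply: (@cvg_entries R _ (nbhs u) (@nbhs_filter _ u)) => r b; rewrite mxE.
set j := enum_rank _.
have -> : (fun v => quadratic_part v r b) = (fun v => v 0 j) by apply/funext => v; rewrite mxE.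
exact: coord_continuous.
Qed.

End packing.

Section positive_definite.
Context {R : realType}.

Lemma posdefmx1 n : posdefmx (1%:M : 'M[R]_n).
Proof.
split; first exact: trmx1.
move=> x x0; rewrite mulmx1 mxE lt_neqAle sumr_ge0 ?andbT; last first.
  by move=> i _; rewrite mxE -expr2 sqr_ge0.
apply: contra x0; rewrite eq_sym psumr_eq0 => [/allP x0|i _]; last first.
  by rewrite mxE -expr2 sqr_ge0.
apply/eqP/colP => i; have := x0 i (mem_index_enum _).
by rewrite !mxE -expr2 sqrf_eq0 => /eqP.
Qed.

(** A positive definite form stays nondegenerate on the column space of Z. *)
Lemma posdefmx_gram_unit n q (A : 'M[R]_n) (Z : 'M[R]_(n, q)) :
  posdefmx A -> \rank Z = q -> Z^T *m A *m Z \in unitmx.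
Proof.
move=> [_ pA] rZ; rewrite -row_free_unit; apply: inj_row_free => v v0.
have fZ : row_free Z^T by rewrite /row_free mxrank_tr rZ.
have [Zv0|Zv0] := eqVneq (Z *m v^T) 0.
  apply: (row_free_inj fZ); rewrite mul0mx.
  by rewrite -[LHS]trmxK trmx_mul trmxK Zv0 trmx0.
have := pA _ Zv0; rewrite trmx_mul trmxK -!mulmxA !mulmxA.
rewrite -(mulmxA v Z^T A) -(mulmxA v) v0 mul0mx mxE ltxx.
by [].
Qed.

Lemma posdefmx_unit n (A : 'M[R]_n) : posdefmx A -> A \in unitmx.
Proof.
move=> pA; have := posdefmx_gram_unit pA (mxrank1 R n).
by rewrite trmx1 mul1mx mulmx1.
Qed.

Lemma posdefmx_inv n (A : 'M[R]_n) : posdefmx A -> posdefmx (invmx A).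
Proof.
move=> pA; have uA := posdefmx_unit pA; have [sA pA'] := pA.
split; first by rewrite trmx_inv sA.
move=> x x0; have Ax0 : invmx A *m x != 0.
  by apply: contra x0 => /eqP Ax; rewrite -[x](mulKVmx uA) Ax mulmx0.
have := pA' _ Ax0; rewrite trmx_mul trmx_inv sA.
by rewrite -mulmxA (mulKVmx uA).
Qed.

Lemma posdefmx_psd n (A : 'M[R]_n) : posdefmx A -> psdmx A.
Proof.
move=> [sA pA]; split=> // v; have [->|v0] := eqVneq v 0; last exact/ltW/pA.
by rewrite mulmx0 mxE.
Qed.

End positive_definite.

Section measurable_estimators.
Context {R : realType} {d : measure_display} {T : measurableType d}.
Context {n k p : nat} {m q : 'I_k -> nat}.
Variables (X : forall i, 'M[R]_(n, m i)) (Z : forall i, 'M[R]_(p, q i)).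
Variable Y : T -> 'M[R]_(n, p).
Hypothesis mY : measurable_entries Y.

Let mcst a b (C : 'M[R]_(a, b)) : measurable_entries (fun _ : T => C).
Proof. exact: measurable_entries_cst. Qed.

Lemma measurable_Sigma_hat : measurable_entries (fun w => Sigma_hat X (Y w)).
Proof.
apply: measurable_entriesM => //; apply: measurable_entriesM => //.
exact: measurable_entries_tr.
Qed.

Lemma measurable_Theta_hat i : measurable_entries (fun w => Theta_hat X Z (Y w) i).
Proof.
have mS : measurable_entries (fun w => invmx (Sigma_hat X (Y w))).
  exact: measurable_entries_invmx measurable_Sigma_hat.
do 2!apply: measurable_entriesM => //.
apply: measurable_entriesM; first exact: measurable_entriesM.
apply: measurable_entriesM => //; apply: measurable_entriesM; first exact: measurable_entriesM.
apply: measurable_entries_invmx; apply: measurable_entriesM => //.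
exact: measurable_entriesM.
Qed.

End measurable_estimators.

Section finite_sample.
Context {R : realType} {n k p : nat} {m q : 'I_k -> nat}.
Variables (X : forall i, 'M[R]_(n, m i)) (Z : forall i, 'M[R]_(p, q i)).
Variables (Theta : forall i, 'M[R]_(m i, q i)) (E : 'M[R]_(n, p)) (Sigma : 'M[R]_p).
Hypotheses (n_gt0 : (0 < n)%N) (rX : forall i, \rank (X i) = m i)
  (oX : forall i j, i != j -> (X i)^T *m X j = 0)
  (rZ : forall i, \rank (Z i) = q i).

Let G i := (X i)^T *m X i.

Let gram_unit i : G i \in unitmx.
Proof.
by have := posdefmx_gram_unit (@posdefmx1 R n) (rX i); rewrite mulmx1.
Qed.

Let projmxE i : projmx (X i) = X i *m invmx (G i) *m (X i)^T.
Proof. by rewrite /projmx pinvmxE. Qed.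

Let resid_mul i : resid_mx X *m X i = 0.
Proof.
rewrite /resid_mx -scalemxAl mulmxBl mul1mx mulmx_suml (bigD1 i)//= big1 => [|j ji].
  by rewrite projmxE -!mulmxA -/(G i) (mulVmx (gram_unit i)) mulmx1 addr0 subrr scaler0.
by rewrite projmxE -(mulmxA _ (X j)^T) oX// mulmx0.
Qed.

Let tr_mul_resid i : (X i)^T *m resid_mx X = 0.
Proof.
rewrite /resid_mx -scalemxAr mulmxBr mulmx1 mulmx_sumr (bigD1 i)//= big1 => [|j ji].
  by rewrite projmxE !mulmxA mulmxV ?mul1mx ?addr0 ?subrr ?scaler0.
by rewrite projmxE !mulmxA oX ?mul0mx// eq_sym.
Qed.

Let Y := \sum_i X i *m Theta i *m (Z i)^T + E.

(** The moment matrix of the residuals, as a function of the normalized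
    statistics M = n^(-1/2) X'E and N = n^(-1/2) (E'E - n Sigma). *)
Definition Sigma_hat_of (M : forall i, 'M[R]_(m i, p)) (N : 'M[R]_p) : 'M[R]_p :=
  (n%:R - \sum_i (m i)%:R)^-1 *: (n%:R *: Sigma + Num.sqrt n%:R *: N -
    \sum_i (M i)^T *m invmx (n%:R^-1 *: G i) *m M i).

Definition profile_gram (A : 'M[R]_p) i := (Z i)^T *m invmx A *m Z i.

(** The first term vanishes as soon as the profile Gram matrix is invertible. *)
Definition Theta_error_of (M : forall i, 'M[R]_(m i, p)) (A : 'M[R]_p) i : 'M[R]_(m i, q i) :=
  Num.sqrt n%:R *: (Theta i *m (profile_gram A i *m invmx (profile_gram A i) - 1%:M)) +
  invmx (n%:R^-1 *: G i) *m M i *m (invmx A *m Z i *m invmx (profile_gram A i)).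

Let M i := (Num.sqrt n%:R)^-1 *: ((X i)^T *m E).
Let N := (Num.sqrt n%:R)^-1 *: (E^T *m E - n%:R *: Sigma).

Let n0 : n%:R != 0 :> R. Proof. by rewrite pnatr_eq0 -lt0n. Qed.
Let sqrtn0 : Num.sqrt n%:R != 0 :> R.
Proof. by rewrite gt_eqF// sqrtr_gt0 ltr0n. Qed.

Let scaled_gram i : invmx (n%:R^-1 *: G i) = n%:R *: invmx (G i).
Proof. by rewrite invmxZ ?invrK// unitmxZ ?gram_unit// unitfE invr_eq0. Qed.

(** The residual projector annihilates every design matrix on both sides, so
    that only the errors remain in Y' W Y. *)
Lemma Sigma_hatE : Sigma_hat X Y = Sigma_hat_of M N.
Proof.
have DW : (\sum_i X i *m Theta i *m (Z i)^T)^T *m resid_mx X = 0.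
  rewrite linear_sum/= mulmx_suml big1// => i _.
  by rewrite !trmx_mul -!mulmxA tr_mul_resid !mulmx0.
have WD : resid_mx X *m (\sum_i X i *m Theta i *m (Z i)^T) = 0.
  by rewrite mulmx_sumr big1// => i _; rewrite !mulmxA resid_mul !mul0mx.
rewrite /Sigma_hat /Y [(_ + E)^T]linearD/= mulmxDl DW add0r -mulmxA mulmxDr WD add0r.
rewrite /resid_mx /Sigma_hat_of /resid_df (eq_bigr (fun i => (m i)%:R)) => [|i _]; last first.
  by rewrite rX.
rewrite -scalemxAl -scalemxAr; congr (_ *: _).
rewrite mulmxBl mul1mx mulmxBr /N scalerA mulfV// scale1r addrCA subrr addr0; congr (_ - _).
rewrite mulmx_suml mulmx_sumr; apply: eq_bigr => i _.
rewrite projmxE scaled_gram /M [(_ *: _)^T]linearZ/= -!(scalemxAl, scalemxAr) !scalerA.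
have -> : (Num.sqrt n%:R)^-1 * ((Num.sqrt n%:R)^-1 * n%:R) = 1 :> R.
  by rewrite mulrA -invfM -expr2 sqr_sqrtr// mulVf.
by rewrite scale1r trmx_mul trmxK !mulmxA.
Qed.

(** Z_i' Z_i is invertible and cancels, and orthogonality leaves only the i-th
    mean in X_i' Y. The product of the profile Gram matrix with invmx of it
    is kept as such, so that the identity holds for every value of the errors,
    singular estimated covariances included. *)
Lemma Theta_hatE i :
  Num.sqrt n%:R *: (Theta_hat X Z Y i - Theta i) = Theta_error_of M (Sigma_hat X Y) i.
Proof.
have uZ : (Z i)^T *m Z i \in unitmx.
  by have := posdefmx_gram_unit (@posdefmx1 R p) (rZ i); rewrite mulmx1.
have XY : invmx (G i) *m (X i)^T *m Y = Theta i *m (Z i)^T + invmx (G i) *m (X i)^T *m E.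
  rewrite /Y mulmxDr; congr (_ + _).
  rewrite mulmx_sumr (bigD1 i)//= big1 ?addr0 => [|j ji]; last first.
    by rewrite !mulmxA -(mulmxA _ (X i)^T) oX ?mulmx0 ?mul0mx// eq_sym.
  by rewrite !mulmxA -(mulmxA _ (X i)^T) mulVmx ?mul1mx.
rewrite /Theta_hat /H_mx -/(G i) XY.
set S := invmx (Sigma_hat X Y); set D := (Z i)^T *m S *m Z i.
have -> : (Theta i *m (Z i)^T + invmx (G i) *m (X i)^T *m E) *m
    (S *m Z i *m invmx D *m (Z i)^T) *m Z i *m invmx ((Z i)^T *m Z i) =
  (Theta i *m (Z i)^T + invmx (G i) *m (X i)^T *m E) *m (S *m Z i *m invmx D).
  by rewrite -!mulmxA (mulmxA (Z i)^T (Z i)) mulmxV// mulmx1.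
rewrite /Theta_error_of /profile_gram -/S -/D mulmxDl addrAC scalerDr; congr (_ + _).
  by rewrite mulmxBr mulmx1 /D !mulmxA.
rewrite scaled_gram /M -scalemxAl -scalemxAr -!scalemxAl scalerA; congr (_ *: _); last first.
  by rewrite !mulmxA.
by rewrite -[X in X / _]sqr_sqrtr// expr2 mulfK.
Qed.

End finite_sample.

(** * Limits of the estimation errors as functions of the statistics *)

Section limits.
Context {R : realType}.

Lemma inv_sqrt_cvg0 : (Num.sqrt n%:R)^-1 @[n --> \oo] --> (0 : R).
Proof.
have H : (n%:R^-1 : R) @[n --> \oo] --> (0 : R).
  by rewrite -(cvg_shiftS (fun n => n%:R^-1 : R)); exact: cvg_harmonic.
have -> : 0 = Num.sqrt 0 :> R by rewrite sqrtr0.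
under eq_fun do rewrite -sqrtrV//.
apply: (@cvg_comp _ _ _ (fun n => n%:R^-1 : R) Num.sqrt _ (nbhs (0 : R))) => //.
exact: sqrt_continuous.
Qed.

Lemma ratio_cvg1 (c : R) : n%:R / (n%:R - c) @[n --> \oo] --> (1 : R).
Proof.
have H : (1 - c * n%:R^-1)^-1 @[n --> \oo] --> (1 : R).
  have H0 : 1 - c * n%:R^-1 @[n --> \oo] --> (1 - c * 0 : R).
    apply: cvgB; first exact: cvg_cst.
    apply: cvgM; first exact: cvg_cst.
    by rewrite -(cvg_shiftS (fun n => n%:R^-1 : R)); exact: cvg_harmonic.
  rewrite mulr0 subr0 in H0.
  have H1 := cvgV (oner_neq0 R) H0; rewrite invr1 in H1; exact: H1.
apply: cvg_trans H; apply: near_eq_cvg; exists 1%N => // n /= n1.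
have nn : n%:R != 0 :> R by rewrite pnatr_eq0 -lt0n.
have -> : n%:R - c = n%:R * (1 - c * n%:R^-1) by field.
by rewrite invfM mulrA mulfV// mul1r.
Qed.

Lemma sqrt_ratio_cvg0 (c : R) : Num.sqrt n%:R / (n%:R - c) @[n --> \oo] --> (0 : R).
Proof.
have H : n%:R / (n%:R - c) * (Num.sqrt n%:R)^-1 @[n --> \oo] --> (1 * 0 : R).
  by apply: cvgM; [exact: ratio_cvg1|exact: inv_sqrt_cvg0].
rewrite mulr0 in H; apply: cvg_trans H; apply: near_eq_cvg; exists 1%N => // n /= n1.
have nn : Num.sqrt n%:R != 0 :> R by rewrite gt_eqF// sqrtr_gt0 ltr0n.
have ss : n%:R = Num.sqrt n%:R * Num.sqrt n%:R :> R by rewrite -expr2 sqr_sqrtr.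
by rewrite {1}ss mulrAC mulfK.
Qed.

End limits.

Section asymptotic_maps.
Context {R : realType} {k p : nat} {m q : 'I_k -> nat}.
Variables (x : forall i : 'I_k, nat -> 'rV[R]_(m i)) (Z : forall i : 'I_k, 'M[R]_(p, q i)).
Variables (Theta : forall i : 'I_k, 'M[R]_(m i, q i)) (Sigma : 'M[R]_p).
Variable Rlim : forall l : 'I_k, 'M[R]_(m l).
Hypotheses (pS : posdefmx Sigma) (pR : forall l, posdefmx (Rlim l))
  (rZ : forall i, \rank (Z i) = q i).
Hypothesis xlim : forall l : 'I_k,
  (n%:R^-1 *: ((design x n l)^T *m design x n l)) @[n --> \oo] --> Rlim l.

Context {I : Type} (F : set_system I) {FF : Filter F}.
Variables (n_ : I -> nat) (M_ : I -> forall i, 'M[R]_(m i, p)) (N_ : I -> 'M[R]_p).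
Variables (M : forall i, 'M[R]_(m i, p)) (N : 'M[R]_p).
Hypotheses (n_cvg : n_ @ F --> \oo) (M_cvg : forall i, M_ z i @[z --> F] --> M i)
  (N_cvg : N_ @ F --> N).

Let A_ z := Sigma_hat_of (design x (n_ z)) Sigma (M_ z) (N_ z).
Let c : R := \sum_i (m i)%:R.

Let inv_cvg i : invmx ((n_ z)%:R^-1 *: ((design x (n_ z) i)^T *m design x (n_ z) i))
  @[z --> F] --> invmx (Rlim i).
Proof.
apply: cvg_invmx; first exact: posdefmx_unit.
exact: (@cvg_comp _ _ _ n_ (fun n => n%:R^-1 *: ((design x n i)^T *m design x n i))
    _ _ _ n_cvg (@xlim i)).
Qed.

(** The difference between n and the residual degrees of freedom is the constant
    c, so that sqrt n (n / (n - c) - 1) vanishes in the limit; the quadratic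
    correction in M carries a factor sqrt n / (n - c). *)
Lemma Sigma_error_cvg : Num.sqrt (n_ z)%:R *: (A_ z - Sigma) @[z --> F] --> N.
Proof.
pose r z : R := (n_ z)%:R - c.
have r_neq0 : \forall z \near F, r z != 0.
  have : \forall n \near \oo, n%:R - c != 0 :> R.
    apply: filterS (nbhs_infty_gtr c) => n cn.
    by rewrite gt_eqF// subr_gt0.
  exact: n_cvg.
have H : ((n_ z)%:R / r z) *: N_ z + (c * (Num.sqrt (n_ z)%:R / r z)) *: Sigma -
    (Num.sqrt (n_ z)%:R / r z) *: (\sum_i (M_ z i)^T *m
      invmx ((n_ z)%:R^-1 *: ((design x (n_ z) i)^T *m design x (n_ z) i)) *m M_ z i)
    @[z --> F] --> 1 *: N + (c * 0) *: Sigma - 0 *: (\sum_i (M i)^T *m invmx (Rlim i) *m M i).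
  have c1 := @cvg_comp _ _ _ n_ _ _ _ _ n_cvg (ratio_cvg1 c).
  have c2 := @cvg_comp _ _ _ n_ _ _ _ _ n_cvg (sqrt_ratio_cvg0 c).
  apply: cvgB; [apply: cvgD|].
  - by apply: cvgZ.
  - by apply: cvgZ; [apply: cvgM; [exact: cvg_cst|exact: c2]|exact: cvg_cst].
  - apply: cvgZ => //; apply: cvg_entries => a b.
    under eq_fun do rewrite summxE; rewrite summxE.
    apply: cvg_bigsum => i _; apply: cvg_entry.
    by apply: cvg_mulmx => //; apply: cvg_mulmx; [exact: cvg_trmx|exact: inv_cvg].
rewrite scale1r mulr0 !scale0r subr0 addr0 in H.
apply: cvg_trans H; apply: near_eq_cvg; apply: filterS r_neq0 => z rz.
rewrite /A_ /Sigma_hat_of -/c -/(r z).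
set S := \sum_i _; set s := Num.sqrt _.
have ss : (n_ z)%:R = s * s :> R by rewrite -expr2 sqr_sqrtr.
have nr : (n_ z)%:R = r z + c :> R by rewrite subrK.
have key (u v w : R) : (n_ z)%:R / r z * u + c * (s / r z) * v - s / r z * w =
    s * ((r z)^-1 * ((n_ z)%:R * v + s * u - w) - v).
  have -> : c = (n_ z)%:R - r z by rewrite nr addrAC subrr add0r.
  by rewrite ss; move: (r z) rz => r' rz; field.
by apply/matrixP => a b; have := key (N_ z a b) (Sigma a b) (S a b); rewrite !mxE.
Qed.

Lemma Sigma_hat_of_cvg : A_ @ F --> Sigma.
Proof.
have H : (Num.sqrt (n_ z)%:R)^-1 *: (Num.sqrt (n_ z)%:R *: (A_ z - Sigma)) + Sigma
    @[z --> F] --> 0 *: N + Sigma.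
  apply: cvgD; last exact: cvg_cst.
  apply: cvgZ; last exact: Sigma_error_cvg.
  exact: (@cvg_comp _ _ _ n_ _ _ _ _ n_cvg inv_sqrt_cvg0).
rewrite scale0r add0r in H; apply: cvg_trans H; apply: near_eq_cvg.
have : \forall z \near F, (0 < n_ z)%N := n_cvg (nbhs_infty_gt 0).
apply: filterS => z nz; rewrite scalerA mulVf ?scale1r ?subrK//.
by rewrite gt_eqF// sqrtr_gt0 ltr0n.
Qed.

(** Near the limit the profile Gram matrix is invertible, so that the biased
    first term of the estimation error vanishes. *)
Lemma Theta_error_of_cvg i :
  Theta_error_of (design x (n_ z)) Z Theta (M_ z) (A_ z) i @[z --> F] -->
  invmx (Rlim i) *m M i *m
    (invmx Sigma *m Z i *m invmx (profile_gram Z Sigma i)).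
Proof.
have uS := posdefmx_unit pS.
have ug : profile_gram Z Sigma i \in unitmx.
  exact: posdefmx_gram_unit (posdefmx_inv pS) (rZ i).
have cI : invmx (A_ z) @[z --> F] --> invmx Sigma by apply: cvg_invmx => //; exact: Sigma_hat_of_cvg.
have cg : profile_gram Z (A_ z) i @[z --> F] --> profile_gram Z Sigma i.
  apply: cvg_mulmx; last exact: cvg_cst.
  by apply: cvg_mulmx; [exact: cvg_cst|].
have H : invmx ((n_ z)%:R^-1 *: ((design x (n_ z) i)^T *m design x (n_ z) i)) *m M_ z i *m
      (invmx (A_ z) *m Z i *m invmx (profile_gram Z (A_ z) i)) @[z --> F] -->
    invmx (Rlim i) *m M i *m (invmx Sigma *m Z i *m invmx (profile_gram Z Sigma i)).
  apply: cvg_mulmx; first by apply: cvg_mulmx => //; exact: inv_cvg.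
  apply: cvg_mulmx; last exact: cvg_invmx.
  by apply: cvg_mulmx => //; exact: cvg_cst.
apply: cvg_trans H; apply: near_eq_cvg.
have : \forall z \near F, \det (profile_gram Z (A_ z) i) != 0.
  by apply: cvgr_neq0 (cvg_det cg) _; rewrite -unitfE -unitmxE.
apply: filterS => z; rewrite -unitfE -unitmxE => uz.
by rewrite /Theta_error_of mulmxV// subrr mulmx0 scaler0 add0r.
Qed.

End asymptotic_maps.

(** * Covariance matrices and Gaussian random matrices *)

Section tensor_index.

Lemma index_allpairs (S U : eqType) (s : seq S) (t : seq U) a b :
  a \in s -> b \in t ->
  index (a, b) [seq (y, z) | y <- s, z <- t] = (index a s * size t + index b t)%N.
Proof.
elim: s => //= c s IH; rewrite inE eq_sym index_cat size_map => ca bt.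
have pair_inj : injective (pair c : U -> S * U) by move=> ? ? [].
have [->|ac] := eqVneq a c.
  by rewrite map_f// mul0n add0n index_map.
rewrite ifN; last by apply/mapP => -[z _ [E _]]; rewrite E eqxx in ac.
move: ca; rewrite eq_sym (negbTE ac)/= => ca.
by rewrite IH// mulSn addnA.
Qed.

(** Both flattenings enumerate the entries row by row. *)
Lemma mxvec_tens_index m n (i : 'I_m) (j : 'I_n) : mxvec_index i j = mxtens_index (i, j).
Proof.
apply/val_inj => /=.
have rankE (T : finType) (z : T) : enum_rank z = index z (enum T) :> nat.
  have := enum_rankK z; rewrite /enum_val.
  set d := enum_default _ => E; rewrite -{2}E index_uniq ?enum_uniq// -cardE.
  exact: ltn_ord.
rewrite rankE enumT unlock /= /prod_enum index_allpairs ?mem_enum//.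
by rewrite !index_enum_ord size_enum_ord.
Qed.

End tensor_index.

Section covariance.
Context {R : realType} {d : measure_display} {T : measurableType d}.
Variable P : probability T R.

Lemma covariance_centered (f g : T -> R) : summable P f -> summable P g ->
  summable P (fun w => f w * g w) ->
  summable P (fun w => (f w - mean P f) * (g w - mean P g)) /\
  fine (covariance P f g) = mean P (fun w => (f w - mean P f) * (g w - mean P g)).
Proof.
move=> sf sg sfg.
have s : summable P (fun w => (f w - mean P f) * (g w - mean P g)).
  rewrite (_ : (fun w => _) = (fun w => (f w * g w - mean P g * f w) -
    (mean P f * g w - mean P f * mean P g))); last by apply/funext => w; ring.
  apply: summableB; apply: summableB => //; try exact: summableZ.
  exact: summable_cst.
split=> //; by rewrite unlock !expectation_mean.
Qed.

Lemma covariance_mx_form N (X : T -> 'rV[R]_N) (s : 'rV[R]_N) :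
  (forall i, summable P (fun w => X w 0 i)) ->
  (forall i j, summable P (fun w => X w 0 i * X w 0 j)) ->
  (s *m covariance_mx P X *m s^T) 0 0 =
  mean P (fun w => (dotv s (X w) - dotv s (\row_i mean P (fun w => X w 0 i))) ^+ 2).
Proof.
move=> s1 s2.
rewrite (_ : (fun w => _ ^+ 2) = (fun w => \sum_i \sum_j s 0 i * s 0 j *
    ((X w 0 i - mean P (fun w => X w 0 i)) * (X w 0 j - mean P (fun w => X w 0 j))))); last first.
  apply/funext => w; rewrite /dotv -sumrB expr2 mulr_suml; apply: eq_bigr => i _.
  by rewrite mulr_sumr; apply: eq_bigr => j _; rewrite !mxE; ring.
have c i j := covariance_centered (s1 i) (s1 j) (s2 i j).
rewrite mean_sum => [|i _]; last by apply: summable_sum => j _; apply: summableZ; exact: (c i j).1.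
rewrite mxE; under eq_bigr do rewrite mxE mulr_suml.
rewrite exchange_big/=; apply: eq_bigr => i _.
rewrite mean_sum => [|j _]; last by apply: summableZ; exact: (c i j).1.
apply: eq_bigr => j _; rewrite meanZ; last exact: (c i j).1.
by rewrite -(c i j).2 !mxE; ring.
Qed.

Lemma covariance_mx_psd N (X : T -> 'rV[R]_N) :
  (forall i, summable P (fun w => X w 0 i)) ->
  (forall i j, summable P (fun w => X w 0 i * X w 0 j)) ->
  psdmx (covariance_mx P X).
Proof.
move=> s1 s2; split.
  apply/matrixP => i j; rewrite !mxE.
  rewrite (covariance_centered (s1 i) (s1 j) (s2 i j)).2.
  rewrite (covariance_centered (s1 j) (s1 i) (s2 j i)).2.
  by apply: eq_mean => w; rewrite mulrC.
move=> v; have := covariance_mx_form v^T s1 s2; rewrite trmxK => ->.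
by apply: mean_ge0 => w; exact: sqr_ge0.
Qed.

End covariance.

Section matrix_laws.
Context {R : realType}.

Lemma dotv_mxvec m n (A B : 'M[R]_(m, n)) : dotv (mxvec A) (mxvec B) = \tr (A *m B^T).
Proof.
rewrite mxtrace_mul_tr pair_big/= /dotv (reindex _ (curry_mxvec_bij m n))/=.
by apply: eq_bigr => -[i j] _; rewrite !mxvecE.
Qed.

Lemma measurable_entries_mxvec {d} {T : measurableType d} m n (A : T -> 'M[R]_(m, n)) :
  measurable_entries A -> measurable_entries (fun w => mxvec (A w)).
Proof.
move=> mA i j; rewrite (ord1 i); case/mxvec_indexP: j => a b.
by under eq_fun do rewrite mxvecE; exact: mA.
Qed.

Lemma measurable_entries_vec_mx {d} {T : measurableType d} m n (v : T -> 'rV[R]_(m * n)) :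
  measurable_entries v -> measurable_entries (fun w => vec_mx (v w)).
Proof. by move=> mv i j; under eq_fun do rewrite mxE; exact: mv. Qed.

Lemma measurable_entries_row_mx {d} {T : measurableType d} m n1 n2
    (A : T -> 'M[R]_(m, n1)) (B : T -> 'M[R]_(m, n2)) :
  measurable_entries A -> measurable_entries B ->
  measurable_entries (fun w => row_mx (A w) (B w)).
Proof.
move=> mA mB i j; rewrite -[j]splitK; case: (fintype.split j) => l /=.
  by under eq_fun do rewrite row_mxEl; exact: mA.
by under eq_fun do rewrite row_mxEr; exact: mB.
Qed.

(** The matrix law mu is centered Gaussian, v s being the variance of its
    projection on the matrix s. *)
Definition has_characteristic m n (mu : probability (borel_mx R m n) R)
    (v : 'M[R]_(m, n) -> R) : Prop :=
  forall s : 'M[R]_(m, n), gaussian_characteristic mu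
    (fun u : borel_mx R m n => \tr (s *m (u : 'M[R]_(m, n))^T)) (v s).

Let measurable_trace m n (s : 'M[R]_(m, n)) :
  measurable_fun setT (fun u : borel_mx R m n => \tr (s *m (u : 'M[R]_(m, n))^T)).
Proof.
under eq_fun do rewrite mxtrace_mul_tr.
have mid : measurable_entries (fun u : borel_mx R m n => (u : 'M[R]_(m, n))).
  exact/measurable_entriesP/measurable_id.
do 2!apply: measurable_sum => ?.
by apply: measurable_funM => //; exact: mid.
Qed.

Let law_characteristic {d} {T : measurableType d} (Q : probability T R) m n
    (X : T -> 'M[R]_(m, n)) (v : 'M[R]_(m, n) -> R) : measurable_entries X ->
  (forall s, gaussian_characteristic Q (fun w => \tr (s *m (X w)^T)) (v s)) ->
  exists mu : probability (borel_mx R m n) R, has_characteristic mu v.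
Proof.
move=> mX Xv; have [mu [_ muE]] := matrix_law_exists Q mX.
exists mu => s theta; rewrite muE ?Xv//.
by apply: bounded_measurable_cos; apply: measurable_funD => //; exact: measurable_trace.
Qed.

Lemma gaussian_matrix_exists m n (V : 'M[R]_(m * n)) : psdmx V ->
  exists mu : probability (borel_mx R m n) R,
    has_characteristic mu (fun s => (mxvec s *m V *m (mxvec s)^T) 0 0).
Proof.
move=> pV; have [d [T [Q [G [mG GE]]]]] := gaussian_vector_exists pV.
apply: (@law_characteristic _ _ Q _ _ (fun w => vec_mx (G w))).
  exact: measurable_entries_vec_mx.
by move=> s; under eq_fun do rewrite -dotv_mxvec vec_mxK; exact: GE.
Qed.

(** The law of B G C for a matrix G with independent standard normal entries. *)
Lemma linear_gaussian_exists m n a b (B : 'M[R]_(m, a)) (C : 'M[R]_(b, n)) :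
  exists mu : probability (borel_mx R m n) R,
    has_characteristic mu (fun s => \tr (s *m (C^T *m C) *m s^T *m (B *m B^T))).
Proof.
have [d [T [Q [G [mG GE]]]]] := @standard_normal_vector R (a * b).
apply: (@law_characteristic _ _ Q _ _ (fun w => B *m vec_mx (G w) *m C)).
  apply: measurable_entriesM; last exact: measurable_entries_cst.
  apply: measurable_entriesM; first exact: measurable_entries_cst.
  exact: measurable_entries_vec_mx.
move=> s; pose s' := B^T *m s *m C^T.
have E w : \tr (s *m (B *m vec_mx (G w) *m C)^T) = dotv (mxvec s') (G w).
  rewrite -[G w in RHS]vec_mxK dotv_mxvec !trmx_mul.
  by rewrite !mulmxA mxtrace_mulC !mulmxA.
under eq_fun do rewrite E.
have -> : \tr (s *m (C^T *m C) *m s^T *m (B *m B^T)) = dotv (mxvec s') (mxvec s').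
  by rewrite dotv_mxvec !trmx_mul !trmxK !mulmxA [LHS]mxtrace_mulC !mulmxA.
exact: GE.
Qed.

Lemma dotv_row_mx n1 n2 (s1 u1 : 'rV[R]_n1) (s2 u2 : 'rV[R]_n2) :
  dotv (row_mx s1 s2) (row_mx u1 u2) = dotv s1 u1 + dotv s2 u2.
Proof.
rewrite /dotv big_split_ord/=; congr (_ + _); apply: eq_bigr => j _.
  by rewrite !row_mxEl.
by rewrite !row_mxEr.
Qed.

Lemma product_characteristic m n m' n' (mu : probability (borel_mx R m n) R)
    (nu : probability (borel_mx R m' n') R) v v' :
  has_characteristic mu v -> has_characteristic nu v' ->
  forall (s : 'M[R]_(m, n)) (s' : 'M[R]_(m', n')),
  gaussian_characteristic (mu \x nu)%E (fun z : borel_mx R m n * borel_mx R m' n' =>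
    \tr (s *m (z.1 : 'M[R]_(m, n))^T) + \tr (s' *m (z.2 : 'M[R]_(m', n'))^T)) (v s + v' s').
Proof.
move=> muv nuv s s'.
exact: gaussian_characteristic_prod (@measurable_trace m n s) (@measurable_trace m' n' s') (muv s) (nuv s').
Qed.

End matrix_laws.

(** * The central limit theorem for the statistics *)

Section averages.
Context {R : realType}.

Lemma cvg_upper_bound (u : nat -> R) (L : R) : u @ \oo --> L ->
  exists C, forall n, u n <= C.
Proof.
move=> uL; have : \forall n \near \oo, u n <= L + 1.
  by apply: (cvgr_le L) => //; rewrite ltrDl.
move=> [N _ uN]; exists (`|L + 1| + \sum_(t < N) `|u t|) => n.
have s0 : 0 <= \sum_(t < N) `|u t| by exact: sumr_ge0.
have [nN|Nn] := ltnP n N; last first.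
  by have := uN n Nn; have := ler_norm (L + 1); rewrite /=; lra.
apply: (le_trans (ler_norm _)); rewrite (bigD1 (Ordinal nN))//=.
have s1 : 0 <= \sum_(t < N | t != Ordinal nN) `|u t| by exact: sumr_ge0.
by have := normr_ge0 (L + 1); lra.
Qed.

(** When the Cesaro means of a nonnegative sequence converge, none of the first
    n terms is comparable with n: the last of them is a difference of two
    consecutive partial sums. *)
Lemma average_small (a : nat -> R) (L : R) : (forall t, 0 <= a t) ->
  n%:R^-1 * (\sum_(t < n) a t) @[n --> \oo] --> L ->
  forall eps, 0 < eps -> \forall n \near \oo, forall t, (t < n)%N -> a t <= eps * n%:R.
Proof.
move=> a0 aL eps eps0.
pose s n := n%:R^-1 * (\sum_(t < n) a t) : R.
have aE n : a n / n.+1%:R = s n.+1 - s n + s n * n.+1%:R^-1.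
  have [->|n0] := posnP n.
    by rewrite /s big_ord_recr/= !big_ord0 mulr0 mul0r add0r subr0 addr0 mulrC.
  rewrite /s big_ord_recr/= -(natr1 n).
  have n1 : n%:R != 0 :> R by rewrite pnatr_eq0 -lt0n.
  have n2 : n%:R + 1 != 0 :> R by rewrite natr1 pnatr_eq0.
  by field; rewrite n1 n2.
have lim0 : a n / n.+1%:R @[n --> \oo] --> 0.
  have -> : 0 = L - L + L * 0 :> R by ring.
  under eq_fun do rewrite aE.
  apply: cvgD; last by apply: cvgM; [exact: aL|exact: cvg_harmonic].
  apply: cvgB; last exact: aL.
  by rewrite (cvg_shiftS s).
have /cvgr0Pnorm_le /(_ _ eps0) [N _ aN] := lim0.
pose B := \sum_(t < N) a t.
have B0 : 0 <= B by exact: sumr_ge0.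
exists (Num.truncn (B / eps)).+1 => // n /= Bn t tn.
have Ben : B <= eps * n%:R.
  rewrite mulrC -ler_pdivrMr// ltW// (lt_le_trans (Num.Theory.truncnS_gt _))//.
  by rewrite ler_nat.
have [tN|Nt] := ltnP t N.
  apply: le_trans Ben; rewrite /B (bigD1 (Ordinal tN))//= lerDl.
  exact: sumr_ge0.
have := aN t Nt; rewrite /= ger0_norm ?divr_ge0// ler_pdivrMr// => /le_trans; apply.
by rewrite ler_wpM2l ?ler_nat// ltW.
Qed.

Lemma trmul_rows n p (A B : 'M[R]_(n, p)) :
  \tr (A *m B^T) = \sum_t (row t A *m (row t B)^T) 0 0.
Proof.
apply: eq_bigr => t _; rewrite !mxE; apply: eq_bigr => j _.
by rewrite !mxE.
Qed.

Lemma norm_bilinear_le m n (u : 'rV[R]_m) (A : 'M[R]_(m, n)) (v : 'rV[R]_n) al be :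
  (forall i, `|u 0 i| <= al) -> (forall j, `|v 0 j| <= be) ->
  `|(u *m A *m v^T) 0 0| <= al * be * (\sum_i \sum_j `|A i j|).
Proof.
move=> ua vb; rewrite mxE.
under eq_bigr do rewrite mxE mulr_suml.
rewrite exchange_big/= (le_trans (ler_norm_sum _ _ _))// mulr_sumr ler_sum// => i _.
rewrite (le_trans (ler_norm_sum _ _ _))// mulr_sumr ler_sum// => j _.
rewrite !mxE !normrM mulrAC ler_wpM2r//.
by apply: ler_pM.
Qed.

Lemma cvg_mxtrace {I : Type} (F : set_system I) {FF : Filter F} n
    (A : I -> 'M[R]_n) (a : 'M[R]_n) :
  A @ F --> a -> \tr (A x) @[x --> F] --> \tr a.
Proof. by move=> Aa; apply: cvg_bigsum => i _; exact: cvg_entry. Qed.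

End averages.

Section growth_curve_limit.
Context {R : realType} {d : measure_display} {T : measurableType d}.
Variables (P : probability T R) (k p : nat) (m : 'I_k -> nat) (n0 : nat).
Variables (x : forall i : 'I_k, nat -> 'rV[R]_(m i)) (e : nat -> T -> 'rV[R]_p).
Variables (Sigma : 'M[R]_p) (Rlim : forall l : 'I_k, 'M[R]_(m l)).
Hypotheses (me : forall t, measurable_fun setT (e t : T -> borel_mx R 1 p))
  (ie : mutually_independent P (e : nat -> T -> borel_mx R 1 p))
  (de : identically_distributed P (e : nat -> T -> borel_mx R 1 p)).
Hypothesis xlim : forall l : 'I_k,
  (n%:R^-1 *: ((design x n l)^T *m design x n l)) @[n --> \oo] --> Rlim l.
Hypothesis xorth : forall n i j, (n0 <= n)%N -> i != j ->
  (design x n i)^T *m design x n j = 0.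

Hypotheses (e4 : summable P (fun w => dotv (e 0%N w) (e 0%N w) ^+ 2))
  (e1 : forall a, mean P (fun w => e 0%N w 0 a) = 0)
  (e2 : forall a b, mean P (fun w => e 0%N w 0 a * e 0%N w 0 b) = Sigma a b)
  (e3 : forall a b c, mean P (fun w => e 0%N w 0 a * e 0%N w 0 b * e 0%N w 0 c) = 0).
Hypothesis Sigma_sym : Sigma^T = Sigma.

(** Every linear functional of the normalized sufficient statistics
    n^(-1/2) X_i'E and n^(-1/2) (E'E - n Sigma) is a sum over the rows of E of
    such a score, affine in the design and quadratic in the error. *)
Definition score (s : forall i, 'M[R]_(m i, p)) (S : 'M[R]_p) (t : nat) (v : 'rV[R]_p) : R :=
  \sum_i (x i t *m s i *m v^T) 0 0 + ((v *m S *m v^T) 0 0 - \tr (S *m Sigma)).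

Definition quadratic_variance (S : 'M[R]_p) : R :=
  mean P (fun w => ((e 0%N w *m S *m (e 0%N w)^T) 0 0 - \tr (S *m Sigma)) ^+ 2).

Definition linear_variance (s : forall i, 'M[R]_(m i, p)) : R :=
  \sum_i \tr (s i *m Sigma *m (s i)^T *m Rlim i).

Let dotv_ge0 n (v : 'rV[R]_n) : 0 <= dotv v v.
Proof. by apply: sumr_ge0 => a _; rewrite -expr2 sqr_ge0. Qed.

Let entry_le (v : 'rV[R]_p) a : `|v 0 a| <= Num.sqrt (1 + dotv v v).
Proof.
rewrite -[leLHS]ger0_norm// -sqrtr_sqr ler_wsqrtr// real_normK ?num_real//.
rewrite /dotv (bigD1 a)//= expr2 addrCA lerDl addr_ge0//.
by apply: sumr_ge0 => b _; rewrite -expr2 sqr_ge0.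
Qed.

Let entry_le' (v : 'rV[R]_p) a : `|v 0 a| <= 1 + dotv v v.
Proof.
apply: le_trans (entry_le v a) _; set y := 1 + _.
have y1 : 1 <= y by rewrite lerDl.
rewrite -[leRHS]ger0_norm ?(le_trans ler01)// -sqrtr_sqr ler_wsqrtr//.
by rewrite expr2 ler_peMr// (le_trans ler01).
Qed.

Let mentry a : measurable_fun setT (fun v : borel_mx R 1 p => v 0 a).
Proof. by have /measurable_entriesP := @measurable_id _ (borel_mx R 1 p) setT; apply. Qed.

Let msqnorm : measurable_fun setT (fun v : borel_mx R 1 p => dotv (v : 'rV[R]_p) v).
Proof. by apply: measurable_sum => a; exact: measurable_funM. Qed.

Let summable_quartic (f : borel_mx R 1 p -> R) C : measurable_fun setT f ->
  (forall v, `|f v| <= C * (1 + dotv v v) ^+ 2) -> summable P (fun w => f (e 0%N w)).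
Proof.
move=> mf fC.
apply: (@summable_le _ _ _ _ _ (fun w => 2 * `|C| * (1 + dotv (e 0%N w) (e 0%N w) ^+ 2))).
- exact: measurableT_comp mf (me 0).
- move=> w; apply: le_trans (fC _) _; set y := dotv _ _.
  apply: (@le_trans _ _ (`|C| * (1 + y) ^+ 2)).
    by rewrite ler_wpM2r ?sqr_ge0// ler_norm.
  rewrite [2 * _]mulrC -mulrA ler_wpM2l//.
  by have := sqr_ge0 (y - 1); nra.
- by apply: summableZ; apply: summableD => //; exact: summable_cst.
Qed.

(* Dominates the squares of all the entries of the design in row t. *)
Let weight (t : nat) : R := 1 + \sum_i dotv (x i t) (x i t).

Let weight_ge1 t : 1 <= weight t.
Proof. by rewrite lerDl; apply: sumr_ge0. Qed.

Let design_le i t r : `|x i t 0 r| <= Num.sqrt (weight t).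
Proof.
rewrite -[leLHS]ger0_norm// -sqrtr_sqr ler_wsqrtr// real_normK ?num_real//.
rewrite /weight (bigD1 i)//= {1}/dotv (bigD1 r)//= expr2.
set y := _ * _; rewrite addrCA -addrA lerDl !addr_ge0//; apply: sumr_ge0 => // a _.
by rewrite -expr2 sqr_ge0.
Qed.

Let weight_cvg : n%:R^-1 * (\sum_(t < n) weight t) @[n --> \oo] -->
  1 + \sum_i \tr (Rlim i).
Proof.
have H : 1 + \sum_i \tr (n%:R^-1 *: ((design x n i)^T *m design x n i)) @[n --> \oo] -->
    1 + \sum_i \tr (Rlim i).
  apply: cvgD; first exact: cvg_cst.
  by apply: cvg_bigsum => i _; apply: cvg_mxtrace; exact: xlim.
apply: cvg_trans H; apply: near_eq_cvg.
exists 1%N => // n /= n1.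
have nn : n%:R != 0 :> R by rewrite pnatr_eq0 -lt0n.
rewrite big_split/= sumr_const card_ord mulrDr mulVf//; congr (_ + _).
rewrite exchange_big/= mulr_sumr; apply: eq_bigr => i _.
rewrite mxtraceZ mxtrace_mulC trmul_rows; congr (_ * _).
by apply: eq_bigr => t _; rewrite rowK dotv_mx.
Qed.

Let score_const s S : R := \sum_i \sum_a \sum_b `|(s i : 'M[R]_(m i, p)) a b| +
  \sum_a \sum_b `|(S : 'M[R]_p) a b| + `|\tr (S *m Sigma)|.

Let score_const_ge0 s S : 0 <= score_const s S.
Proof.
rewrite !addr_ge0//; first by do 3!apply: sumr_ge0 => ? _.
by do 2!apply: sumr_ge0 => ? _.
Qed.

(* The domination required by Lindeberg's theorem, with weights that depend on
   the design only. *)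
Let score_le s S t v :
  `|score s S t v| <= Num.sqrt (weight t) * (score_const s S * (1 + dotv v v)).
Proof.
have w1 : 1 <= Num.sqrt (weight t) by rewrite -[leLHS]sqrtr1 ler_wsqrtr.
have v1 : 1 <= 1 + dotv v v by rewrite lerDl.
have wv1 : 1 <= Num.sqrt (weight t) * (1 + dotv v v).
  by rewrite (le_trans w1)// ler_peMr// (le_trans ler01).
have lin : `|\sum_i (x i t *m s i *m v^T) 0 0| <=
    Num.sqrt (weight t) * (1 + dotv v v) * (\sum_i \sum_a \sum_b `|s i a b|).
  rewrite (le_trans (ler_norm_sum _ _ _))// mulr_sumr ler_sum// => i _.
  by apply: norm_bilinear_le => r; [exact: design_le|exact: entry_le'].
have quad : `|(v *m S *m v^T) 0 0| <=
    Num.sqrt (weight t) * (1 + dotv v v) * (\sum_a \sum_b `|S a b|).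
  apply: (@le_trans _ _ ((1 + dotv v v) * (\sum_a \sum_b `|S a b|))).
    rewrite -[1 + dotv v v]sqr_sqrtr ?(le_trans ler01)// expr2.
    by apply: norm_bilinear_le => r; exact: entry_le.
  rewrite ler_wpM2r//; first by do 2!apply: sumr_ge0 => ? _.
  by rewrite ler_peMl// (le_trans ler01).
have cst : `|\tr (S *m Sigma)| <=
    Num.sqrt (weight t) * (1 + dotv v v) * `|\tr (S *m Sigma)|.
  by rewrite ler_peMl.
move: (1 + dotv v v) lin quad cst => y lin quad cst.
rewrite /score_const [_ * y]mulrC mulrA !mulrDr -addrA.
apply: (le_trans (ler_normD _ _)); apply: lerD => //.
by apply: (le_trans (ler_normB _ _)); apply: lerD.
Qed.

Let mscore s S t : measurable_fun setT (fun v : borel_mx R 1 p => score s S t v).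
Proof.
have mid : measurable_entries (fun v : borel_mx R 1 p => (v : 'rV[R]_p)).
  by move=> i j; rewrite (ord1 i); exact: mentry.
apply: measurable_funD.
  apply: measurable_sum => i; apply: measurable_entriesM.
    exact: measurable_entries_cst.
  exact: measurable_entries_tr.
apply: measurable_funB; last exact: measurable_cst.
apply: measurable_entriesM; last exact: measurable_entries_tr.
by apply: measurable_entriesM => //; exact: measurable_entries_cst.
Qed.

Let summable1 a : summable P (fun w => e 0%N w 0 a).
Proof.
apply: (@summable_quartic (fun v => v 0 a) 1); first exact: mentry.
move=> v; apply: (le_trans (entry_le' v a)); rewrite mul1r expr2.
by rewrite ler_peMr ?lerDl// addr_ge0.
Qed.

Lemma summable_entry2 a b : summable P (fun w => e 0%N w 0 a * e 0%N w 0 b).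
Proof.
apply: (@summable_quartic (fun v => v 0 a * v 0 b) 1); first exact: measurable_funM.
by move=> v; rewrite mul1r normrM expr2 ler_pM//; exact: entry_le'.
Qed.

Lemma summable_entry4 a b c l :
  summable P (fun w => e 0%N w 0 a * e 0%N w 0 b * (e 0%N w 0 c * e 0%N w 0 l)).
Proof.
have le2 (v : 'rV[R]_p) i j : `|v 0 i * v 0 j| <= 1 + dotv v v.
  rewrite normrM -[leRHS]sqr_sqrtr ?addr_ge0// expr2.
  by apply: ler_pM => //; exact: entry_le.
apply: (@summable_quartic (fun v => v 0 a * v 0 b * (v 0 c * v 0 l)) 1).
  by apply: measurable_funM; exact: measurable_funM.
by move=> v; rewrite mul1r normrM expr2; apply: ler_pM; rewrite ?le2.
Qed.

Let summable2 a b : summable P (fun w => e 0%N w 0 a * e 0%N w 0 b).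
Proof. exact: summable_entry2. Qed.

Let summable3 a b c : summable P (fun w => e 0%N w 0 a * e 0%N w 0 b * e 0%N w 0 c).
Proof.
apply: (@summable_quartic (fun v => v 0 a * v 0 b * v 0 c) 1).
  by apply: measurable_funM => //; exact: measurable_funM.
move=> v; rewrite mul1r normrM expr2; apply: ler_pM => //.
rewrite normrM -[leRHS]sqr_sqrtr ?addr_ge0// expr2.
by apply: ler_pM => //; exact: entry_le.
Qed.

Let linE (s : forall i, 'M[R]_(m i, p)) t (v : 'rV[R]_p) :
  \sum_i (x i t *m s i *m v^T) 0 0 = \sum_b (\sum_i x i t *m s i) 0 b * v 0 b.
Proof.
rewrite -/(dotv _ v) dotv_mx mulmx_suml summxE.
by [].
Qed.

Let quadE (S : 'M[R]_p) (v : 'rV[R]_p) :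
  (v *m S *m v^T) 0 0 = \sum_a \sum_b S a b * (v 0 a * v 0 b).
Proof.
rewrite exchange_big mxE; apply: eq_bigr => b _; rewrite !mxE mulr_suml.
by apply: eq_bigr => a _; ring.
Qed.

Let traceE (S : 'M[R]_p) : \tr (S *m Sigma) = \sum_a \sum_b S a b * Sigma a b.
Proof.
by apply: eq_bigr => a _; rewrite mxE; apply: eq_bigr => b _; rewrite -{1}Sigma_sym mxE.
Qed.

Let squad S : summable P (fun w => (e 0%N w *m S *m (e 0%N w)^T) 0 0).
Proof.
under eq_fun do rewrite quadE.
by apply: summable_sum => a _; apply: summable_sum => b _; exact: summableZ.
Qed.

Let slin s t : summable P (fun w => \sum_i (x i t *m s i *m (e 0%N w)^T) 0 0).
Proof.
under eq_fun do rewrite linE.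
by apply: summable_sum => b _; exact: summableZ.
Qed.

Let mean_quad S : mean P (fun w => (e 0%N w *m S *m (e 0%N w)^T) 0 0) = \tr (S *m Sigma).
Proof.
under eq_fun do rewrite quadE.
rewrite mean_sum ?traceE => [|a _]; last by apply: summable_sum => b _; exact: summableZ.
apply: eq_bigr => a _; rewrite mean_sum => [|b _]; last exact: summableZ.
by apply: eq_bigr => b _; rewrite meanZ// e2.
Qed.

Let mean_lin s t : mean P (fun w => \sum_i (x i t *m s i *m (e 0%N w)^T) 0 0) = 0.
Proof.
under eq_fun do rewrite linE.
rewrite mean_sum => [|b _]; last exact: summableZ.
by rewrite big1// => b _; rewrite meanZ// e1 mulr0.
Qed.

Let mean_score s S t : mean P (fun w => score s S t (e 0%N w)) = 0.
Proof.
have sq := squad S; have sl := slin s t.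
have sc := summable_cst P (\tr (S *m Sigma)).
rewrite meanD//; last exact: summableB.
by rewrite mean_lin meanB// mean_cst mean_quad subrr addr0.
Qed.

Let coef (s : forall i, 'M[R]_(m i, p)) t : 'rV[R]_p := \sum_i x i t *m s i.

Let summable_score2 s S t : summable P (fun w => score s S t (e 0%N w) ^+ 2).
Proof.
apply: (@summable_quartic (fun v => score s S t v ^+ 2)
  ((Num.sqrt (weight t) * score_const s S) ^+ 2)).
  exact: measurable_funX.
move=> v; rewrite -exprMn normrX lerXn2r ?nnegrE//; last first.
  by rewrite -mulrA; exact: score_le.
by rewrite !mulr_ge0// addr_ge0.
Qed.

(** The third moments vanish, so the linear and the quadratic parts of a score
    are uncorrelated. *)
Let mean_score2 s S t : mean P (fun w => score s S t (e 0%N w) ^+ 2) =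
  (coef s t *m Sigma *m (coef s t)^T) 0 0 + quadratic_variance S.
Proof.
pose l w := dotv (coef s t) (e 0%N w).
pose q w := (e 0%N w *m S *m (e 0%N w)^T) 0 0.
pose c := \tr (S *m Sigma).
have ql w : l w * q w = \sum_b \sum_a \sum_a' coef s t 0 b * S a a' *
    (e 0%N w 0 b * e 0%N w 0 a * e 0%N w 0 a').
  rewrite /q quadE mulr_suml; apply: eq_bigr => b _.
  rewrite mulr_sumr; apply: eq_bigr => a _; rewrite mulr_sumr.
  by apply: eq_bigr => a' _; ring.
have ll w : l w * l w = \sum_b \sum_a coef s t 0 b * coef s t 0 a *
    (e 0%N w 0 b * e 0%N w 0 a).
  rewrite mulr_suml; apply: eq_bigr => b _; rewrite mulr_sumr.
  by apply: eq_bigr => a _; ring.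
have sl : summable P l by apply: summable_sum => b _; exact: summableZ.
have sq : summable P q by exact: squad.
have slq : summable P (fun w => l w * q w).
  under eq_fun do rewrite ql.
  by do 3!apply: summable_sum => ? _; exact: summableZ.
have sll : summable P (fun w => l w * l w).
  under eq_fun do rewrite ll.
  by do 2!apply: summable_sum => ? _; exact: summableZ.
have sqq : summable P (fun w => (q w - c) ^+ 2).
  rewrite (_ : (fun w => _) = (fun w => score (fun=> 0) S 0 (e 0%N w) ^+ 2)).
    exact: summable_score2.
  apply/funext => w; rewrite /score big1 ?add0r// => i _.
  by rewrite mulmx0 mul0mx mxE.
have l0 : mean P l = 0.
  rewrite -(mean_lin s t); apply: eq_mean => w; exact/esym/linE.
have lq0 : mean P (fun w => l w * q w) = 0.
  under eq_fun do rewrite ql.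
  rewrite mean_sum => [|b _]; last by do 2!apply: summable_sum => ? _; exact: summableZ.
  rewrite big1// => b _.
  rewrite mean_sum => [|a _]; last by apply: summable_sum => ? _; exact: summableZ.
  rewrite big1// => a _; rewrite mean_sum => [|a' _]; last exact: summableZ.
  by rewrite big1// => a' _; rewrite meanZ// e3 mulr0.
have ll0 : mean P (fun w => l w * l w) = (coef s t *m Sigma *m (coef s t)^T) 0 0.
  under eq_fun do rewrite ll.
  rewrite mean_sum => [|b _]; last by apply: summable_sum => ? _; exact: summableZ.
  rewrite quadE; apply: eq_bigr => b _; rewrite mean_sum => [|a _]; last exact: summableZ.
  by apply: eq_bigr => a _; rewrite meanZ// e2 mulrC.
rewrite (_ : (fun w => _) =
    (fun w => l w * l w + (2 * (l w * q w) - 2 * c * l w) + (q w - c) ^+ 2)).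
  rewrite meanD//; last first.
    by apply: summableD => //; apply: summableB; exact: summableZ.
  rewrite meanD//; last by apply: summableB; exact: summableZ.
  rewrite meanB//; [|exact: summableZ|exact: summableZ].
  by rewrite !meanZ// lq0 l0 ll0 !mulr0 subrr addr0.
apply/funext => w; rewrite /score linE -/(dotv _ _) -/(l w) -/(q w) -/c; ring.
Qed.

(* Only the diagonal blocks survive, because the designs are orthogonal. *)
Let mean_coef_cvg s :
  n%:R^-1 * (\sum_(t < n) (coef s t *m Sigma *m (coef s t)^T) 0 0) @[n --> \oo] -->
  linear_variance s.
Proof.
pose K i j := s i *m Sigma *m (s j)^T.
have cK t : (coef s t *m Sigma *m (coef s t)^T) 0 0 =
    \sum_i \sum_j (x i t *m K i j *m (x j t)^T) 0 0.
  rewrite /coef linear_sum/= !mulmx_suml summxE; apply: eq_bigr => i _.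
  rewrite mulmx_sumr summxE; apply: eq_bigr => j _.
  by rewrite /K trmx_mul !mulmxA.
have H : \sum_i \tr (K i i *m (n%:R^-1 *: ((design x n i)^T *m design x n i)))
    @[n --> \oo] --> linear_variance s.
  apply: cvg_bigsum => i _; apply: cvg_mxtrace; apply: cvg_mulmx; first exact: cvg_cst.
  exact: xlim.
apply: cvg_trans H; apply: near_eq_cvg.
exists n0 => // n /= n0n.
under [in RHS]eq_bigr do rewrite cK.
rewrite exchange_big/= mulr_sumr; apply: eq_bigr => i _.
rewrite exchange_big/= (bigD1 i)//= [X in _ + X]big1 ?addr0 => [|j ji].
  rewrite -scalemxAr mxtraceZ; congr (_ * _).
  rewrite mulmxA mxtrace_mulC mulmxA trmul_rows; apply: eq_bigr => t _.
  by rewrite row_mul !rowK.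
transitivity (\tr (design x n i *m K i j *m (design x n j)^T)).
  by rewrite trmul_rows; apply: eq_bigr => t _; rewrite row_mul !rowK.
by rewrite -mulmxA mxtrace_mulC -mulmxA xorth ?mulmx0 ?raddf0// eq_sym.
Qed.

Let variance_cvg s S : n%:R^-1 * (\sum_(t < n) mean P (fun w => score s S t (e 0%N w) ^+ 2))
    @[n --> \oo] --> linear_variance s + quadratic_variance S.
Proof.
have H : n%:R^-1 * (\sum_(t < n) (coef s t *m Sigma *m (coef s t)^T) 0 0) +
    quadratic_variance S @[n --> \oo] --> linear_variance s + quadratic_variance S.
  by apply: cvgD; [exact: mean_coef_cvg|exact: cvg_cst].
apply: cvg_trans H; apply: near_eq_cvg; exists 1%N => // n /= n1.
have nn : n%:R != 0 :> R by rewrite pnatr_eq0 -lt0n.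
under [in RHS]eq_bigr do rewrite mean_score2.
rewrite big_split/= mulrDr; congr (_ + _).
by rewrite sumr_const card_ord -[quadratic_variance S *+ n]mulr_natr mulrCA mulVf// mulr1.
Qed.

Let weight_sqrt t : Num.sqrt (weight t) ^+ 2 = weight t.
Proof. by rewrite sqr_sqrtr// (le_trans ler01). Qed.

Definition cross_stat (n : nat) (w : T) (i : 'I_k) : 'M[R]_(m i, p) :=
  (Num.sqrt n%:R)^-1 *: ((design x n i)^T *m errors e n w).

Definition square_stat (n : nat) (w : T) : 'M[R]_p :=
  (Num.sqrt n%:R)^-1 *: ((errors e n w)^T *m errors e n w - n%:R *: Sigma).

Definition functional s S n w : R :=
  \sum_i \tr (s i *m (cross_stat n w i)^T) + \tr (S *m (square_stat n w)^T).

Lemma functional_score s S n w :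
  functional s S n w = (\sum_(t < n) score s S t (e t w)) / Num.sqrt n%:R.
Proof.
rewrite /functional big_split/= mulrDl exchange_big/= mulr_suml; congr (_ + _).
  apply: eq_bigr => i _; rewrite /cross_stat linearZ/= -scalemxAr mxtraceZ mulrC.
  congr (_ * _); rewrite trmx_mul trmxK mulmxA mxtrace_mulC mulmxA trmul_rows.
  by apply: eq_bigr => t _; rewrite row_mul !rowK.
rewrite /square_stat linearZ/= -scalemxAr mxtraceZ mulrC; congr (_ * _).
rewrite linearB/= linearZ/= Sigma_sym trmx_mul trmxK mulmxBr linearB/= -scalemxAr mxtraceZ.
rewrite sumrB sumr_const card_ord; congr (_ - _); last by rewrite mulr_natl.
rewrite mulmxA mxtrace_mulC mulmxA trmul_rows.
by apply: eq_bigr => t _; rewrite row_mul !rowK.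
Qed.

Lemma functional_characteristic s S theta :
  mean P (fun w => cos (functional s S n w + theta)) @[n --> \oo] -->
    cos theta * expR (- (linear_variance s + quadratic_variance S) / 2).
Proof.
pose h (v : borel_mx R 1 p) := score_const s S * (1 + dotv (v : 'rV[R]_p) v).
have mh : measurable_fun setT h.
  by apply: measurable_funM => //; apply: measurable_funD.
have h0 v : 0 <= h v by rewrite mulr_ge0// addr_ge0.
have gh t v : `|score s S t v| <= Num.sqrt (weight t) * h v by exact: score_le.
have h2 : summable P (fun w => h (e 0%N w) ^+ 2).
  apply: (@summable_quartic (fun v => h v ^+ 2) (score_const s S ^+ 2)).
    exact: measurable_funX.
  by move=> v; rewrite ger0_norm ?sqr_ge0// /h exprMn.
have [C bC] : exists C, forall n, (\sum_(t < n) Num.sqrt (weight t) ^+ 2) / n%:R <= C.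
  have [C wC] := cvg_upper_bound weight_cvg; exists C => n.
  by under eq_bigr do rewrite weight_sqrt; rewrite mulrC.
have bs eps : 0 < eps -> \forall n \near \oo, forall t, (t < n)%N ->
    Num.sqrt (weight t) <= eps * Num.sqrt n%:R.
  move=> eps0; have w0 t : 0 <= weight t by rewrite (le_trans ler01).
  have := average_small w0 weight_cvg (exprn_gt0 2 eps0).
  apply: filterS => n wn t tn.
  apply: (@le_trans _ _ (Num.sqrt (eps ^+ 2 * n%:R))).
    by rewrite ler_wsqrtr//; exact: wn.
  by rewrite sqrtrM ?sqr_ge0// sqrtr_sqr ger0_norm// ltW.
under eq_fun do under eq_fun do rewrite functional_score.
exact: (@lindeberg R _ _ T (borel_mx R 1 p) P e me ie de (score s S) h
  (fun t => Num.sqrt (weight t)) (mscore s S) mh h0 (fun t => sqrtr_ge0 _) gh h2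
  (mean_score s S) _ (@variance_cvg s S) C bC bs).
Qed.

Lemma functional_second_moment s S : exists C, forall n,
  summable P (fun w => functional s S n w ^+ 2) /\
  mean P (fun w => functional s S n w ^+ 2) <= C.
Proof.
have [C vC] := cvg_upper_bound (@variance_cvg s S); exists C => n.
have [sS mS] := @mean_sqr_sum R _ _ T (borel_mx R 1 p) P e me ie de (score s S) n
  (mscore s S) (summable_score2 s S) (mean_score s S).
have -> : (fun w => functional s S n w ^+ 2) =
    (fun w => n%:R^-1 * (\sum_(t < n) score s S t (e t w)) ^+ 2).
  by apply/funext => w; rewrite functional_score exprMn exprVn sqr_sqrtr// mulrC.
split; first exact: summableZ.
by rewrite meanZ// mS.
Qed.

Definition statistics n w : 'rV[R]_#|{: @stat_index k p m}| :=
  pack (cross_stat n w) (square_stat n w).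

Lemma measurable_errors n : measurable_entries (errors e n).
Proof.
move=> t j; under eq_fun do rewrite mxE.
by have /measurable_entriesP := me t; apply.
Qed.

Lemma measurable_statistics n : measurable_entries (statistics n).
Proof.
move=> i j; rewrite (ord1 i); under eq_fun do rewrite mxE.
have mE := @measurable_errors n.
case: (enum_val j) => [[[l r] b]|[a b]] /=.
  apply: measurable_entriesZ; first exact: measurable_cst.
  by apply: measurable_entriesM => //; exact: measurable_entries_cst.
apply: measurable_entriesZ; first exact: measurable_cst.
apply: measurable_entriesB; last exact: measurable_entries_cst.
by apply: measurable_entriesM => //; exact: measurable_entries_tr.
Qed.

(** Functions of the statistics that converge continuously to a linear map
    inherit its Gaussian limit; adj_s and adj_S describe the adjoint map. *)
Lemma statistics_limit_law N' (F_ : nat -> 'rV[R]_#|{: @stat_index k p m}| -> 'rV[R]_N')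
    (F : 'rV[R]_#|{: @stat_index k p m}| -> 'rV[R]_N')
    (adj_s : 'rV[R]_N' -> forall i, 'M[R]_(m i, p)) (adj_S : 'rV[R]_N' -> 'M[R]_p)
    (X : nat -> T -> 'rV[R]_N')
    {d'} {T' : measurableType d'} (Q : probability T' R) (W : T' -> 'rV[R]_N') :
  continuous F -> (forall u, F_ z.2 z.1 @[z --> (nbhs u, \oo)] --> F u) ->
  (forall s u, dotv s (F u) = \sum_i \tr (adj_s s i *m (linear_part i u)^T) +
    \tr (adj_S s *m (quadratic_part u)^T)) ->
  (forall n, measurable_entries (X n)) ->
  (\forall n \near \oo, forall w, X n w = F_ n (statistics n w)) ->
  measurable_entries W ->
  (forall s, gaussian_characteristic Q (fun w => dotv s (W w))
    (linear_variance (adj_s s) + quadratic_variance (adj_S s))) ->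
  forall (f : 'rV[R]_N' -> R) (B : R), continuous f -> (forall v, `|f v| <= B) ->
  mean P (f \o X n) @[n --> \oo] --> mean Q (f \o W).
Proof.
move=> cF F_F adjE mX XE mW WE f B cf fB.
have partsE s n w : dotv s (statistics n w) = functional
    (fun i => linear_part i s) (quadratic_part s) n w.
  rewrite dotv_parts quadratic_part_pack; congr (_ + _).
  by apply: eq_bigr => i _; rewrite linear_part_pack.
have FE s n w : dotv s (F (statistics n w)) = functional (adj_s s) (adj_S s) n w.
  rewrite adjE quadratic_part_pack; congr (_ + _).
  by apply: eq_bigr => i _; rewrite linear_part_pack.
have deltaE N0 (u : 'rV[R]_N0) j : dotv (delta_mx 0 j) u = u 0 j.
  by rewrite -[delta_mx _ _]scale1r dotv_delta mul1r.
have [C UC] : exists C : 'I_#|{: @stat_index k p m}| -> R, forall j n,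
    summable P (fun w => statistics n w 0 j ^+ 2) /\
    mean P (fun w => statistics n w 0 j ^+ 2) <= C j.
  apply: (@fin_all_exists _ (fun=> R) (fun j c => forall n,
    summable P (fun w => statistics n w 0 j ^+ 2) /\
    mean P (fun w => statistics n w 0 j ^+ 2) <= c)) => j.
  have [C H] := functional_second_moment (fun i => linear_part i (delta_mx 0 j))
      (quadratic_part (delta_mx 0 j)).
  exists C => n; have := H n.
  by under eq_fun do rewrite -partsE deltaE.
have [C' FC] : exists C : 'I_N' -> R, forall j n,
    summable P (fun w => F (statistics n w) 0 j ^+ 2) /\
    mean P (fun w => F (statistics n w) 0 j ^+ 2) <= C j.
  apply: (@fin_all_exists _ (fun=> R) (fun j c => forall n,
    summable P (fun w => F (statistics n w) 0 j ^+ 2) /\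
    mean P (fun w => F (statistics n w) 0 j ^+ 2) <= c)) => j.
  have [C' H] := functional_second_moment (adj_s (delta_mx 0 j)) (adj_S (delta_mx 0 j)).
  exists C' => n; have := H n.
  by under eq_fun do rewrite -FE deltaE.
have le_sum (I : finType) (c : I -> R) j : c j <= \sum_i `|c i|.
  by rewrite (le_trans (ler_norm _))// (bigD1 j)//= lerDl sumr_ge0.
apply: (@continuous_convergence_law _ _ _ _ _ P statistics (\sum_j `|C j|)
  measurable_statistics _ _ F_ F cF F_F X mX XE _ _ Q W (\sum_j `|C' j|) mW _ _ _ f B cf fB).
- by move=> n j; exact: (UC j n).1.
- by move=> n j; exact: le_trans (UC j n).2 (le_sum _ _ _).
- by move=> n j; exact: (FC j n).1.
- by move=> n j; exact: le_trans (FC j n).2 (le_sum _ _ _).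
- move=> s theta; rewrite WE; under eq_fun do under eq_fun do rewrite FE.
  exact: functional_characteristic.
Qed.

Lemma tensmx_row (v : 'rV[R]_p) : tensmx v v = mxvec (v^T *m v).
Proof.
apply/rowP => j; case/mxvec_indexP: j => a b.
rewrite mxvecE mxvec_tens_index [RHS]mxE big_ord1 [X in _ = X * _]mxE.
have E0 : mxtens_index ((0 : 'I_1), (0 : 'I_1)) = 0 by exact: ord1.
by have := tensmxE v v 0 0 a b; rewrite E0.
Qed.

Definition tensor_covariance : 'M[R]_(p * p) :=
  covariance_mx P (fun w => tensmx (e 0%N w) (e 0%N w)).

Lemma tensor_covariance_psd : psdmx tensor_covariance.
Proof.
rewrite /tensor_covariance.
under [fun w => tensmx _ _]eq_fun do rewrite tensmx_row.
have E w a b : mxvec ((e 0%N w)^T *m e 0%N w) 0 (mxvec_index a b) = e 0%N w 0 a * e 0%N w 0 b.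
  by rewrite mxvecE mxE big_ord1 mxE.
apply: covariance_mx_psd => [i|i j].
  by case/mxvec_indexP: i => a b; under eq_fun do rewrite E; exact: summable_entry2.
case/mxvec_indexP: i => a b; case/mxvec_indexP: j => a' b'.
by under eq_fun do rewrite !E; exact: summable_entry4.
Qed.

(** The variance of the quadratic part of the limit is the quadratic form of the
    covariance matrix of the tensor square of an error row. *)
Lemma tensor_covariance_form (S : 'M[R]_p) :
  (mxvec S *m tensor_covariance *m (mxvec S)^T) 0 0 = quadratic_variance S.
Proof.
rewrite /tensor_covariance.
under [fun w => tensmx _ _]eq_fun do rewrite tensmx_row.
have E w a b : mxvec ((e 0%N w)^T *m e 0%N w) 0 (mxvec_index a b) = e 0%N w 0 a * e 0%N w 0 b.
  by rewrite mxvecE mxE big_ord1 mxE.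
rewrite covariance_mx_form => [|i|i j].
- apply: eq_mean => w; congr ((_ - _) ^+ 2).
    by rewrite dotv_mxvec trmx_mul trmxK mulmxA mxtrace_mulC mulmxA /mxtrace big_ord1.
  rewrite (_ : \row_i _ = mxvec Sigma); first by rewrite dotv_mxvec Sigma_sym.
  apply/rowP => j; case/mxvec_indexP: j => a b; rewrite mxE mxvecE -e2.
  by apply: eq_mean => w'; rewrite E.
- by case/mxvec_indexP: i => a b; under eq_fun do rewrite E; exact: summable_entry2.
- case/mxvec_indexP: i => a b; case/mxvec_indexP: j => a' b'.
  by under eq_fun do rewrite !E; exact: summable_entry4.
Qed.

End growth_curve_limit.

(** * Joint convergence of pairs of matrices *)

Section pair_convergence.
Context {R : realType}.

Lemma dotv_pair m n m' n' (s : 'rV[R]_(m * n + m' * n')) (A : 'M[R]_(m, n)) (B : 'M[R]_(m', n')) :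
  dotv s (row_mx (mxvec A) (mxvec B)) =
  \tr (vec_mx (lsubmx s) *m A^T) + \tr (vec_mx (rsubmx s) *m B^T).
Proof. by rewrite -{1}[s]hsubmxK dotv_row_mx -!dotv_mxvec !vec_mxK. Qed.

Lemma continuous_vec_mx m n : continuous (vec_mx : 'rV[R]_(m * n) -> 'M[R]_(m, n)).
Proof.
move=> u; apply: (@cvg_entries R _ (nbhs u) (@nbhs_filter _ u)) => i j.
rewrite mxE; have -> : (fun v : 'rV[R]_(m * n) => vec_mx v i j) = (fun v => v 0 (mxvec_index i j)).
  by apply/funext => v; rewrite mxE.
exact: coord_continuous.
Qed.

Lemma cvg_mxvec {I : Type} (F : set_system I) {FF : Filter F} m n
    (A : I -> 'M[R]_(m, n)) (a : 'M[R]_(m, n)) :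
  A @ F --> a -> mxvec (A z) @[z --> F] --> mxvec a.
Proof.
move=> Aa; apply: cvg_entries => i j; rewrite (ord1 i); case/mxvec_indexP: j => b c.
by under eq_fun do rewrite mxvecE; rewrite mxvecE; exact: cvg_entry.
Qed.

Lemma cvg_row_mx {I : Type} (F : set_system I) {FF : Filter F} m n1 n2
    (A : I -> 'M[R]_(m, n1)) (B : I -> 'M[R]_(m, n2)) (a : 'M[R]_(m, n1)) (b : 'M[R]_(m, n2)) :
  A @ F --> a -> B @ F --> b -> row_mx (A z) (B z) @[z --> F] --> row_mx a b.
Proof.
move=> Aa Bb; apply: cvg_entries => i j; rewrite -[j]splitK.
case: (fintype.split j) => l /=.
  by under eq_fun do rewrite row_mxEl; rewrite row_mxEl; exact: cvg_entry.
by under eq_fun do rewrite row_mxEr; rewrite row_mxEr; exact: cvg_entry.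
Qed.

Let continuous_submx n1 n2 : continuous (lsubmx : 'rV[R]_(n1 + n2) -> 'rV[R]_n1) /\
  continuous (rsubmx : 'rV[R]_(n1 + n2) -> 'rV[R]_n2).
Proof.
split=> u; apply: (@cvg_entries R _ (nbhs u) (@nbhs_filter _ u)) => i j; rewrite mxE.
  have -> : (fun v : 'rV[R]_(n1 + n2) => lsubmx v i j) = (fun v => v i (lshift n2 j)).
    by apply/funext => v; rewrite mxE.
  exact: coord_continuous.
have -> : (fun v : 'rV[R]_(n1 + n2) => rsubmx v i j) = (fun v => v i (rshift n1 j)).
  by apply/funext => v; rewrite mxE.
exact: coord_continuous.
Qed.

Lemma expectation_cvg {d d'} {T : measurableType d} {T' : measurableType d'}
    (P : probability T R) (Q : probability T' R) (f_ : nat -> T -> R) (f : T' -> R) M :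
  (forall n, measurable_fun setT (f_ n)) -> measurable_fun setT f ->
  (forall n w, `|f_ n w| <= M) -> (forall w, `|f w| <= M) ->
  mean P (f_ n) @[n --> \oo] --> mean Q f ->
  ('E_P[f_ n])%E @[n --> \oo] --> ('E_Q[f])%E.
Proof.
move=> mf_ mf f_M fM H.
rewrite (expectation_mean (summable_bounded Q mf fM)).
under eq_fun do rewrite (expectation_mean (summable_bounded P (mf_ _) (f_M _))).
by apply: cvg_EFin => //; exact: nearW.
Qed.

Context {d : measure_display} {T : measurableType d} (P : probability T R).
Context {m n m' n' : nat}.
Variables (A : nat -> T -> 'M[R]_(m, n)) (B : nat -> T -> 'M[R]_(m', n')).
Variables (mu : probability (borel_mx R m n) R) (nu : probability (borel_mx R m' n') R).

Let pair_vec (z : borel_mx R m n * borel_mx R m' n') : 'rV[R]_(m * n + m' * n') :=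
  row_mx (mxvec (z.1 : 'M[R]_(m, n))) (mxvec (z.2 : 'M[R]_(m', n'))).

Lemma measurable_pair_vec : measurable_entries pair_vec.
Proof.
apply: measurable_entries_row_mx; apply: measurable_entries_mxvec => i j.
  have mid : measurable_entries (fun u : borel_mx R m n => (u : 'M[R]_(m, n))).
    exact/measurable_entriesP/measurable_id.
  exact: measurableT_comp (mid i j) measurable_fst.
have mid : measurable_entries (fun u : borel_mx R m' n' => (u : 'M[R]_(m', n'))).
  exact/measurable_entriesP/measurable_id.
exact: measurableT_comp (mid i j) measurable_snd.
Qed.

Lemma pair_cvg_in_distribution :
  (forall t, measurable_entries (A t)) -> (forall t, measurable_entries (B t)) ->
  (forall (f : 'rV[R]_(m * n + m' * n') -> R) (M : R), continuous f ->
    (forall v, `|f v| <= M) ->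
    mean P (f \o (fun w => row_mx (mxvec (A t w)) (mxvec (B t w)))) @[t --> \oo] -->
    mean (mu \x nu)%E (f \o pair_vec)) ->
  asymptotically_independent P A B.
Proof.
move=> mA mB H; exists mu, nu => f cf [M fM].
pose g (v : 'rV[R]_(m * n + m' * n')) := f (vec_mx (lsubmx v), vec_mx (rsubmx v)).
have cg : continuous g.
  move=> v; apply: (@cvg_comp _ _ _ (fun v : 'rV[R]_(m * n + m' * n') =>
    (vec_mx (lsubmx v) : 'M[R]_(m, n), vec_mx (rsubmx v) : 'M[R]_(m', n'))) f _
    (nbhs (vec_mx (lsubmx v) : 'M[R]_(m, n), vec_mx (rsubmx v) : 'M[R]_(m', n')))); last exact: cf.
  apply: (@cvg_pair _ _ _ (nbhs v) (nbhs (vec_mx (lsubmx v) : 'M[R]_(m, n)))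
    (nbhs (vec_mx (rsubmx v) : 'M[R]_(m', n'))) _ _ _
    (fun v => vec_mx (lsubmx v)) (fun v => vec_mx (rsubmx v))).
    apply: (@continuous_comp _ _ _ lsubmx vec_mx); [exact: (@continuous_submx _ _).1|exact: continuous_vec_mx].
  apply: (@continuous_comp _ _ _ rsubmx vec_mx); [exact: (@continuous_submx _ _).2|exact: continuous_vec_mx].
have gM v : `|g v| <= M by exact: fM.
have EA t : (f \o (fun w => (A t w, B t w))) =
    g \o (fun w => row_mx (mxvec (A t w)) (mxvec (B t w))).
  by apply/funext => w; rewrite /g/= row_mxKl row_mxKr !mxvecK.
have EQ : (f \o (fun z : borel_mx R m n * borel_mx R m' n' =>
    (z.1, z.2) : 'M[R]_(m, n) * 'M[R]_(m', n'))) = g \o pair_vec.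
  by apply/funext => z; rewrite /g /pair_vec/= row_mxKl row_mxKr !mxvecK.
rewrite EQ; under eq_fun do rewrite EA.
apply: (@expectation_cvg _ _ _ _ _ _ _ _ M) => //.
- move=> t; apply: measurable_continuous_entries => //.
  by apply: measurable_entries_row_mx; exact: measurable_entries_mxvec.
- by apply: measurable_continuous_entries => //; exact: measurable_pair_vec.
- by move=> t w; exact: gM.
- by move=> z; exact: gM.
- exact: H g M cg gM.
Qed.

End pair_convergence.

Section embedding.
Context {R : realType} {k p : nat} {m : 'I_k -> nat}.

Definition embed i (A : 'M[R]_(m i, p)) : forall j, 'M[R]_(m j, p) :=
  @dfwith _ (fun j => 'M[R]_(m j, p)) (fun=> 0) i A.

Lemma embed_id i (A : 'M[R]_(m i, p)) : embed A i = A.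
Proof. exact: dfwithin. Qed.

Lemma embed_neq i j (A : 'M[R]_(m i, p)) : i != j -> embed A j = 0.
Proof. exact: dfwithout. Qed.

Lemma sum_embed i (A : 'M[R]_(m i, p)) (M : forall j, 'M[R]_(m j, p)) :
  \sum_j \tr (embed A j *m (M j)^T) = \tr (A *m (M i)^T).
Proof.
rewrite (bigD1 i)//= embed_id big1 ?addr0// => j ji.
by rewrite embed_neq 1?eq_sym// mul0mx raddf0.
Qed.

Variables (Sigma : 'M[R]_p) (Rlim : forall l : 'I_k, 'M[R]_(m l)).

Lemma linear_variance_embed i (A : 'M[R]_(m i, p)) :
  linear_variance Sigma Rlim (embed A) = \tr (A *m Sigma *m A^T *m Rlim i).
Proof.
rewrite /linear_variance (bigD1 i)//= embed_id big1 ?addr0// => j ji.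
by rewrite embed_neq 1?eq_sym// !mul0mx raddf0.
Qed.

(** Distinct blocks of the statistics have no covariance. *)
Lemma linear_varianceD i j (A : 'M[R]_(m i, p)) (B : 'M[R]_(m j, p)) : i != j ->
  linear_variance Sigma Rlim (fun l => embed A l + embed B l) =
  linear_variance Sigma Rlim (embed A) + linear_variance Sigma Rlim (embed B).
Proof.
move=> ij; rewrite /linear_variance -big_split/=; apply: eq_bigr => l _.
have [<-|il] := eqVneq i l.
  by rewrite (embed_neq B) 1?eq_sym// addr0 !mul0mx raddf0 addr0.
by rewrite (embed_neq A)// add0r !mul0mx raddf0 add0r.
Qed.

Lemma linear_variance0 : linear_variance Sigma Rlim (fun l => 0 : 'M[R]_(m l, p)) = 0.
Proof. by rewrite /linear_variance big1// => l _; rewrite !mul0mx raddf0. Qed.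

Lemma mxtrace_adjoint a b c l (s : 'M[R]_(a, b)) (B : 'M[R]_(a, c)) (M : 'M[R]_(c, l))
    (K : 'M[R]_(l, b)) : \tr (s *m (B *m M *m K)^T) = \tr (B^T *m s *m K^T *m M^T).
Proof. by rewrite !trmx_mul !mulmxA mxtrace_mulC !mulmxA. Qed.

(** The limit law of the error of one Theta_hat: the law of B M K for a Gaussian
    matrix M with covariance Rlim i between rows and Sigma between columns. *)
Lemma estimator_law_exists q i (B : 'M[R]_(m i)) (K : 'M[R]_(p, q)) :
  psdmx Sigma -> psdmx (Rlim i) ->
  exists nu : probability (borel_mx R (m i) q) R, has_characteristic nu
    (fun s => linear_variance Sigma Rlim (embed (B^T *m s *m K^T))).
Proof.
move=> /psdmx_factor[C CE] /psdmx_factor[D DE].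
have [nu nuE] := @linear_gaussian_exists R _ _ _ _ (B *m D^T) (C *m K).
exists nu => s; rewrite linear_variance_embed.
rewrite (_ : \tr (B^T *m s *m K^T *m Sigma *m (B^T *m s *m K^T)^T *m Rlim i) =
  \tr (s *m ((C *m K)^T *m (C *m K)) *m s^T *m (B *m D^T *m (B *m D^T)^T))); first exact: nuE.
rewrite CE DE !trmx_mul !trmxK !mulmxA.
by rewrite [RHS]mxtrace_mulC !mulmxA.
Qed.

End embedding.

(** * Asymptotic normality and asymptotic independence of the estimators *)

Theorem theorem4p4 (R : realType) (d : measure_display) (T : measurableType d)
    (P : probability T R) (k p : nat) (m q : 'I_k -> nat) (n0 : nat)
    (x : forall i : 'I_k, nat -> 'rV[R]_(m i))
    (Z : forall i : 'I_k, 'M[R]_(p, q i))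
    (Theta : forall i : 'I_k, 'M[R]_(m i, q i))
    (e : nat -> T -> 'rV[R]_p) (Sigma : 'M[R]_p)
    (Rlim : forall l : 'I_k, 'M[R]_(m l)) :
  let X := design x in
  let Y := observations x Z Theta e in
  let E1 := fun w => (e 0%N w)^T in
  let dSigma := fun n w =>
    Num.sqrt n%:R *: (Sigma_hat (X n) (Y n w) - Sigma) in
  let dTheta := fun i n w =>
    Num.sqrt n%:R *: (Theta_hat (X n) Z (Y n w) i - Theta i) in
  growth_curve_model P n0 x Z Theta e ->
  (forall l : 'I_k,
    (n%:R^-1 *: ((X n l)^T *m X n l)) @[n --> \oo] --> Rlim l) ->
  (forall l : 'I_k, posdefmx (Rlim l)) ->
  expectation_mx P E1 = 0 ->
  expectation_mx P (fun w => E1 w *m (E1 w)^T) = Sigma ->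
  posdefmx Sigma ->
  expectation_mx P (fun w => tensmx (E1 w) (E1 w *m (E1 w)^T)) = 0 ->
  ('E_P[fun w => (enorm (e 0%N w) ^+ 4)%R] < +oo)%E ->
  [/\ cvg_to_normal P dSigma
        (covariance_mx P (fun w => tensmx (E1 w)^T (E1 w)^T)),
      forall i : 'I_k, asymptotically_independent P dSigma (dTheta i) &
      forall i j : 'I_k, i != j ->
        asymptotically_independent P (dTheta i) (dTheta j)].
Proof.
move=> X Y E1 dSigma dTheta gcm xlim pR E1_0 E1_Sigma pS E1_third E1_fourth.
have [gn gX _ gO _ gZ me ie de _ _] := gcm.
have fineE (f : T -> R) : fine ('E_P[f])%E = mean P f by rewrite unlock.
have dotv_enorm (v : 'rV[R]_p) : enorm v ^+ 4 = dotv v v ^+ 2.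
  rewrite (exprM _ 2 2) /enorm sqr_sqrtr; last by apply: sumr_ge0 => j _; exact: sqr_ge0.
  by congr (_ ^+ 2); apply: eq_bigr => j _; rewrite expr2.
have mentry t j : measurable_fun setT (fun w => e t w 0 j).
  by have /measurable_entriesP := me t; apply.
have e4 : summable P (fun w => dotv (e 0%N w) (e 0%N w) ^+ 2).
  apply/integrableP; split.
    apply/measurable_EFinP; apply: measurable_funX.
    by apply: measurable_sum => j; exact: measurable_funM.
  move: E1_fourth; rewrite unlock; apply: le_lt_trans.
  rewrite le_eqVlt; apply/orP; left; apply/eqP; apply: eq_integral => w _ /=.
  by rewrite ger0_norm ?sqr_ge0// dotv_enorm.
have e1 a : mean P (fun w => e 0%N w 0 a) = 0.
  have := congr1 (fun M : 'cV[R]_p => M a 0) E1_0; rewrite !mxE fineE => <-.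
  by apply: eq_mean => w; rewrite /E1 mxE.
have e2 a b : mean P (fun w => e 0%N w 0 a * e 0%N w 0 b) = Sigma a b.
  rewrite -E1_Sigma mxE fineE; apply: eq_mean => w.
  by rewrite mxE big_ord1 /E1 !mxE.
have e3 a b c : mean P (fun w => e 0%N w 0 a * e 0%N w 0 b * e 0%N w 0 c) = 0.
  have := congr1 (fun M : 'M[R]_(p * p, 1 * p) => M (mxtens_index (a, b)) (mxtens_index (0, c))) E1_third.
  rewrite [LHS]mxE [RHS]mxE fineE => <-; apply: eq_mean => w.
  by rewrite tensmxE [X in _ = _ * X]mxE big_ord1 /E1 !mxE mulrA.
have sS : Sigma^T = Sigma by case: pS.
(* Both errors are expressed through the sample size and the statistics U. *)
pose U := statistics x e Sigma.
pose A n u := Sigma_hat_of (X n) Sigma (fun i => linear_part i u) (quadratic_part u).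
pose K i := invmx Sigma *m Z i *m invmx (profile_gram Z Sigma i).
pose G i u : 'M[R]_(m i, q i) := invmx (Rlim i) *m linear_part i u *m K i.
have linU n w : (fun i => linear_part i (U n w)) = cross_stat x e n w.
  by apply: functional_extensionality_dep => i; exact: linear_part_pack.
have large : \forall n \near \oo, (n0 <= n)%N /\ (0 < n)%N.
  exists (maxn n0 1) => // n /=; rewrite geq_max => /andP[-> ->].
  by [].
have SigmaE : \forall n \near \oo, forall w,
    Sigma_hat (X n) (Y n w) = A n (U n w).
  apply: filterS large => n [nn0 n_gt0] w; rewrite /A linU quadratic_part_pack.
  apply: Sigma_hatE => //.
  - by move=> i; exact: gX.
  - by move=> i j; exact: gO.
pose tau i n u : 'M[R]_(m i, q i) :=
  Theta_error_of (X n) Z Theta (fun l => linear_part l u) (A n u) i.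
pose sig n u : 'M[R]_p := Num.sqrt n%:R *: (A n u - Sigma).
have dSigmaE : \forall n \near \oo, forall w, dSigma n w = sig n (U n w).
  by apply: filterS SigmaE => n nE w; rewrite /dSigma nE.
have dThetaE i : \forall n \near \oo, forall w, dTheta i n w = tau i n (U n w).
  apply: filterS2 large SigmaE => n [nn0 n_gt0] nE w.
  rewrite /tau -nE linU; apply: Theta_hatE => //.
  - by move=> l; exact: gX.
  - by move=> l j; exact: gO.
(* Convergence is joint in the statistics and in the sample size, as a continuous
   mapping theorem for varying maps requires. *)
have sig_cvg u : sig z.2 z.1 @[z --> (nbhs u, \oo)] --> quadratic_part u.
  apply: (@Sigma_error_cvg _ _ _ _ _ _ Rlim pR xlim _ (filter_prod (nbhs u) \oo) _ snd
    (fun z i => linear_part i z.1) (fun z => quadratic_part z.1) (fun i => linear_part i u)).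
  - exact: cvg_snd.
  - by move=> i; apply: (cvg_comp fst _ cvg_fst); exact: continuous_linear_part.
  - by apply: (cvg_comp fst _ cvg_fst); exact: continuous_quadratic_part.
have tau_cvg i u : tau i z.2 z.1 @[z --> (nbhs u, \oo)] --> G i u.
  apply: (@Theta_error_of_cvg _ _ _ _ _ _ Z Theta Sigma Rlim pS pR gZ xlim _ (filter_prod (nbhs u) \oo) _ snd
    (fun z i => linear_part i z.1) (fun z => quadratic_part z.1) (fun i => linear_part i u)
    (quadratic_part u)).
  - exact: cvg_snd.
  - by move=> l; apply: (cvg_comp fst _ cvg_fst); exact: continuous_linear_part.
  - by apply: (cvg_comp fst _ cvg_fst); exact: continuous_quadratic_part.
have cG i : continuous (G i).
  move=> u; apply: (@cvg_mulmx R _ (nbhs u) (@nbhs_filter _ u) _ _ _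
    (fun v => invmx (Rlim i) *m linear_part i v) (fun=> K i)); last exact: cvg_cst.
  apply: (@cvg_mulmx R _ (nbhs u) (@nbhs_filter _ u) _ _ _ (fun=> invmx (Rlim i)) (linear_part i)).
    exact: cvg_cst.
  exact: continuous_linear_part.
have mY n : measurable_entries (Y n).
  apply: measurable_entriesD; first exact: measurable_entries_cst.
  exact: measurable_errors.
have mcst a b (C : 'M[R]_(a, b)) : measurable_entries (fun _ : T => C).
  exact: measurable_entries_cst.
have mdSigma n : measurable_entries (dSigma n).
  apply: measurable_entriesZ; first exact: measurable_cst.
  by apply: measurable_entriesB => //; exact: measurable_Sigma_hat.
have mdTheta i n : measurable_entries (dTheta i n).
  apply: measurable_entriesZ; first exact: measurable_cst.
  by apply: measurable_entriesB => //; exact: measurable_Theta_hat.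
have limit_law := statistics_limit_law me ie de xlim gO e4 e1 e2 e3 sS.
have psdV := tensor_covariance_psd me e4.
have quad0 : quadratic_variance P e Sigma 0 = 0.
  rewrite /quadratic_variance (_ : (fun w => _) = cst 0) ?mean_cst//.
  by apply/funext => w; rewrite mulmx0 !mul0mx mxtrace0 mxE subrr expr0n.
split.
(* In (a) the limit reads off the quadratic part of the statistics only. *)
- rewrite (_ : covariance_mx P _ = tensor_covariance P e); last first.
    by congr covariance_mx; apply/funext => w; rewrite /E1 trmxK.
  have [mu [muN mu_char]] := multivariate_normal_exists psdV.
  exists mu => // f cf [M fM].
  have mid : measurable_entries (fun v : borel_mx R (p * p) 1 => (v : 'cV[R]_(p * p))).
    exact/measurable_entriesP/measurable_id.
  pose g (v : 'rV[R]_(p * p)) := f v^T.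
  have cg : continuous g.
    move=> v; apply: (@continuous_comp _ _ _ (fun v : 'rV[R]_(p * p) => v^T) f); last exact: cf.
    apply: (@cvg_trmx R _ (nbhs v) (@nbhs_filter _ v) _ _ id); exact: cvg_id.
  apply: (@expectation_cvg _ _ _ _ _ _ _ _ _ M).
  + move=> n; apply: measurable_continuous_entries => //.
    by apply: measurable_entries_tr; exact: measurable_entries_mxvec.
  + exact: measurable_continuous_entries.
  + by move=> n w; exact: fM.
  + by move=> w; exact: fM.
  have := limit_law (p * p)%N (fun n u => mxvec (sig n u)) (fun u => mxvec (quadratic_part u))
    (fun _ _ => 0) vec_mx (fun n w => mxvec (dSigma n w)) _ _ mu
    (fun v : borel_mx R (p * p) 1 => (v : 'cV[R]_(p * p))^T) _ _ _ _ _ _ _ g M cg.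
  rewrite (_ : g \o _ = f \o (fun v : borel_mx R (p * p) 1 => (v : 'cV[R]_(p * p)))); last first.
    by apply/funext => v; rewrite /g/= trmxK.
  apply.
  + move=> u; apply: (@cvg_mxvec R _ (nbhs u) (@nbhs_filter _ u)).
    exact: continuous_quadratic_part.
  + by move=> u; apply: cvg_mxvec; exact: sig_cvg.
  + move=> s u; rewrite big1 ?add0r => [|l _]; last by rewrite mul0mx mxtrace0.
    by rewrite -dotv_mxvec vec_mxK.
  + by move=> n; exact: measurable_entries_mxvec.
  + by apply: filterS dSigmaE => n nE w; rewrite nE.
  + exact: measurable_entries_tr.
  + move=> s; rewrite linear_variance0 add0r -(tensor_covariance_form me e4 e2 sS) vec_mxK.
    exact: mu_char.
  + by move=> v; exact: fM.
(* In (b) the adjoint of the limit map sends the two components to the quadratic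
   part and to the block i, whose variances add as they do for a product law. *)
- move=> i.
  have [mu muV] := gaussian_matrix_exists psdV.
  have [nu nuV] := @estimator_law_exists R k p m Sigma Rlim (q i) i (invmx (Rlim i)) (K i)
    (posdefmx_psd pS) (posdefmx_psd (pR i)).
  apply: (@pair_cvg_in_distribution _ _ _ P _ _ _ _ _ _ mu nu) => // g M cg gM.
  apply: (limit_law _ (fun n u => row_mx (mxvec (sig n u)) (mxvec (tau i n u)))
    (fun u => row_mx (mxvec (quadratic_part u)) (mxvec (G i u)))
    (fun s => embed ((invmx (Rlim i))^T *m vec_mx (rsubmx s) *m (K i)^T))
    (fun s => vec_mx (lsubmx s)) _ _ _ _ _ _ _ _ _ _ _ _ g M cg gM).
  + move=> u; apply: (@cvg_row_mx R _ (nbhs u) (@nbhs_filter _ u));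
      apply: (@cvg_mxvec R _ (nbhs u) (@nbhs_filter _ u)).
      exact: continuous_quadratic_part.
    exact: cG.
  + by move=> u; apply: cvg_row_mx; apply: cvg_mxvec; [exact: sig_cvg|exact: tau_cvg].
  + by move=> s u; rewrite dotv_pair sum_embed mxtrace_adjoint addrC.
  + by move=> n; apply: measurable_entries_row_mx; exact: measurable_entries_mxvec.
  + by apply: filterS2 dSigmaE (dThetaE i) => n nS nT w; rewrite nS nT.
  + exact: measurable_pair_vec.
  + move=> s; under eq_fun do rewrite dotv_pair.
    rewrite addrC -(tensor_covariance_form me e4 e2 sS).
    exact: product_characteristic muV nuV _ _.
(* In (c) the two components go to distinct blocks, and again variances add. *)
- move=> i j ij.
  have law l := @estimator_law_exists R k p m Sigma Rlim (q l) l (invmx (Rlim l)) (K l)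
    (posdefmx_psd pS) (posdefmx_psd (pR l)).
  have [mu muV] := law i; have [nu nuV] := law j.
  apply: (@pair_cvg_in_distribution _ _ _ P _ _ _ _ _ _ mu nu) => // g M cg gM.
  apply: (limit_law _ (fun n u => row_mx (mxvec (tau i n u)) (mxvec (tau j n u)))
    (fun u => row_mx (mxvec (G i u)) (mxvec (G j u)))
    (fun s l => embed ((invmx (Rlim i))^T *m vec_mx (lsubmx s) *m (K i)^T) l +
      embed ((invmx (Rlim j))^T *m vec_mx (rsubmx s) *m (K j)^T) l)
    (fun=> 0) _ _ _ _ _ _ _ _ _ _ _ _ g M cg gM).
  + by move=> u; apply: (@cvg_row_mx R _ (nbhs u) (@nbhs_filter _ u));
      apply: (@cvg_mxvec R _ (nbhs u) (@nbhs_filter _ u)); exact: cG.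
  + by move=> u; apply: cvg_row_mx; apply: cvg_mxvec; exact: tau_cvg.
  + move=> s u; rewrite dotv_pair mul0mx mxtrace0 addr0.
    under eq_bigr do rewrite mulmxDl mxtraceD.
    by rewrite big_split/= !sum_embed !mxtrace_adjoint.
  + by move=> n; apply: measurable_entries_row_mx; exact: measurable_entries_mxvec.
  + by apply: filterS2 (dThetaE i) (dThetaE j) => n nS nT w; rewrite nS nT.
  + exact: measurable_pair_vec.
  + move=> s; under eq_fun do rewrite dotv_pair.
    rewrite quad0 addr0 linear_varianceD//.
    exact: product_characteristic muV nuV _ _.
Qed.
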